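(* Let $F$ be a $p$-adic field and $\mathbf G$ a connected reductive group over $F$, with Iwahori-Weyl group $W$ over $F$ and Iwahori-Weyl group $\breve W$ over $\breve F$. The natural embedding $W=\breve W^\sigma\hookrightarrow\breve W$ induces an injection $$i: W/\!\!/ W \hookrightarrow \breve W /\!\!/_{\sigma} \breve W_a .$$ That is, each straight (ordinary) conjugacy class $\nu$ of $W$ is contained in a single straight $\breve W_a$-orbit $i(\nu)$ on $\breve W$ for the $\sigma$-twisted conjugation action, and the resulting map $\nu\mapsto i(\nu)$ is injective.
   Context: Groups. $F$ is a $p$-adic field, $\breve F$ the completion of its maximal unramified extension, $\sigma$ the Frobenius automorphism of $\breve F/F$; $\mathbf G$ is a connected reductive group over $F$, $G=\mathbf G(F)$, $\breve G=\mathbf G(\breve F)$; $\sigma$ also denotes the induced automorphism of $\breve G$, so $G=\breve G^\sigma$. Iwahori-Weyl group over $F$. Fix a maximal $F$-split torus $\mathbf A$ of $\mathbf G$ with centralizer $\mathbf M$ and normalizer $\mathbf N$. Put $W=\mathbf N(F)/\mathbf M(F)_1$, where $\mathbf M(F)_1$ is the unique parahoric subgroup of $\mathbf M(F)$. Fix an alcove $\mathfrak a_C$ in the apartment $\mathscr A$ of $\mathbf A$ over $F$. Let $G_1\subseteq G$ be the subgroup generated by all parahoric subgroups and let $W_a\subseteq W$ be the image of $\mathbf N(F)\cap G_1$ (the affine Weyl group). Then $W=W_a\rtimes\Omega$ with $\Omega$ the stabilizer of $\mathfrak a_C$. The length function $\ell$ on $W$ is the Coxeter length on $W_a$ with respect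 to the reflections in the walls of $\mathfrak a_C$, extended by $\ell(w\tau)=\ell(w)$ for $w\in W_a$, $\tau\in\Omega$. Iwahori-Weyl group over $\breve F$. Let $\mathbf S\supseteq\mathbf A$ be a maximal $\breve F$-split torus defined over $F$, $\mathbf T$ its centralizer, $\mathbf N_{\mathbf S}$ its normalizer, and $\breve{\mathscr A}$ its apartment over $\breve F$, so that $\mathscr A=\breve{\mathscr A}^\sigma$. Put $\breve W=\mathbf N_{\mathbf S}(\breve F)/\mathbf T(\breve F)_1$, where $\mathbf T(\breve F)_1$ is the unique parahoric subgroup of $\mathbf T(\breve F)$. Fix a $\sigma$-stable alcove $\breve{\mathfrak a}_C\subseteq\breve{\mathscr A}$ containing $\mathfrak a_C$. Let $\breve G_1\subseteq\breve G$ be the subgroup generated by all parahoric subgroups, $\breve W_a\subseteq\breve W$ the image of $\mathbf N_{\mathbf S}(\breve F)\cap\breve G_1$, and $\breve\Omega$ the stabilizer of $\breve{\mathfrak a}_C$; then $\breve W=\breve W_a\rtimes\breve\Omega$, with length function $\breve\ell$ defined as for $W$. One has natural identifications $W=\breve W^\sigma$, $W_a=\breve W_a^\sigma$, $\Omega=\breve\Omega^\sigma$. Straightness. An element $x\in W$ is straight if $\ell(x^n)=n\ell(x)$ for all $n\ge 0$; a conjugacy class of $W$ is straight if it contains a straight element; $W/\!\!/ W$ is the set of straight conjugacy classes of $W$. An element $x\in\breve W$ is $\sigma$-straight if $\breve\ell(x\sigma(x)\cdots\sigma^{n-1}(x))=n\breve\ell(x)$ for all $n\ge0$. The group $\breve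 W_a$ acts on $\breve W$ by $\sigma$-twisted conjugation $w\cdot_\sigma w'=ww'\sigma(w)^{-1}$; an orbit is straight if it contains a $\sigma$-straight element; $\breve W/\!\!/_\sigma\breve W_a$ is the set of straight orbits. *)

(* Defs.v *)
(* The p-adic field F, the completion L of its maximal unramified extension,
   the reductive group, its tori, its parahoric subgroups and its Iwahori-Weyl
   groups over F and over L are all defined here.  The theorems of Steinberg,
   Borel-Tits and Bruhat-Tits describing these objects are collected in the
   record [bruhat_tits] near the end. *)
From HB Require Import structures.
From mathcomp Require Import all_boot all_order all_algebra all_fingroup all_field.
From mathcomp Require Import mpoly.
From mathcomp Require Import boolp classical_sets functions cardinality reals.

Set Implicit Arguments.
Unset Strict Implicit.
Unset Printing Implicit Defensive.

Import Order.TTheory GRing.Theory Num.Theory.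
Local Open Scope classical_set_scope.
Local Open Scope ring_scope.

Section Valuations.
Variables (k : fieldType) (v : k -> int).

(* The value of v at 0 is irrelevant: [vge m x] reads "v(x) >= m" with
   v(0) = +oo. *)
Definition vge (m : int) (x : k) : Prop := x = 0 \/ (m <= v x)%R.

Definition discrete_valuation : Prop :=
  [/\ forall x y, x != 0 -> y != 0 -> v (x * y) = v x + v y,
      forall m x y, vge m x -> vge m y -> vge m (x + y) &
      exists2 x, x != 0 & v x = 1].

Definition valuation_complete : Prop :=
  forall u : nat -> k,
    (forall m, exists N, forall i j, (N <= i)%N -> (N <= j)%N ->
       vge m (u i - u j)) ->
    exists l, forall m, exists N, forall i, (N <= i)%N -> vge m (u i - l).

(* The residue field has exactly q elements. *)
Definition residue_card (q : nat) : Prop :=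
  exists s : seq k,
    [/\ size s = q, uniq s,
        {in s, forall x, vge 0 x},
        {in s &, forall x y, vge 1 (x - y) -> x = y} &
        forall x, vge 0 x -> exists2 y, y \in s & vge 1 (x - y)].

Definition residue_alg_closed : Prop :=
  forall p : {poly k}, p \is monic -> (1 < size p)%N ->
    (forall i, vge 0 p`_i) -> exists2 x, vge 0 x & vge 1 p.[x].

End Valuations.

(* F is a finite extension of some Q_p, i.e. a complete discretely valued field
   of characteristic 0 with finite residue field.  L/F is complete discretely
   valued of ramification index 1 (vL extends vF and both are normalised), and
   its residue field is an algebraic closure of that of F; this characterises
   the completion of the maximal unramified extension, and sig is then its
   Frobenius automorphism.  K is an algebraic closure of L. *)
Record padic_datum := PadicDatum {
  pF : fieldType;
  pL : fieldType;
  pK : closedFieldType;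
  pq : nat;
  vF : pF -> int;
  vL : pL -> int;
  iFL : {rmorphism pF -> pL};
  iLK : {rmorphism pL -> pK};
  sig : {rmorphism pL -> pL};
  pF_char : [pchar pF] =i pred0;
  pF_val : discrete_valuation vF;
  pF_complete : valuation_complete vF;
  pF_residue : residue_card vF pq;
  pL_val : discrete_valuation vL;
  pL_complete : valuation_complete vL;
  pL_unramified : forall x, x != 0 -> vL (iFL x) = vF x;
  pL_residue_algebraic : forall x, vge vL 0 x ->
    exists2 m, (0 < m)%N & vge vL 1 (x ^+ (pq ^ m) - x);
  pL_residue_closed : residue_alg_closed vL;
  sig_bij : bijective sig;
  sig_F : forall x, sig (iFL x) = iFL x;
  sig_val : forall x, x != 0 -> vL (sig x) = vL x;
  sig_frobenius : forall x, vge vL 0 x -> vge vL 1 (sig x - x ^+ pq);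
  pK_algebraic : forall z : pK, algebraicOver iLK z
}.

Arguments vF : clear implicits.
Arguments vL : clear implicits.
Arguments iFL : clear implicits.
Arguments iLK : clear implicits.
Arguments sig : clear implicits.

(* Linear algebraic groups over a field of characteristic 0, as Zariski closed
   subgroups of GL_n with points in an algebraically closed field. *)
Section LinearAlgebraicGroups.
Variable n : nat.

Definition zlocus (k E : fieldType) (f : k -> E) (I : set {mpoly k[n * n]}) :
    set 'M[E]_n :=
  [set g | g \in unitmx /\
     forall p, I p -> (map_mpoly f p).@[fun i => mxvec g 0 i] = 0].

Definition defined_over (k E : fieldType) (f : k -> E) (X : set 'M[E]_n) :
  Prop := exists I, X = zlocus f I.

Definition mx_subgroup (E : fieldType) (X : set 'M[E]_n) : Prop :=
  [/\ X `<=` [set g | g \in unitmx], X 1%:M,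
      forall g h, X g -> X h -> X (g *m h) &
      forall g, X g -> X (invmx g)].

Definition generated (E : fieldType) (X : set 'M[E]_n) : set 'M[E]_n :=
  [set g | forall H, mx_subgroup H -> X `<=` H -> H g].

Definition mx_conj (E : fieldType) (g x : 'M[E]_n) := g *m x *m invmx g.

Definition centralizer (E : fieldType) (G X : set 'M[E]_n) : set 'M[E]_n :=
  [set g | G g /\ forall x, X x -> mx_conj g x = x].

Definition normalizer (E : fieldType) (G X : set 'M[E]_n) : set 'M[E]_n :=
  [set g | G g /\ [set mx_conj g x | x in X] = X].

Variable K : closedFieldType.

Definition zclosed (X : set 'M[K]_n) : Prop := defined_over idfun X.

Definition zconnected (X : set 'M[K]_n) : Prop :=
  forall Y Z, zclosed Y -> zclosed Z -> Y `|` Z = X -> Y `&` Z = set0 ->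
    Y = set0 \/ Z = set0.

Definition unipotent (g : 'M[K]_n) : Prop := char_poly g = ('X - 1) ^+ n.

(* The unipotent radical is trivial. *)
Definition reductive (G : set 'M[K]_n) : Prop :=
  forall U, mx_subgroup U -> zclosed U -> zconnected U -> U `<=` G ->
    G `<=` normalizer G U -> (forall u, U u -> unipotent u) ->
    U = [set 1%:M].

Variables (k : fieldType) (f : k -> K).

Definition connected_reductive_group (G : set 'M[K]_n) : Prop :=
  [/\ mx_subgroup G, defined_over f G, zconnected G & reductive G].

Definition diagonalizes (h : 'M[k]_n) (X : set 'M[K]_n) : Prop :=
  h \in unitmx /\ forall x, X x -> is_diag_mx (mx_conj (map_mx f h) x).

Definition split_torus (A : set 'M[K]_n) : Prop :=
  [/\ mx_subgroup A, zclosed A, zconnected A & exists h, diagonalizes h A].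

Definition maximal_split_torus (G A : set 'M[K]_n) : Prop :=
  [/\ split_torus A, A `<=` G &
      forall A', split_torus A' -> A' `<=` G -> A `<=` A' -> A' = A].

End LinearAlgebraicGroups.

(* A connected reductive group G over F, a maximal F-split torus A, and a
   maximal L-split torus S containing A and defined over F.  The matrix gdiag
   diagonalizes S over L; it is only used as a coordinate system on the
   character group of S. *)
Record group_datum (D : padic_datum) := GroupDatum {
  gdim : nat;
  gG : set 'M[pK D]_gdim;
  gA : set 'M[pK D]_gdim;
  gS : set 'M[pK D]_gdim;
  gdiag : 'M[pL D]_gdim;
  gG_reductive : connected_reductive_group (iLK D \o iFL D) gG;
  gA_max : maximal_split_torus (iLK D \o iFL D) gG gA;
  gS_max : maximal_split_torus (iLK D) gG gS;
  gS_def : defined_over (iLK D \o iFL D) gS;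
  gAS : gA `<=` gS;
  gdiagP : diagonalizes (iLK D) gdiag gS
}.

Arguments gG {D} B _ : rename.
Arguments gA {D} B _ : rename.
Arguments gS {D} B _ : rename.
Arguments gdiag {D} B : rename.

Section Groups.
Variables (D : padic_datum) (B : group_datum D).
Local Notation n := (gdim B).
Local Notation L := (pL D).
Local Notation K := (pK D).

Definition ptsL (H : set 'M[K]_n) : set 'M[L]_n :=
  [set g | H (map_mx (iLK D) g)].

Definition frob (g : 'M[L]_n) : 'M[L]_n := map_mx (sig D) g.

Definition ptsF (H : set 'M[K]_n) : set 'M[L]_n :=
  ptsL H `&` [set g | frob g = g].

Definition gM := centralizer (gG B) (gA B).
Definition gN := normalizer (gG B) (gA B).
Definition gT := centralizer (gG B) (gS B).
Definition gNS := normalizer (gG B) (gS B).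

Definition integral_over_OL (E : fieldExtType L) (x : E) : Prop :=
  exists p : {poly L}, [/\ p \is monic, forall i, vge (vL D) 0 p`_i &
    root (map_poly (in_alg E) p) x].

(* T(L)_1.  For a torus this is the kernel of the Kottwitz homomorphism
   T(L) -> X_*(T)_I, that is, the image under the norm map T(E) -> T(L) of the
   maximal bounded subgroup of T(E), for any finite Galois E/L splitting T
   (T(E) is a cohomologically trivial Galois module).  The factors of the
   product below lie in T(E) and commute. *)
Definition torus_parahoric : set 'M[L]_n :=
  [set t | exists (E : splittingFieldType L) (e : {rmorphism E -> K})
             (h t' : 'M[E]_n),
    [/\ galois 1 {:E}, forall x : L, e (in_alg E x) = iLK D x,
        diagonalizes e h gT,
        [/\ t' \in unitmx, gT (map_mx e t') &
            forall i, integral_over_OL (mx_conj h t' i i) /\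
                      integral_over_OL (mx_conj h t' i i)^-1] &
        map_mx (in_alg E) t =
          \big[mulmx/1%:M]_(gam in ('Gal({:E} / 1))%g) map_mx gam t']].

(* The i-th diagonal character of S; these generate the character group of S,
   and c : 'I_n -> int stands for the character prod_i wt_i^(c_i). *)
Definition wt (s : 'M[L]_n) (i : 'I_n) : L := mx_conj (gdiag B) s i i.

Definition chr (c : 'I_n -> int) (s : 'M[L]_n) : L := \prod_i wt s i ^ c i.

Section Apartment.
Variable R : realType.

Definition pairing (c : 'I_n -> int) (x : 'rV[R]_n) : R :=
  \sum_i (c i)%:~R * x 0 i.

(* X_*(S) (x) R = Hom(X^*(S), R), in the coordinates dual to the wt_i; an
   origin of the apartment being chosen, this is the apartment of S over L. *)
Definition apt : set 'rV[R]_n :=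
  [set x | forall c, (forall s, ptsL (gS B) s -> chr c s = 1) ->
             pairing c x = 0].

Definition same_wt (i j : 'I_n) : bool :=
  `[< forall s, ptsL (gS B) s -> wt s i = wt s j >].

(* The determinant of t in T(L) on the weight space of wt_i: a character of T
   over L, with restriction wt_i^m to S, m the dimension of the space. *)
Definition wt_det (i : 'I_n) (t : 'M[L]_n) : L :=
  \det (\matrix_(j, l) if same_wt i j && same_wt i l
                       then mx_conj (gdiag B) t j l else (j == l)%:R).

Definition is_quotient (W : groupType) (pi : 'M[L]_n -> W)
    (X Y : set 'M[L]_n) : Prop :=
  [/\ forall g h, X g -> X h -> pi (g *m h) = (pi g * pi h)%g,
      forall w, exists2 g, X g & pi g = w,
      Y `<=` X &
      forall g, X g -> (pi g = 1%g <-> Y g)].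

Variables (W : groupType) (pi : 'M[L]_n -> W) (sW : W -> W).
Variables (act : W -> 'rV[R]_n -> 'rV[R]_n) (sA : 'rV[R]_n -> 'rV[R]_n).

(* The Iwahori-Weyl group acts on the apartment: the linear part of the action
   is the natural one on cocharacters, and t in T(L) acts by the translation by
   nu(t) with <chi, nu(t)> = - v(chi(t)) for every L-rational character chi of
   T.  This determines the action up to a translation. *)
Definition apartment_action : Prop :=
  [/\ forall w x, apt x -> apt (act w x),
      forall x, apt x -> act 1%g x = x,
      forall w w' x, apt x -> act (w * w')%g x = act w (act w' x),
      forall g i j, ptsL gNS g ->
        (forall s, ptsL (gS B) s -> wt s j = wt (mx_conj g s) i) ->
        forall x y, apt x -> apt y ->
          act (pi g) x 0 i - act (pi g) y 0 i = x 0 j - y 0 j &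
      forall t i x, ptsL gT t -> apt x ->
        (act (pi t) x 0 i - x 0 i) *+ #|[set j | same_wt i j]%SET| =
          - (vL D (wt_det i t))%:~R].

Definition apartment_frobenius : Prop :=
  [/\ forall x, apt x -> apt (sA x),
      forall i j,
        (forall s, ptsL (gS B) s -> sig D (wt s j) = wt (frob s) i) ->
        forall x y, apt x -> apt y ->
          sA x 0 i - sA y 0 i = x 0 j - y 0 j &
      forall w x, apt x -> sA (act w x) = act (sW w) (sA x)].

(* The root subgroup of a root c (trivial when no positive multiple of c is a
   root): in characteristic 0, the elements u of G(L) such that u - 1 only has
   components of weight a positive multiple of c. *)
Definition root_group (c : 'I_n -> int) : set 'M[L]_n :=
  [set u | ptsL (gG B) u /\
     forall j l, mx_conj (gdiag B) u j l != (j == l)%:R ->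
       exists2 m, (0 < m)%N &
         forall s, ptsL (gS B) s -> wt s j / wt s l = chr c s ^+ m].

(* U_{c,x}.  For u != 1 in U_c there is a unique m in U_{-c} u U_{-c} that
   normalizes S; it acts on the apartment as a reflection, and u belongs to
   U_{c,x} when x is on the side of c of the mirror of m. *)
Definition filtered_root_group (c : 'I_n -> int) (x : 'rV[R]_n) :
    set 'M[L]_n :=
  [set u | root_group c u /\
     exists u1 u2 y,
       [/\ root_group (fun i => - c i) u1, root_group (fun i => - c i) u2,
           ptsL gNS (u1 *m u *m u2),
           apt y /\ act (pi (u1 *m u *m u2)) y = y &
           0 <= pairing c x - pairing c y]].

Definition nontrivial_chr (c : 'I_n -> int) : Prop :=
  exists2 s, ptsL (gS B) s & chr c s != 1.

(* Here H is a connected reductive subgroup of G containing T (below, H is G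
   or M); it is quasi-split over L. *)
Definition parahoric_at (H : set 'M[K]_n) (x : 'rV[R]_n) : set 'M[L]_n :=
  generated (torus_parahoric `|`
    [set u | ptsL H u /\
             exists2 c, nontrivial_chr c & filtered_root_group c x u]).

Definition parahoricL (H : set 'M[K]_n) (P : set 'M[L]_n) : Prop :=
  exists g x, [/\ ptsL H g, apt x &
                  P = [set mx_conj g p | p in parahoric_at H x]].

Definition parahoricF (H : set 'M[K]_n) (P : set 'M[L]_n) : Prop :=
  exists Q, [/\ parahoricL H Q, [set frob g | g in Q] = Q &
                P = Q `&` [set g | frob g = g]].

Definition gen_parahoricL (H : set 'M[K]_n) : set 'M[L]_n :=
  generated [set g | exists2 P, parahoricL H P & P g].

Definition gen_parahoricF (H : set 'M[K]_n) : set 'M[L]_n :=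
  generated [set g | exists2 P, parahoricF H P & P g].

End Apartment.
End Groups.

Arguments gM {D} B _.
Arguments gN {D} B _.
Arguments gT {D} B _.
Arguments gNS {D} B _.
Arguments torus_parahoric {D} B _.
Arguments apt {D} B R _.

(* Alcoves and Coxeter length for a group W acting on an affine space E, with
   respect to the affine reflections that belong to a subgroup Wa. *)
Section Coxeter.
Variables (R : realType) (n : nat) (W : groupType).
Variables (act : W -> 'rV[R]_n -> 'rV[R]_n) (E : set 'rV[R]_n) (Wa : set W).

Definition hyperplane (H : set 'rV[R]_n) : Prop :=
  [/\ H !=set0, H <> E &
      exists (c : 'rV[R]_n) (a : R),
        H = E `&` [set x | \sum_i c 0 i * x 0 i = a]].

Definition fixset (w : W) : set 'rV[R]_n := E `&` [set x | act w x = x].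

Definition mirror (H : set 'rV[R]_n) : Prop :=
  hyperplane H /\ exists2 w, Wa w & H = fixset w.

Definition segment_pt (x y : 'rV[R]_n) (t : R) : 'rV[R]_n :=
  (1 - t) *: x + t *: y.

(* Connected components of the complement of the mirrors. *)
Definition alcove (C : set 'rV[R]_n) : Prop :=
  exists x, [/\ E x, forall H, mirror H -> ~ H x &
    C = [set y | E y /\ forall t, 0 <= t <= 1 ->
                   forall H, mirror H -> ~ H (segment_pt x y t)]].

(* H contains a point in the closure of C that lies on no other mirror. *)
Definition wall (C H : set 'rV[R]_n) : Prop :=
  mirror H /\
  exists y, [/\ H y, forall H', mirror H' -> H' y -> H' = H &
    exists2 x, C x & forall t, 0 < t <= 1 -> C (segment_pt y x t)].

Definition simple_reflection (C : set 'rV[R]_n) (w : W) : Prop :=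
  Wa w /\ wall C (fixset w).

Definition alcove_stabilizer (C : set 'rV[R]_n) : set W :=
  [set w | [set act w x | x in C] = C].

Definition has_word (C : set 'rV[R]_n) (w : W) (l : nat) : Prop :=
  exists (s : seq W) (tau : W),
    [/\ size s = l, forall r, r \in s -> simple_reflection C r,
        alcove_stabilizer C tau & w = ((\prod_(r <- s) r) * tau)%g].

(* Coxeter length on Wa, extended by length (w * tau) = length w for tau in
   the stabilizer of C. *)
Definition length (C : set 'rV[R]_n) (w : W) : nat :=
  xget 0%N [set l | has_word C w l /\
                    forall l', has_word C w l' -> (l <= l')%N].

(* (Wa, simple reflections) is an affine reflection group with alcove C, and
   W is the semidirect product of Wa and of the stabilizer of C. *)
Record affine_weyl (C : set 'rV[R]_n) : Prop := AffineWeyl {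
  aw_faithful : forall w, Wa w -> (forall x, E x -> act w x = x) -> w = 1%g;
  aw_locally_finite : forall x, E x -> exists2 eps : R, 0 < eps &
    finite_set [set H | mirror H /\
      exists2 y, H y & forall i, `|y 0 i - x 0 i| < eps];
  aw_generated : forall w, Wa w -> exists2 s : seq W,
    (forall r, r \in s -> simple_reflection C r) & w = (\prod_(r <- s) r)%g;
  aw_subgroup : [/\ Wa 1%g, forall w w', Wa w -> Wa w' -> Wa (w * w')%g &
                    forall w, Wa w -> Wa w^-1%g];
  aw_normal : forall w g, Wa w -> Wa (g * w * g^-1)%g;
  aw_prod : forall w, exists u tau,
    [/\ Wa u, alcove_stabilizer C tau & w = (u * tau)%g];
  aw_disjoint : Wa `&` alcove_stabilizer C = [set 1%g]
}.

End Coxeter.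

(* The Iwahori-Weyl group over L, with its Frobenius and its apartment. *)
Record breve_datum (D : padic_datum) (B : group_datum D) (R : realType) :=
  BreveDatum {
  bW : groupType;
  bpi : 'M[pL D]_(gdim B) -> bW;
  bsig : bW -> bW;
  bact : bW -> 'rV[R]_(gdim B) -> 'rV[R]_(gdim B);
  bsA : 'rV[R]_(gdim B) -> 'rV[R]_(gdim B);
  bpiP : is_quotient bpi (ptsL (gNS B)) (torus_parahoric B);
  bsigP : forall g, ptsL (gNS B) g -> bsig (bpi g) = bpi (frob g);
  bactP : apartment_action bpi bact;
  bsAP : apartment_frobenius bsig bact bsA
}.

Arguments bW {D B R} I : rename.
Arguments bpi {D B R} I _ : rename.
Arguments bsig {D B R} I _ : rename.
Arguments bact {D B R} I _ _ : rename.
Arguments bsA {D B R} I _ : rename.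

Section Breve.
Variables (D : padic_datum) (B : group_datum D) (R : realType).
Variable I : breve_datum B R.

Definition bparahoricF := parahoricF (bpi I) (bact I).
Definition bG1L : set 'M[pL D]_(gdim B) :=
  gen_parahoricL (bpi I) (bact I) (gG B).
Definition bG1F : set 'M[pL D]_(gdim B) :=
  gen_parahoricF (bpi I) (bact I) (gG B).

Definition bWa : set (bW I) :=
  [set bpi I g | g in ptsL (gNS B) `&` bG1L].

Definition balcove := alcove (bact I) (apt B R) bWa.

(* The apartment of A over F. *)
Definition aptF : set 'rV[R]_(gdim B) :=
  apt B R `&` [set x | bsA I x = x].

End Breve.

Arguments bG1L {D B R} I _.
Arguments bG1F {D B R} I _.
Arguments bWa {D B R} I _.
Arguments aptF {D B R} I _.

(* The Iwahori-Weyl group over F, the natural embedding into the one over L,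
   induced by N_S(F) -> N(F), and the two base alcoves. *)
Record iw_datum (D : padic_datum) (B : group_datum D) (R : realType) :=
  IWDatum {
  iwB :> breve_datum B R;
  iwM1 : set 'M[pL D]_(gdim B);
  iwW : groupType;
  iwpi : 'M[pL D]_(gdim B) -> iwW;
  iwj : iwW -> bW iwB;
  iwCb : set 'rV[R]_(gdim B);
  iwC : set 'rV[R]_(gdim B);
  iwM1P : unique (bparahoricF iwB (gM B)) iwM1;
  iwpiP : is_quotient iwpi (ptsF (gN B)) iwM1;
  iwjP : forall g, ptsF (gNS B) g -> iwj (iwpi g) = bpi iwB g;
  iwCbP : balcove iwB iwCb;
  iwCb_sig : [set bsA iwB x | x in iwCb] = iwCb;
  iwCP : alcove (fun w => bact iwB (iwj w)) (aptF iwB)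
           [set iwpi g | g in ptsF (gN B) `&` bG1F iwB] iwC;
  iwC_Cb : iwC `<=` iwCb
}.

Arguments iwW {D B R} I : rename.
Arguments iwpi {D B R} I _ : rename.
Arguments iwj {D B R} I _ : rename.
Arguments iwC {D B R} I _ : rename.
Arguments iwCb {D B R} I _ : rename.

Section IwahoriWeyl.
Variables (D : padic_datum) (B : group_datum D) (R : realType).
Variable I : iw_datum B R.

Definition iwact (w : iwW I) := bact I (iwj I w).

Definition iwWa : set (iwW I) :=
  [set iwpi I g | g in ptsF (gN B) `&` bG1F I].

Definition iwOmega : set (iwW I) := alcove_stabilizer iwact (iwC I).

Definition bOmega : set (bW I) := alcove_stabilizer (bact I) (iwCb I).

Definition ell : iwW I -> nat := length iwact (aptF I) iwWa (iwC I).

Definition bell : bW I -> nat :=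
  length (bact I) (apt B R) (bWa I) (iwCb I).

(* Background theorems on these objects: T is a torus, G being quasi-split
   over L (Steinberg); the finite Weyl group N_S(L)/T(L) is generated by the
   reflections in the roots (Borel-Tits); the structure of the two
   Iwahori-Weyl groups, and the identifications of W, Wa, Omega with the
   fixed points of the Frobenius (Bruhat-Tits).
   None of them is about straight elements or conjugacy classes. *)
Record bruhat_tits : Prop := BruhatTits {
  bt_torus : forall s t, gT B s -> gT B t -> s *m t = t *m s;
  bt_weyl : forall g, ptsL (gNS B) g -> exists m t,
    [/\ ptsL (gNS B) m, bG1L I m, ptsL (gT B) t & g = m *m t];
  bt_affineL : affine_weyl (bact I) (apt B R) (bWa I) (iwCb I);
  bt_affineF : affine_weyl iwact (aptF I) iwWa (iwC I);
  bt_repr : forall w, exists2 g, ptsF (gNS B) g & iwpi I g = w;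
  bt_morph : forall w w', iwj I (w * w')%g = (iwj I w * iwj I w')%g :> bW I;
  bt_inj : injective (iwj I);
  bt_W : range (iwj I) = [set w | bsig I w = w];
  bt_Wa : [set iwj I w | w in iwWa] = bWa I `&` [set w | bsig I w = w];
  bt_Omega : [set iwj I w | w in iwOmega] = bOmega `&` [set w | bsig I w = w]
}.

Definition straight (x : iwW I) : Prop :=
  forall m : nat, ell (x ^+ m)%g = (m * ell x)%N.

Definition conj_class (c : set (iwW I)) : Prop :=
  exists x, c = [set (g * x * g^-1)%g | g in setT].

Definition straight_class (c : set (iwW I)) : Prop :=
  conj_class c /\ exists2 x, c x & straight x.

Definition sig_straight (x : bW I) : Prop :=
  forall m : nat,
    bell (\prod_(i < m) iter i (bsig I) x)%g = (m * bell x)%N.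

Definition sig_orbit (o : set (bW I)) : Prop :=
  exists x, o = [set (w * x * (bsig I w)^-1)%g | w in bWa I].

Definition straight_orbit (o : set (bW I)) : Prop :=
  sig_orbit o /\ exists2 x, o x & sig_straight x.

End IwahoriWeyl.

(* Main.v *)
(* Every element w of the Iwahori-Weyl group acts on the apartment by an affine
   map whose linear part is a permutation of coordinates, hence an isometry of
   finite order. The length of w counts the mirrors separating a base point p of
   the alcove from w p, so x is straight exactly when no mirror is crossed twice
   along p, x p, x^2 p, ... A mirror over the unramified closure separating two
   Frobenius-fixed points traces a mirror over F, so straight elements over F
   stay straight.

   Let nu be the Newton vector of f = x o Frobenius, and consider the mirrors
   parallel to nu. For x straight they do not separate p from its iterates, and
   an element of the affine Weyl group fixing nu is determined by the region to
   which it moves p and by its translation part modulo the span of the normals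
   orthogonal to nu. The lattice of roots has a basis of simple roots, on which
   the linear part of f permutes the roots not orthogonal to nu. Taking floors
   of coordinates in this basis rounds a real solution of a cohomological
   equation to a lattice solution. This makes a twisted conjugator of straight
   elements Frobenius-fixed (injectivity), and lets conjugation by a translation
   be replaced by twisted conjugation by the affine Weyl group (containment in
   one orbit). *)
From mathcomp Require Import all_boot all_order all_algebra all_fingroup all_field.
From mathcomp Require Import boolp classical_sets cardinality reals.
From mathcomp Require Import cyclic ring lra.
From mathcomp Require Import mpoly.
Require Import Defs.

Set Implicit Arguments.
Unset Strict Implicit.
Unset Printing Implicit Defensive.

Import Order.TTheory GRing.Theory Num.Theory.
Local Open Scope classical_set_scope.
Local Open Scope ring_scope.

(** * Affine maps with permutation linear part *)

(** The real solutions that get rounded are explicit. For injectivity it is a difference of two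
    averaged orbits of the base point, one for each straight element, both Frobenius-fixed; for
    containment it is the translation part of the conjugating element. Rounding is harmless because
    the floor commutes with integer shifts and with permuting coordinates. It only yields equalities
    of translation parts modulo the span; the regions then turn these into equalities in the group,
    since an element with trivial region and trivial translation part is 1.

    The axioms allow finite factors, whose mirrors have no parallel translates and contribute no
    roots. The iterate of f of order n! is a translation by n! nu, as n! kills every coordinate
    permutation, and it permutes the mirrors. So a mirror not parallel to nu has translates, and the
    exceptional mirrors are all parallel to nu.

    On the algebraic side, normalizers are conditions on points over K whereas the Frobenius is
    given on L only; it is extended to finitely many coordinates at a time. *)

Section Dot.
Variables (R : realType) (n : nat).
Implicit Types u v w : 'rV[R]_n.

Definition dot u v := \sum_i u 0 i * v 0 i.

Lemma dotC u v : dot u v = dot v u.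
Proof. by apply: eq_bigr => i _; rewrite mulrC. Qed.

Lemma dotDl u v w : dot (u + v) w = dot u w + dot v w.
Proof. by rewrite -big_split; apply: eq_bigr => i _; rewrite mxE mulrDl. Qed.

Lemma dotZl a u v : dot (a *: u) v = a * dot u v.
Proof. by rewrite mulr_sumr; apply: eq_bigr => i _; rewrite mxE mulrA. Qed.

Lemma dotNl u v : dot (- u) v = - dot u v.
Proof. by rewrite -scaleN1r dotZl mulN1r. Qed.

Lemma dotBl u v w : dot (u - v) w = dot u w - dot v w.
Proof. by rewrite dotDl dotNl. Qed.

Lemma dotDr u v w : dot u (v + w) = dot u v + dot u w.
Proof. by rewrite dotC dotDl !(dotC u). Qed.

Lemma dotZr a u v : dot u (a *: v) = a * dot u v.
Proof. by rewrite dotC dotZl (dotC u). Qed.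

Lemma dotNr u v : dot u (- v) = - dot u v.
Proof. by rewrite dotC dotNl (dotC u). Qed.

Lemma dotBr u v w : dot u (v - w) = dot u v - dot u w.
Proof. by rewrite dotDr dotNr. Qed.

Lemma dot0l u : dot 0 u = 0.
Proof. by rewrite -(scale0r 0) dotZl mul0r. Qed.

Lemma dot_suml (I : Type) (r : seq I) (P : pred I) (F : I -> 'rV[R]_n) v :
  dot (\sum_(i <- r | P i) F i) v = \sum_(i <- r | P i) dot (F i) v.
Proof.
elim/big_rec2: _ => [|i y1 y2 _ <-]; first exact: dot0l.
by rewrite dotDl.
Qed.

Lemma dot_sumr (I : Type) (r : seq I) (P : pred I) (F : I -> 'rV[R]_n) v :
  dot v (\sum_(i <- r | P i) F i) = \sum_(i <- r | P i) dot v (F i).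
Proof. by rewrite dotC dot_suml; apply: eq_bigr => i _; rewrite dotC. Qed.

Lemma dot_ge0 u : 0 <= dot u u.
Proof. by apply: sumr_ge0 => i _; rewrite -expr2 sqr_ge0. Qed.

Lemma dot_eq0 u : (dot u u == 0) = (u == 0).
Proof.
apply/idP/eqP => [|->]; last by rewrite dot0l.
rewrite psumr_eq0 => [/allP h|i _]; last by rewrite -expr2 sqr_ge0.
apply/rowP => i; have := h i (mem_index_enum i).
by rewrite mxE /= mulf_eq0 orbb => /eqP.
Qed.

Lemma dot_gt0 u : u != 0 -> 0 < dot u u.
Proof. by rewrite lt_def dot_ge0 dot_eq0 => ->. Qed.

Lemma dot_perm (s : 'S_n) u v : dot (col_perm s u) (col_perm s v) = dot u v.
Proof.
rewrite /dot [RHS](reindex_inj (@perm_inj _ s)).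
by apply: eq_bigr => i _; rewrite !mxE.
Qed.

Lemma dot_permV (s : 'S_n) u v : dot (col_perm s u) v = dot u (col_perm s^-1 v).
Proof.
rewrite -(dot_perm s u); congr dot.
by rewrite -col_permM mulgV col_perm1.
Qed.

Lemma col_permK (s : 'S_n) u : col_perm s^-1 (col_perm s u) = u.
Proof. by rewrite -col_permM mulVg col_perm1. Qed.

Lemma col_permKV (s : 'S_n) u : col_perm s (col_perm s^-1 u) = u.
Proof. by rewrite -col_permM mulgV col_perm1. Qed.

Lemma col_perm_iter (s : 'S_n) m u : iter m (col_perm s) u = col_perm (s ^+ m)%g u.
Proof.
elim: m => [|m IH]; first by rewrite expg0 col_perm1.
by rewrite iterS IH expgS col_permM.
Qed.

Lemma col_perm_order (s : 'S_n) u : iter (n`!) (col_perm s) u = u.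
Proof.
rewrite col_perm_iter.
have -> : (s ^+ n`! = 1)%g by rewrite -card_Sn -cardsT expg_cardG ?inE.
by rewrite col_perm1.
Qed.

Definition dotE := (dotDl, dotDr, dotBl, dotBr, dotZl, dotZr, dotNl, dotNr).

End Dot.

Section Aut.
Variables (R : realType) (n : nat).
Local Notation V := 'rV[R]_n.
Implicit Types (E : set V) (f : V -> V) (s : 'S_n).

Definition affine_set E :=
  forall x y z a, E x -> E y -> E z -> E (x + a *: (y - z)).

(** [s] is carried as data because [f] determines only its effect on the directions of [E], where
    distinct permutations may agree. *)
Definition paff E f s :=
  (forall x, E x -> E (f x)) /\
  forall x y, E x -> E y -> f x - f y = col_perm s (x - y).

Definition dir E (v : V) := forall x, E x -> E (x + v).

Lemma dirB E x y : affine_set E -> E x -> E y -> dir E (x - y).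
Proof. by move=> aE Ex Ey z Ez; rewrite -(scale1r (x - y)); apply: aE. Qed.

Lemma dirZ E a v : affine_set E -> dir E v -> dir E (a *: v).
Proof.
by move=> aE dv x Ex; have := aE _ _ _ a Ex (dv x Ex) Ex; rewrite (addrC x v) addrK.
Qed.

Lemma dirD E u v : dir E u -> dir E v -> dir E (u + v).
Proof. by move=> du dv x Ex; rewrite addrA; apply/dv/du. Qed.

Lemma dirN E v : affine_set E -> dir E v -> dir E (- v).
Proof. by move=> aE dv; rewrite -scaleN1r; apply: dirZ. Qed.

Lemma dir0 E : dir E 0.
Proof. by move=> x; rewrite addr0. Qed.

Lemma dir_sum E (I : Type) (r : seq I) (P : pred I) (F : I -> V) :
  (forall i, P i -> dir E (F i)) -> dir E (\sum_(i <- r | P i) F i).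
Proof. by move=> h; elim/big_ind: _ => //; [exact: dir0|exact: dirD]. Qed.

Lemma paff_add E f s x v : paff E f s -> dir E v -> E x ->
  f (x + v) = f x + col_perm s v.
Proof.
move=> [_ h] dv Ex; apply: (addIr (- f x)).
by rewrite (h _ _ (dv x Ex) Ex) !(addrC x) !(addrC (f x)) !addrK.
Qed.

Lemma paff_comp E f g s t : paff E f s -> paff E g t ->
  paff E (f \o g) (s * t)%g.
Proof.
move=> [Ef hf] [Eg hg]; split=> [x Ex|x y Ex Ey] /=; first by apply/Ef/Eg.
by rewrite (hf _ _ (Eg x Ex) (Eg y Ey)) hg // col_permM.
Qed.

Lemma paff_iter E f s m : paff E f s -> paff E (iter m f) (s ^+ m)%g.
Proof.
move=> h; elim: m => [|m IH].
  by split=> // x y _ _; rewrite expg0 col_perm1.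
by rewrite expgS; exact: paff_comp.
Qed.

Lemma paff_dir E f s v : E !=set0 -> affine_set E -> paff E f s -> dir E v ->
  dir E (col_perm s v).
Proof.
move=> [p Ep] aE h dv x Ex.
have -> : col_perm s v = f (p + v) - f p.
  by rewrite (h.2 _ _ (dv p Ep) Ep) (addrC p) addrK.
by apply: dirB => //; apply: h.1 => //; apply: dv.
Qed.

(* Coordinate permutations have order dividing n!, so the n!-th iterate is a
   translation. *)
Lemma paff_translation E f s p : paff E f s -> E p ->
  forall x, E x -> iter n`! f x = x + (iter n`! f p - p).
Proof.
move=> h Ep x Ex; have [_ hN] := paff_iter n`! h.
have := hN _ _ Ex Ep; rewrite -col_perm_iter col_perm_order => e.
by rewrite -(subrK (iter n`! f p) (iter n`! f x)) e -addrA (addrC (- p)).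
Qed.

Lemma paff_avg E f s (I : finType) (F : I -> V) : paff E f s -> affine_set E ->
  (0 < #|I|)%N -> (forall i, E (F i)) ->
  E (#|I|%:R^-1 *: \sum_i F i) /\
  f (#|I|%:R^-1 *: \sum_i F i) = #|I|%:R^-1 *: \sum_i f (F i).
Proof.
move=> h aE I0 EF; have [i0 _] := card_gt0P I0.
have c0 : #|I|%:R != 0 :> R by rewrite pnatr_eq0 -lt0n.
pose v := #|I|%:R^-1 *: \sum_i (F i - F i0).
have -> : #|I|%:R^-1 *: \sum_i F i = F i0 + v.
  rewrite /v sumrB sumr_const scalerBr -scaler_nat scalerA mulVf // scale1r.
  by rewrite addrC subrK.
have dv : dir E v by apply: dirZ => //; apply: dir_sum => i _; apply: dirB.
split; first exact: dv.
rewrite (paff_add h dv) // /v linearZ /= linear_sum /=.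
under eq_bigr => i _ do rewrite -h.2 //.
rewrite sumrB sumr_const scalerBr -scaler_nat scalerA mulVf // scale1r.
by rewrite addrC subrK.
Qed.

End Aut.

(** * Mirrors and regions *)

Section CoxSystem.
Variables (R : realType) (n : nat) (E : set 'rV[R]_n) (W : groupType).
Variables (act : W -> 'rV[R]_n -> 'rV[R]_n) (ws : W -> 'S_n).
Variables (Wa : set W) (C : set 'rV[R]_n) (p : 'rV[R]_n).

(** Instantiated over [L] on the full apartment and over [F] on its Frobenius-fixed part, with the
    same base point [p]. *)
Record cox_system : Prop := CoxSystem {
  cs_affine : affine_set E;
  cs_paff : forall w, paff E (act w) (ws w);
  cs_act1 : forall x, E x -> act 1%g x = x;
  cs_actM : forall w w' x, E x -> act (w * w')%g x = act w (act w' x);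
  cs_weyl : affine_weyl act E Wa C;
  cs_alcove : alcove act E Wa C;
  cs_base : C p
}.

Hypothesis S : cox_system.
Local Notation V := 'rV[R]_n.
Implicit Types (x y z a v : V) (t w u : W) (c : R).

Let aE : affine_set E := cs_affine S.

Lemma alcove_sub x : C x -> E x.
Proof. by have [x0 [_ _ ->]] := cs_alcove S; case. Qed.

Lemma base_E : E p.
Proof. exact: alcove_sub (cs_base S). Qed.

Lemma Wa1 : Wa 1%g.
Proof. by have [] := aw_subgroup (cs_weyl S). Qed.

Lemma WaM w u : Wa w -> Wa u -> Wa (w * u)%g.
Proof. by have [_ h _] := aw_subgroup (cs_weyl S); apply: h. Qed.

Lemma WaV w : Wa w -> Wa w^-1%g.
Proof. by have [_ _ h] := aw_subgroup (cs_weyl S); apply: h. Qed.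

Lemma WaJ w g : Wa w -> Wa (g * w * g^-1)%g.
Proof. by move=> hw; apply: (aw_normal (cs_weyl S)). Qed.

Lemma act_E w x : E x -> E (act w x).
Proof. by case: (cs_paff S w) => h _; apply: h. Qed.

Lemma actK w x : E x -> act w^-1 (act w x) = x.
Proof. by move=> Ex; rewrite -(cs_actM S) // mulVg (cs_act1 S). Qed.

Lemma actKV w x : E x -> act w (act w^-1 x) = x.
Proof. by move=> Ex; rewrite -(cs_actM S) // mulgV (cs_act1 S). Qed.

Lemma actB w x y : E x -> E y -> act w x - act w y = col_perm (ws w) (x - y).
Proof. by case: (cs_paff S w) => _; apply. Qed.

Lemma actD w x v : E x -> dir E v -> act w (x + v) = act w x + col_perm (ws w) v.
Proof. by move=> Ex dv; apply: (paff_add (cs_paff S w)). Qed.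

Lemma faithful w u : Wa w -> Wa u -> (forall x, E x -> act w x = act u x) -> w = u.
Proof.
move=> hw hu e; apply/eqP; rewrite -divg_eq1; apply/eqP.
apply: (aw_faithful (cs_weyl S)) => [|x Ex]; first by apply/WaM/WaV.
by rewrite (cs_actM S) // e ?actKV //; apply: act_E.
Qed.

(** The reflection is orthogonal for the coordinate dot product, which permutations preserve. The
    pair of [a] and [c] is determined up to a common nonzero factor. *)
Definition rfl t a c := [/\ Wa t, a != 0, dir E a &
  forall x, E x -> act t x = x - (2 * (dot a x - c) / dot a a) *: a].

(* As x - act t x is 2 (dot a x - c) / dot a a times a, these say that x and y lie
   strictly on the same side, resp. on opposite sides, of the mirror of t. *)
Definition side t x y := 0 < dot (x - act t x) (y - act t y).
Definition sep t x y := dot (x - act t x) (y - act t y) < 0.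

Section Rfl.
Variables (t : W) (a : V) (c : R).
Hypothesis h : rfl t a c.

Let a0 : 0 < dot a a. Proof. by case: h => _ a0 _ _; apply: dot_gt0. Qed.

Lemma rfl_dot x y : E x -> E y -> dot (x - act t x) (y - act t y) =
  (4 / dot a a) * ((dot a x - c) * (dot a y - c)).
Proof.
move=> Ex Ey; have [_ _ _ ht] := h.
rewrite !ht // !subKr !dotE; field.
by rewrite gt_eqF.
Qed.

Lemma sepE x y : E x -> E y -> sep t x y = ((dot a x - c) * (dot a y - c) < 0).
Proof. by move=> Ex Ey; rewrite /sep rfl_dot // pmulr_rlt0 // divr_gt0. Qed.

Lemma sideE x y : E x -> E y -> side t x y = (0 < (dot a x - c) * (dot a y - c)).
Proof. by move=> Ex Ey; rewrite /side rfl_dot // pmulr_rgt0 // divr_gt0. Qed.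

Lemma rfl_val x : E x -> dot a (act t x) - c = - (dot a x - c).
Proof.
have [_ a1 _ ht] := h; move=> Ex; rewrite ht // !dotE; field.
by rewrite gt_eqF.
Qed.

Lemma rfl_fix x : E x -> act t x = x <-> dot a x = c.
Proof.
have [_ _ _ ht] := h; move=> Ex; split=> [e|e].
  by have := rfl_val Ex; rewrite e; lra.
by rewrite ht // e subrr mulr0 mul0r scale0r subr0.
Qed.

Lemma rfl_invol : (t * t = 1)%g.
Proof.
have [Wt a1 _ ht] := h.
apply: (aw_faithful (cs_weyl S)) => [|x Ex]; first exact: WaM.
have E1 := act_E t Ex.
by rewrite (cs_actM S) // ht // rfl_val // mulrN mulNr scaleNr opprK ht // subrK.
Qed.

Lemma rfl_inv : (t^-1 = t)%g.
Proof. by apply: (@mulgI _ t); rewrite mulgV rfl_invol. Qed.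

Lemma rfl_proj x : E x ->
  let y := x - ((dot a x - c) / dot a a) *: a in E y /\ dot a y = c.
Proof.
have [_ _ da _] := h; move=> Ex y; split.
  by rewrite /y -scaleNr; exact: (dirZ (- ((dot a x - c) / dot a a)) aE da).
by rewrite !dotE; field; rewrite gt_eqF.
Qed.

Lemma rfl_scale k : k != 0 -> rfl t (k *: a) (k * c).
Proof.
have [Wt a1 da ht] := h; move=> k0; split=> //.
- by rewrite scaler_eq0 negb_or k0.
- exact: dirZ.
- move=> x Ex; rewrite ht // scalerA; congr (_ - _ *: _); rewrite !dotE; field.
  by rewrite gt_eqF.
Qed.

End Rfl.

Lemma rfl_Wa t a c : rfl t a c -> Wa t. Proof. by case. Qed.
Lemma rfl_neq0 t a c : rfl t a c -> a != 0. Proof. by case. Qed.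
Lemma rfl_dir t a c : rfl t a c -> dir E a. Proof. by case. Qed.

(** The component [v] of [a'] orthogonal to [a] is a direction of the first mirror, along which
    [dot a'] is constant; so [v] is orthogonal to both [a] and [a'], and vanishes. *)
Lemma rfl_uniq t a c t' a' c' : rfl t a c -> rfl t' a' c' ->
  (forall x, E x -> dot a x = c -> dot a' x = c') ->
  t = t' /\ exists k, [/\ k != 0, a' = k *: a & c' = k * c].
Proof.
move=> h h' sub; have [Wt a0 da ht] := h; have [Wt' a0' da' ht'] := h'.
have p0 := dot_gt0 a0; have n0 : dot a a != 0 by rewrite gt_eqF.
have [Ey hy] := rfl_proj h base_E; move: Ey hy; set y := (X in E X) => Ey hy.
pose k := dot a' a / dot a a; pose v := a' - k *: a.
have av : dot a v = 0 by rewrite /v /k !dotE (dotC a a'); field.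
have dv : dir E v by apply: dirD => //; rewrite -scaleNr; apply: dirZ.
have a'v : dot a' v = 0.
  have e1 := sub _ Ey hy.
  have e2 : dot a' (y + v) = c' by apply: sub; [exact: dv|rewrite dotDr av addr0].
  by move: e2; rewrite dotDr e1 => /(canRL (addKr _)); rewrite addNr.
have v0 : v = 0.
  by apply/eqP; rewrite -dot_eq0 {1}/v dotBl a'v dotZl av mulr0 subrr.
have ea : a' = k *: a by apply/eqP; rewrite -subr_eq0 -/v v0.
have k0 : k != 0 by apply: contraNneq a0' => k0; rewrite ea k0 scale0r.
have ec : c' = k * c by rewrite -(sub _ Ey hy) ea dotZl hy.
split; last by exists k.
apply: faithful => // x Ex; rewrite ht // ht' // ea ec scalerA.
by congr (_ - _ *: _); rewrite !dotE; field; rewrite k0 gt_eqF.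
Qed.

Lemma rfl_off t a c : rfl t a c -> exists2 x, E x & dot a x != c.
Proof.
move=> h; have [Ey hy] := rfl_proj h base_E; move: Ey hy; set y := (X in E X) => Ey hy.
exists (y + a); first by apply: (rfl_dir h).
by rewrite dotDr hy addrC -subr_eq0 addrK dot_eq0 (rfl_neq0 h).
Qed.

Lemma fixset_rfl t a c : rfl t a c -> fixset act E t = E `&` [set x | dot a x = c].
Proof.
by move=> h; apply/seteqP; split=> x [Ex /= hx]; split=> //; apply/(rfl_fix h).
Qed.

Lemma mirror_rfl t a c : rfl t a c -> mirror act E Wa (fixset act E t).
Proof.
move=> h; split; last by exists t => //; apply: (rfl_Wa h).
split.
- by have [Ey hy] := rfl_proj h base_E; eexists; split; first exact: Ey; apply/(rfl_fix h).
- have [x Ex /eqP hx] := rfl_off h => e; apply: hx.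
  by apply/(rfl_fix h) => //; move: Ex; rewrite -{1}e => -[].
- by exists a, c; rewrite (fixset_rfl h).
Qed.

(** An isometry fixing a hyperplane pointwise and moving [x0]: each fixed point is equidistant from
    [x0] and its image, hence lies on their bisector, of equation [dot a y = c]. Any point of [E] is
    a fixed one plus a multiple of [x0 - h]. *)
Lemma mirror_fixP t : Wa t -> mirror act E Wa (fixset act E t) ->
  exists a c, rfl t a c.
Proof.
move=> Wt [[[h Hh] HE [c0 [al eH]]] _]; set H := fixset act E t in h Hh HE eH.
have [x0 [Ex0 hx0]] : exists x0, E x0 /\ ~ H x0.
  apply: contrapT => e; apply: HE; apply/seteqP; split=> [x []|x Ex] //.
  by apply: contrapT => hx; apply: e; exists x.
have HP x : E x -> H x <-> dot c0 x = al.
  by rewrite eH => Ex; split=> [[]|] //; split.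
have Eh : E h by move: Hh => [].
pose k x := dot c0 x - al.
have kh : k h = 0 by rewrite /k; apply/eqP; rewrite subr_eq0; apply/eqP/HP.
have k0 : k x0 != 0 by rewrite /k subr_eq0; apply/eqP => /(HP _ Ex0).
pose a := x0 - act t x0.
have Etx := act_E t Ex0.
have a0 : a != 0.
  by rewrite subr_eq0; apply/eqP => e; apply: hx0; rewrite /H /fixset; split=> //=; rewrite -e.
pose c := (dot x0 x0 - dot (act t x0) (act t x0)) / 2.
have bis y : H y -> dot a y = c.
  move=> [Ey /= fy].
  have : dot (act t x0 - act t y) (act t x0 - act t y) = dot (x0 - y) (x0 - y).
    by rewrite actB // dot_perm.
  rewrite fy /a /c !dotE => e.
  have e1 := dotC x0 y; have e2 := dotC (act t x0) y; lra.
have da : dir E a by apply: dirB.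
exists a, c; split=> // x Ex.
pose s := k x / k x0.
pose y := x + (- s) *: (x0 - h).
have Ey : E y by apply: aE.
have Hy : H y.
  apply/(HP y Ey); move: kh; rewrite /y /s /k !dotE => kh.
  move: k0; rewrite /k => k0.
  have -> : dot c0 h = al by lra.
  by field.
have ex : x = y + s *: (x0 - h) by rewrite /y scaleNr subrK.
have etx : act t x = x - s *: a.
  have [_ /= fy] := Hy; have [_ /= fh] := Hh.
  have dx : dir E (x0 - h) by apply: dirB.
  have -> : x - s *: a = y + s *: (act t x0 - h).
    by rewrite {1}ex /a; apply/rowP => i; rewrite !mxE; ring.
  rewrite {1}ex actD //; last exact: dirZ.
  by rewrite fy linearZ /= -actB // fh.
rewrite etx; congr (_ - _ *: _).
have -> : dot a x - c = s * (dot a a / 2).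
  have e1 := bis _ Hy; have e2 := bis _ Hh.
  have e3 : dot a x0 - c = dot a a / 2.
    by rewrite /c {1 2 3}/a !dotE (dotC (act t x0) x0); lra.
  by rewrite ex dotDr dotZr dotBr e1 e2 -e3; ring.
by field; rewrite dot_eq0.
Qed.

Lemma mirrorP H : mirror act E Wa H ->
  exists t a c, rfl t a c /\ H = fixset act E t.
Proof.
move=> hH; have [_ [t Wt eH]] := hH; rewrite eH in hH.
by have [a [c h]] := mirror_fixP Wt hH; exists t, a, c.
Qed.

End CoxSystem.

Section Near0.
Variable R : realType.

Definition near0 (P : R -> Prop) := exists2 e0, 0 < e0 & forall e, 0 < e < e0 -> P e.

Lemma near0_and P Q : near0 P -> near0 Q -> near0 (fun e => P e /\ Q e).
Proof.
move=> [e1 e1p h1] [e2 e2p h2]; exists (Num.min e1 e2); first by rewrite lt_min e1p.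
move=> e /andP[e0]; rewrite lt_min => /andP[l1 l2].
by split; [apply: h1|apply: h2]; rewrite e0.
Qed.

Lemma near0_all (T : eqType) (l : seq T) (P : T -> R -> Prop) :
  (forall t, t \in l -> near0 (P t)) -> near0 (fun e => forall t, t \in l -> P t e).
Proof.
elim: l => [|t l IH] h; first by exists 1.
have [|e1 e1p h1] := near0_and (h t (mem_head _ _)) (IH _).
  by move=> t' ht'; apply: h; rewrite inE ht' orbT.
exists e1 => // e /h1 [h2 h3] t'; rewrite inE => /orP[/eqP->|] //; exact: h3.
Qed.

Lemma near0_pos u v : 0 < u -> near0 (fun e => 0 < u + e * v).
Proof.
move=> u0; have d0 : 0 < `|v| + 1 by rewrite ltr_pwDr.
exists (u / (`|v| + 1)); first exact: divr_gt0.
move=> e /andP[e0]; rewrite ltr_pdivlMr // => h.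
have h1 : - (e * `|v|) <= e * v by rewrite -mulrN ler_pM2l // lerNnormlW.
by move: h h1 e0; rewrite mulrDr; lra.
Qed.

Lemma near0_neq0 u v : u != 0 -> near0 (fun e => u + e * v != 0).
Proof.
move=> u0; have [h|h|h] := ltgtP u 0; last by rewrite h eqxx in u0.
  have [|e0 e0p h0] := near0_pos (u := - u) (- v); first lra.
  by exists e0 => // e /h0 h1; apply: contraTneq h1 => h1; rewrite mulrN; lra.
by have [e0 e0p h0] := near0_pos v h; exists e0 => // e /h0; apply: lt0r_neq0.
Qed.

Lemma near0_exists P : near0 P -> exists2 e, 0 < e & P e.
Proof.
move=> [e0 e0p h]; exists (e0 / 2); first by rewrite divr_gt0.
by apply: h; rewrite divr_gt0 //= ltr_pdivrMr //; lra.
Qed.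

End Near0.

Lemma mulr_gt0_trans (R : realType) (x y z : R) : 0 < x * y -> 0 < y * z -> 0 < x * z.
Proof.
move=> h1 h2; have y0 : y != 0 by apply: contraTneq h1 => ->; rewrite mulr0 ltxx.
have := mulr_gt0 h1 h2; have -> : x * y * (y * z) = (x * z) * y ^+ 2 by ring.
by rewrite pmulr_lgt0 // lt_def sqr_ge0 sqrf_eq0 y0.
Qed.

Lemma mulr_gt0_lt0 (R : realType) (x y z : R) : 0 < x * y -> y * z < 0 -> x * z < 0.
Proof. by move=> h1; rewrite -!oppr_gt0 -!mulrN; apply: mulr_gt0_trans. Qed.

Lemma convex_neq0 (R : realType) (r k m : R) : 0 <= r <= 1 -> 0 < k * m ->
  (1 - r) * k + r * m <> 0.
Proof.
move=> /andP[r0 r1] km e; have k0 : k != 0 by apply: contraTneq km => ->; rewrite mul0r ltxx.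
have k2 : 0 < k * k by rewrite -expr2 lt_def sqr_ge0 sqrf_eq0 k0.
have : (1 - r) * (k * k) + r * (k * m) == 0.
  by apply/eqP; rewrite -(mulr0 k) -e; ring.
rewrite paddr_eq0; first 1 last.
- by rewrite mulr_ge0 ?(ltW k2) // subr_ge0.
- by rewrite mulr_ge0 ?(ltW km).
rewrite !mulf_eq0 -mulf_eq0 (gt_eqF k2) -mulf_eq0 (gt_eqF km) !orbF => /andP[/eqP h /eqP h'].
lra.
Qed.

(** * Automorphisms of the reflection system, chambers and stabilizers *)

Section Chambers.
Variables (R : realType) (n : nat) (E : set 'rV[R]_n) (W : groupType).
Variables (act : W -> 'rV[R]_n -> 'rV[R]_n) (ws : W -> 'S_n).
Variables (Wa : set W) (C : set 'rV[R]_n) (p : 'rV[R]_n).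
Hypothesis S : cox_system E act ws Wa C p.
Local Notation V := 'rV[R]_n.
Implicit Types (x y z a v : V) (t w u : W) (c : R).
Local Notation rfl := (rfl E act Wa).
Local Notation side := (side act).
Local Notation sep := (sep act).

Let aE : affine_set E := cs_affine S.

Record aut (f : V -> V) (s : 'S_n) (psi : W -> W) : Prop := Aut {
  aut_paff : paff E f s;
  aut_surj : forall y, E y -> exists2 x, E x & f x = y;
  aut_Wa : forall w, Wa w -> Wa (psi w);
  aut_onto : forall w, Wa w -> exists2 w', Wa w' & psi w' = w;
  aut_equiv : forall w x, E x -> f (act w x) = act (psi w) (f x)
}.

Lemma aut_E f s psi x : aut f s psi -> E x -> E (f x).
Proof. by case=> -[h _] *; apply: h. Qed.

Lemma aut_B f s psi x y : aut f s psi -> E x -> E y ->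
  f x - f y = col_perm s (x - y).
Proof. by case=> -[_ h] *; apply: h. Qed.

Lemma aut_D f s psi x v : aut f s psi -> E x -> dir E v ->
  f (x + v) = f x + col_perm s v.
Proof. by case=> h _ _ _ _ Ex dv; apply: (paff_add h). Qed.

Lemma aut_dir f s psi v : aut f s psi -> dir E v -> dir E (col_perm s v).
Proof.
by move=> h dv; apply: (paff_dir _ aE (aut_paff h) dv); exists p; apply: (base_E S).
Qed.

Lemma aut_dirV f s psi v : aut f s psi -> dir E v -> dir E (col_perm s^-1 v).
Proof.
move=> h dv x Ex.
have [y Ey e] := aut_surj h (dv _ (aut_E h Ex)).
have <- : y - x = col_perm s^-1 v.
  by rewrite -[y - x](col_permK s) -(aut_B h) // e addrC addKr.
by rewrite addrC subrK.
Qed.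

Lemma aut_act w : aut (act w) (ws w) (fun t => w * t * w^-1)%g.
Proof.
split.
- exact: (cs_paff S).
- by move=> y Ey; exists (act w^-1 y); [apply: (act_E S)|apply: (actKV S)].
- by move=> t; apply: (WaJ S).
- move=> t ht; exists (w^-1 * t * w)%g; first by have := WaJ S w^-1 ht; rewrite invgK.
  by rewrite !mulgA mulgV mul1g mulgK.
- move=> t x Ex; rewrite !(cs_actM S) ?(actK S) //; exact: (act_E S).
Qed.

Lemma aut_comp f s psi f' s' psi' : aut f s psi -> aut f' s' psi' ->
  aut (f \o f') (s * s')%g (psi \o psi').
Proof.
move=> h h'; split=> /=.
- exact: paff_comp (aut_paff h) (aut_paff h').
- move=> y /(aut_surj h) [x /(aut_surj h') [z Ez <-] <-]; by exists z.
- by move=> w /(aut_Wa h'); apply: (aut_Wa h).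
- by move=> w /(aut_onto h) [x /(aut_onto h') [z Ez <-] <-]; exists z.
- by move=> w x Ex; rewrite (aut_equiv h') // (aut_equiv h) //; apply: (aut_E h').
Qed.

Section AutDot.
Variables (f : V -> V) (s : 'S_n) (psi : W -> W).
Hypothesis h : aut f s psi.

Let aut_dot t x y : E x -> E y ->
  dot (f x - act (psi t) (f x)) (f y - act (psi t) (f y)) =
  dot (x - act t x) (y - act t y).
Proof.
move=> Ex Ey; rewrite -!(aut_equiv h) // !(aut_B h) ?dot_perm //.
all: exact: (act_E S).
Qed.

Lemma aut_side t x y : E x -> E y -> side (psi t) (f x) (f y) = side t x y.
Proof. by move=> Ex Ey; rewrite /side aut_dot. Qed.

Lemma aut_sep t x y : E x -> E y -> sep (psi t) (f x) (f y) = sep t x y.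
Proof. by move=> Ex Ey; rewrite /sep aut_dot. Qed.

Lemma aut_rfl t a c : rfl t a c ->
  rfl (psi t) (col_perm s a) (c - dot a p + dot (col_perm s a) (f p)).
Proof.
move=> [Wt a0 da ht]; split.
- exact: (aut_Wa h).
- by apply: contra_neq a0 => e; rewrite -(col_permK s a) e linear0.
- exact: (aut_dir h).
- move=> y /(aut_surj h) [x Ex <-]; rewrite -(aut_equiv h) // ht //.
  rewrite -scaleNr (aut_D h) //; last exact: (dirZ _ aE).
  rewrite linearZ /= scaleNr; congr (_ - _ *: _); rewrite dot_perm.
  have e : dot (col_perm s a) (f x) - dot (col_perm s a) (f p) = dot a x - dot a p.
    by rewrite -dotBr (aut_B h) ?dot_perm ?dotBr //; apply: (base_E S).
  by congr (2 * _ / _); lra.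
Qed.

Lemma aut_rflV t a c : Wa t -> rfl (psi t) a c ->
  exists c', rfl t (col_perm s^-1 a) c'.
Proof.
move=> Wt [Wt' a0 da ht].
pose b := col_perm s^-1 a; have db : dir E b := aut_dirV h da.
have sb : col_perm s b = a by rewrite col_permKV.
exists (dot b p - dot a (f p) + c); split=> //.
- by apply: contra_neq a0 => e; rewrite -(col_permKV s a) e linear0.
- move=> x Ex; rewrite -/b; have := ht _ (aut_E h Ex).
  rewrite -(aut_equiv h) // => e.
  have e1 : f (act t x) = f (x - (2 * (dot b x - (dot b p - dot a (f p) + c)) / dot b b) *: b).
    rewrite e -!scaleNr (aut_D h) //; last exact: (dirZ _ aE).
    rewrite linearZ /= sb; congr (_ + (- _) *: _).
    rewrite -{2 3}sb dot_perm; congr (2 * _ / _).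
    have : dot a (f x) - dot a (f p) = dot b x - dot b p.
      by rewrite -dotBr (aut_B h) -?sb ?dot_perm ?dotBr //; apply: (base_E S).
    lra.
  have E2 : E (x - (2 * (dot b x - (dot b p - dot a (f p) + c)) / dot b b) *: b).
    by rewrite -scaleNr; exact: (dirZ _ aE db).
  apply/eqP; rewrite -subr_eq0; apply/eqP.
  rewrite -[LHS](col_permK s) -(aut_B h) //; last exact: (act_E S).
  by rewrite e1 subrr linear0.
Qed.

End AutDot.

Definition refl t := exists a c, rfl t a c.

Lemma aut_refl f s psi t : aut f s psi -> refl t -> refl (psi t).
Proof. by move=> h [a [c ht]]; do 2!eexists; apply: (aut_rfl h ht). Qed.

Lemma aut_reflV f s psi t : aut f s psi -> refl t -> exists2 t', refl t' & psi t' = t.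
Proof.
move=> h [a [c ht]]; have [t' Wt' e] := aut_onto h (rfl_Wa ht); exists t' => //.
by rewrite -e in ht; have [c' h'] := aut_rflV h Wt' ht; do 2!eexists; exact: h'.
Qed.

Lemma reflJ w t : refl t -> refl (w * t * w^-1)%g.
Proof. exact: (aut_refl (aut_act w)). Qed.

Lemma reflJV w t : refl t -> refl (w^-1 * t * w)%g.
Proof. by move=> h; have := reflJ w^-1 h; rewrite invgK. Qed.

Lemma refl_inv t : refl t -> (t^-1 = t)%g.
Proof. by case=> a [c h]; apply: (rfl_inv S h). Qed.

Lemma refl_invol t : refl t -> (t * t = 1)%g.
Proof. by case=> a [c h]; apply: (rfl_invol S h). Qed.

Lemma refl_Wa t : refl t -> Wa t.
Proof. by case=> a [c h]; apply: (rfl_Wa h). Qed.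

Lemma sideJ w t x y : E x -> E y ->
  side (w * t * w^-1)%g (act w x) (act w y) = side t x y.
Proof. exact: (aut_side (aut_act w)). Qed.

Lemma sepJ w t x y : E x -> E y ->
  sep (w * t * w^-1)%g (act w x) (act w y) = sep t x y.
Proof. exact: (aut_sep (aut_act w)). Qed.

Lemma sideJV w t x y : E x -> E y ->
  side t (act w x) (act w y) = side (w^-1 * t * w)%g x y.
Proof. by move=> Ex Ey; rewrite -[RHS](sideJ w) // !mulgA mulgV mul1g mulgK. Qed.

Lemma sepJV w t x y : E x -> E y ->
  sep t (act w x) (act w y) = sep (w^-1 * t * w)%g x y.
Proof. by move=> Ex Ey; rewrite -[RHS](sepJ w) // !mulgA mulgV mul1g mulgK. Qed.

Lemma side_sym t x y : side t x y = side t y x.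
Proof. by rewrite /side dotC. Qed.

Lemma sep_sym t x y : sep t x y = sep t y x.
Proof. by rewrite /sep dotC. Qed.

Lemma side_trans t x y z : refl t -> E x -> E y -> E z ->
  side t x y -> side t y z -> side t x z.
Proof.
move=> [a [c h]] Ex Ey Ez; rewrite !(sideE h) // => h1 h2.
exact: mulr_gt0_trans h1 h2.
Qed.

Lemma side_sepN t x y : side t x y -> ~~ sep t x y.
Proof. by move=> h; rewrite /sep -leNgt ltW. Qed.

Lemma side_fix t x y : side t x y -> act t x <> x.
Proof. by rewrite /side => h e; move: h; rewrite e subrr dot0l ltxx. Qed.

Definition reg x := forall t, refl t -> act t x <> x.

Lemma reg_act w x : E x -> reg x -> reg (act w x).
Proof.
move=> Ex h t ht e; apply: (h _ (reflJV w ht)).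
by rewrite !(cs_actM S) ?e ?(actK S) //; apply: (act_E S).
Qed.

Lemma reg_side t x y : refl t -> E x -> E y -> reg x -> reg y -> ~~ sep t x y -> side t x y.
Proof.
move=> ht Ex Ey hx hy; have [a [c h]] := ht.
rewrite (sepE h) // (sideE h) // -leNgt lt_def => ->; rewrite andbT mulf_neq0 // subr_eq0.
  by apply/eqP => /(rfl_fix h Ex); apply: hx.
by apply/eqP => /(rfl_fix h Ey); apply: hy.
Qed.

Lemma base_reg : reg p.
Proof.
move=> t [a [c h]] e.
have [x [Ex hx eC]] := cs_alcove S; have := cs_base S; rewrite eC => -[Ep h1].
have hm := mirror_rfl S h.
apply: (h1 1 _ _ hm); first by rewrite ler01 lexx.
by rewrite /segment_pt subrr scale0r add0r scale1r; split.
Qed.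

(** If the affine function of a mirror does not keep its strict sign from the centre [x0] to [z], it
    vanishes at the parameter [r] of the segment joining them, which an alcove forbids. *)
Lemma alcove_side x y t : C x -> C y -> refl t -> side t x y.
Proof.
have [x0 [Ex0 hx0 eC]] := cs_alcove S.
have h0 z : C z -> refl t -> side t x0 z.
  rewrite eC => -[Ez hz] [a [c h]]; rewrite (sideE h) // ltNge; apply/negP => le0.
  have hm := mirror_rfl S h.
  have k0 : dot a x0 - c != 0.
    by rewrite subr_eq0; apply/eqP => /(rfl_fix h Ex0) e; apply: (hx0 _ hm).
  pose r := (dot a x0 - c) / (dot a x0 - dot a z).
  have sq : 0 < (dot a x0 - c) ^+ 2 by rewrite lt_def sqr_ge0 sqrf_eq0 k0.
  have dz : dot a x0 - dot a z != 0.
    by apply: contraTneq le0 => e; rewrite -ltNge (_ : dot a z = dot a x0) -?expr2 //; lra.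
  have hd : 0 < (dot a x0 - dot a z) ^+ 2 by rewrite lt_def sqr_ge0 sqrf_eq0 dz.
  have er : r = ((dot a x0 - c) * (dot a x0 - dot a z)) / (dot a x0 - dot a z) ^+ 2.
    by rewrite /r; field.
  have r01 : 0 <= r <= 1.
    rewrite er; apply/andP; split.
      by rewrite divr_ge0 ?(ltW hd) //; move: le0 sq; rewrite expr2; lra.
    by rewrite ler_pdivrMr // mul1r !expr2; nra.
  have Es : E (segment_pt x0 z r).
    rewrite /segment_pt (_ : _ + _ = x0 + r *: (z - x0)); first exact: aE.
    by apply/rowP => i; rewrite !mxE; ring.
  apply: (hz _ r01 _ hm); split=> //; apply/(rfl_fix h Es).
  by rewrite /segment_pt !dotE /r; field.
move=> Cx Cy ht; have Ex := alcove_sub S Cx; have Ey := alcove_sub S Cy.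
by apply: (side_trans ht Ex Ex0 Ey); [rewrite side_sym|]; apply: h0.
Qed.

Lemma side_alcove y : E y -> (forall t, refl t -> side t p y) -> C y.
Proof.
move=> Ey h; have Ep := base_E S; have [x0 [Ex0 hx0 eC]] := cs_alcove S.
have Cx0 : C x0.
  rewrite eC; split=> // r _ H hH; rewrite /segment_pt -scalerDl subrK scale1r; exact: hx0.
rewrite eC; split=> // r /andP[r0 r1] H hH; have [t [a [c [ht ->]]]] := mirrorP S hH.
have tr : refl t by exists a, c.
have : side t x0 y := side_trans tr Ex0 Ep Ey (alcove_side Cx0 (cs_base S) tr) (h t tr).
rewrite (sideE ht) // => k0 [Es /(rfl_fix ht Es)].
rewrite /segment_pt !dotE => e.
have : (1 - r) * (dot a x0 - c) + r * (dot a y - c) = 0 by rewrite -e; ring.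
by apply: convex_neq0; rewrite ?r0.
Qed.

(** [y] preserves the side conditions cutting out [C], so it stabilizes the alcove, and [Wa] meets
    that stabilizer trivially. *)
Lemma simply_transitive (y : W) : Wa y ->
  (forall t, refl t -> side t p (act y p)) -> y = 1%g.
Proof.
move=> Wy h; have Ep := base_E S.
have : (Wa `&` alcove_stabilizer act C) y; last by rewrite (aw_disjoint (cs_weyl S)).
split=> //; apply/seteqP; split=> [_ [x Cx <-]|x Cx].
  have Ex := alcove_sub S Cx; apply: side_alcove => [|t ht]; first exact: (act_E S).
  apply: (side_trans ht _ (act_E S y Ep)); rewrite ?(h t) //; try exact: (act_E S).
  by rewrite sideJV //; apply: alcove_side (cs_base S) Cx (reflJV y ht).
have Ex := alcove_sub S Cx.
exists (act y^-1%g x); last exact: (actKV S).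
apply: side_alcove => [|t ht]; first exact: (act_E S).
rewrite -(sideJ y) ?(actKV S) //; try exact: (act_E S).
have ht' := reflJ y ht.
apply: (side_trans ht' _ Ep) => //; try exact: (act_E S).
  by rewrite side_sym; apply: h.
exact: alcove_side (cs_base S) Cx ht'.
Qed.

Lemma refl_near x : E x -> exists2 eps, 0 < eps & exists l : seq W,
  forall t y, refl t -> E y -> act t y = y -> (forall i, `|y 0 i - x 0 i| < eps) -> t \in l.
Proof.
move=> Ex; have [eps e0 /finite_seqP [l hl]] := aw_locally_finite (cs_weyl S) Ex.
exists eps => //.
exists [seq xget 1%g [set t | refl t /\ H = fixset act E t] | H <- l].
move=> t y ht Ey fy hy; have [a [c h]] := ht.
have Hl : fixset act E t \in l.
  have : [set` l] (fixset act E t); last by [].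
  by rewrite -hl /=; split; [apply: (mirror_rfl S h)|exists y].
have -> : t = xget 1%g [set u | refl u /\ fixset act E t = fixset act E u].
  case: xgetP => [u _ [[a' [c' h']] eq]|/(_ t)]; last by case.
  have [] := rfl_uniq S h h' => // z Ez /(rfl_fix h Ez) ez; apply/(rfl_fix h' Ez).
  by have : fixset act E t z by []; rewrite eq => -[].
exact: map_f.
Qed.

(** Compactness of the segment, by a supremum: near each parameter only finitely many mirrors meet
    it, and a separating mirror meets it at the parameter [k / (k - m)]. *)
Lemma sep_finite x y : E x -> E y ->
  exists l : seq W, forall t, refl t -> sep t x y -> t \in l.
Proof.
move=> Ex Ey; pose z r := x + r *: (y - x).
have Ez r : E (z r) by apply: aE.
pose fin s := exists l : seq W,
  forall t r, refl t -> 0 <= r <= s -> act t (z r) = z r -> t \in l.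
have loc s : exists2 d, 0 < d & exists l : seq W,
    forall t r, refl t -> `|r - s| < d -> act t (z r) = z r -> t \in l.
  have [eps e0 [l hl]] := refl_near (Ez s).
  pose M := 1 + \sum_i `|(y - x) 0 i|.
  have M0 : 0 < M by rewrite ltr_wpDr // sumr_ge0.
  exists (eps / M); first exact: divr_gt0.
  exists l => t r ht hr fr; apply: (hl t (z r)) => // i.
  have -> : z r 0 i - z s 0 i = (r - s) * (y - x) 0 i by rewrite !mxE; ring.
  rewrite normrM; apply: (@le_lt_trans _ _ (`|r - s| * M)).
    rewrite ler_wpM2l // /M (bigD1 i) //= addrCA lerDl addr_ge0 // sumr_ge0 //.
  by rewrite -ltr_pdivlMr.
have fin_le s s' : s' <= s -> fin s -> fin s'.
  move=> hs [l hl]; exists l => t r ht /andP[r0 r1]; apply: hl => //.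
  by rewrite r0 (le_trans r1).
have fin1 : fin 1.
  apply: contrapT => nf.
  pose A := [set s | 0 <= s /\ fin s].
  have A0 : A 0.
    split=> //; have [d d0 [l hl]] := loc 0; exists l => t r ht.
    by move=> /le_anti <-; apply: hl => //; rewrite subrr normr0.
  have ubA : ubound A 1.
    by move=> s [_ hs]; rewrite leNgt; apply/negP => /ltW h; apply/nf/(fin_le _ _ h).
  have hA : has_sup A by split; [exists 0|exists 1].
  have [d d0 [l hl]] := loc (sup A).
  have [s [s0 [l1 hl1]] hs] := sup_adherent d0 hA.
  have : A (sup A + d / 2).
    split; first by rewrite addr_ge0 ?divr_ge0 ?(ltW d0) ?ub_le_sup //; case: hA.
    exists (l1 ++ l) => t r ht /andP[r0 r1] fr; rewrite mem_cat.
    have [h|h] := leP r s; first by rewrite (hl1 t r) ?r0.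
    by rewrite (hl t r) ?orbT // ltr_norml; apply/andP; split; lra.
  by move=> /(ub_le_sup hA.2); lra.
have [l hl] := fin1; exists l => t ht; have [a [c h]] := ht.
rewrite (sepE h) //; set k := _ - c; set m := _ - c => km.
have kmn : k - m != 0.
  apply: contraTneq km => e; have -> : m = k by lra.
  by rewrite -leNgt -expr2 sqr_ge0.
have s2 : 0 < (k - m) ^+ 2 by rewrite lt_def sqr_ge0 sqrf_eq0 kmn.
apply: (hl t (k / (k - m))) => //.
  have -> : k / (k - m) = (k * (k - m)) / (k - m) ^+ 2 by field.
  apply/andP; split; first by rewrite divr_ge0 ?(ltW s2) //; nra.
  by rewrite ler_pdivrMr // mul1r expr2; nra.
apply/(rfl_fix h (Ez _)); rewrite /z !dotE.
have -> : dot a y = m + c by rewrite /m; ring.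
have -> : dot a x = k + c by rewrite /k; ring.
by field.
Qed.

(* Folding x along a mirror separating it from y injects the mirrors separating
   the image from y into the other mirrors separating x from y, by t |-> t or
   t |-> t0 t t0. *)
Lemma chamber_move (M : set W) x y : (forall t, M t -> refl t) ->
  (forall t t', M t -> M t' -> M (t * t' * t)%g) -> E x -> E y ->
  exists s : seq W, (forall t, t \in s -> M t) /\
    forall t, M t -> ~~ sep t (act (\prod_(r <- s) r)%g x) y.
Proof.
move=> MT MJ Ex Ey; have [l0 hl0] := sep_finite Ex Ey.
have : exists2 l : seq W, (size l <= size l0)%N & forall t, M t -> sep t x y -> t \in l.
  by exists l0 => // t /MT; apply: hl0.
move: (size l0) => k0 {l0 hl0}; elim: k0 x Ex => [|k IH] x Ex [l hk hl].
  exists [::]; rewrite big_nil (cs_act1 S) //; split=> // t Mt; apply/negP => /(hl _ Mt).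
  by case: l hk {hl}.
have [[t0 [M0 s0]]|no] := pselect (exists t0, M t0 /\ sep t0 x y); last first.
  exists [::]; rewrite big_nil (cs_act1 S) //; split=> // t Mt; apply/negP => ht.
  by apply: no; exists t.
pose x' := act t0 x; have Ex' : E x' := act_E S t0 Ex.
(* [g] inverts the folding injection: its values on [l] without [t0] include every mirror of [M]
   separating [x'] from [y]. *)
pose g t := if sep t x' y then t else (t0 * t * t0)%g.
have t00 := refl_invol (MT _ M0); have t0V := refl_inv (MT _ M0).
have ns0 : ~~ sep t0 x' y.
  have [a [c h]] := MT _ M0; move: s0; rewrite !(sepE h) // (rfl_val h) //.
  by rewrite mulNr oppr_lt0 -leNgt; apply: ltW.
have [||s [hs1 hs2]] := IH x'; first exact: Ex'.
  exists [seq g t | t <- rem t0 l].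
    by rewrite size_map size_rem ?hl // -ltnS prednK //; case: (l) (hl _ M0 s0).
  move=> t Mt st.
  have nt : t != t0 by apply: contraTneq st => ->.
  have [sx|nsx] := boolP (sep t x y).
    have -> : t = g t by rewrite /g st.
    apply: map_f; move: (perm_to_rem (hl _ M0 s0)) => /perm_mem /(_ t).
    by rewrite (hl _ Mt sx) inE (negPf nt) /= => <-.
  pose t' := (t0 * t * t0)%g.
  have Mt' : M t' by apply: MJ.
  have t't : (t0 * t' * t0)%g = t by rewrite /t' !mulgA t00 mul1g -mulgA t00 mulg1.
  have [s1 s2] : sep t' x y /\ ~~ sep t' x' y.
    pose y' := act t0 y; have Ey' : E y' := act_E S t0 Ey.
    have e1 : sep t' x y = sep t x' y'.
      by rewrite -(sepJ t0) // t0V -/x' -/y' t't.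
    have e2 : sep t' x' y = sep t x y'.
      by rewrite -(sepJ t0) // t0V -/y' t't /x' -(cs_actM S) // t00 (cs_act1 S).
    rewrite {}e1 {}e2; have [b [d hb]] := MT _ Mt; have [a [c ha]] := MT _ M0.
    move: st nsx s0; rewrite !(sepE hb) // (sepE ha) // -!leNgt.
    have p0 := dot_gt0 (rfl_neq0 ha).
    have val z : E z -> dot b (act t0 z) - d = dot b z - d - (dot a z - c) * (2 * dot a b / dot a a).
      by move=> Ez; case: ha => _ _ _ -> //; rewrite !dotE (dotC b a); field; rewrite gt_eqF.
    rewrite /x' /y' !val //.
    move: (dot b x - d) (dot b y - d) (dot a x - c) (dot a y - c) (2 * _ / _).
    move=> X Y K L G h1 h2 h3.
    (* [K] and [L] have opposite signs, so reflecting in [t0] shifts [X] and [Y] in opposite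
       directions, by [KG] and [LG]. *)
    have h4 : (K * G) * (L * G) <= 0.
      have -> : (K * G) * (L * G) = (K * L) * G ^+ 2 by ring.
      by apply: mulr_le0_ge0; [apply: ltW|apply: sqr_ge0].
    move: h1 h4; set KG := K * G; set LG := L * G => h1 h4.
    have [Y0|Y0|Y0] := ltgtP Y 0; last by rewrite Y0 mulr0 ltxx in h1.
      have X0 : X <= 0 by rewrite -(nmulr_lge0 _ Y0).
      have h5 : 0 < X - KG by rewrite -(nmulr_llt0 _ Y0).
      have h6 : 0 <= LG by rewrite -(nmulr_rle0 (x := KG)) //; lra.
      by split; nra.
    have X0 : 0 <= X by rewrite -(pmulr_lge0 _ Y0).
    have h5 : X - KG < 0 by rewrite -(pmulr_llt0 _ Y0).
    have h6 : LG <= 0 by rewrite -(pmulr_rle0 (x := KG)) //; lra.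
    by split; nra.
  have -> : t = g t' by rewrite /g (negPf s2).
  apply: map_f; move: (perm_to_rem (hl _ M0 s0)) => /perm_mem /(_ t').
  rewrite (hl _ Mt' s1) inE => /esym /orP[/eqP e|] //.
  by move: nt; rewrite -t't e t00 mul1g eqxx.
exists (rcons s t0); split=> [t|t Mt].
  by rewrite mem_rcons inE => /orP[/eqP->|/hs1].
by rewrite big_rcons /= (cs_actM S) //; apply: hs2.
Qed.

Lemma prod_Wa (s : seq W) : (forall t, t \in s -> Wa t) -> Wa (\prod_(r <- s) r)%g.
Proof.
elim: s => [|t s IH] h; first by rewrite big_nil; apply: (Wa1 S).
rewrite big_cons; apply: (WaM S); first by apply: h; rewrite mem_head.
by apply: IH => u hu; apply: h; rewrite inE hu orbT.
Qed.

(** Folding [q] into the alcove of [p] reduces to a conjugate of [y] fixing a point of that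
    alcove. *)
Lemma reg_free (y : W) q : Wa y -> E q -> reg q -> act y q = q -> y = 1%g.
Proof.
move=> Wy Eq rq fq; have Ep := base_E S.
have [||s [hs1 hs2]] := @chamber_move refl q p _ _ Eq Ep; first by [].
  by move=> t t' ht ht'; rewrite -{2}(refl_inv ht); apply: reflJ.
set g := (\prod_(r <- s) r)%g in hs2.
have Wg : Wa g by apply: prod_Wa => t /hs1 /refl_Wa.
pose y' := (g * y * g^-1)%g; have Eg := act_E S g Eq.
have fy' : act y' (act g q) = act g q.
  by rewrite !(cs_actM S) ?(actK S) ?fq //; apply: (act_E S).
suff e : y' = 1%g by apply: (@mulgI _ g); rewrite mulg1; apply: divg1_eq.
apply: simply_transitive => [|t ht]; first exact: (WaJ S).
have h1 t1 : refl t1 -> side t1 p (act g q).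
  move=> h1; apply: reg_side => //; first exact: base_reg.
    exact: reg_act.
  by rewrite sep_sym; apply: hs2.
apply: (side_trans ht Ep Eg); [exact: (act_E S)|exact: h1|].
by rewrite side_sym -{1}fy' sideJV //; apply/h1/reflJV.
Qed.

(** Only finitely many mirrors come near a point of [A], and none contains [A]: they are left one at
    a time by moves inside [A], too small to return to those already left. *)
Lemma reg_exists (A : set V) : A !=set0 -> affine_set A -> A `<=` E ->
  (forall t, refl t -> exists2 x, A x & act t x <> x) -> exists2 z, A z & reg z.
Proof.
move=> [a0 Aa0] aA AE hA; have [eps e0 [l hl]] := refl_near (AE _ Aa0).
have [z [Az hz1 hz2]] : exists z, [/\ A z, forall i, `|z 0 i - a0 0 i| < eps &
    forall t, t \in l -> refl t -> act t z <> z].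
  elim: l {hl} => [|t l [z [Az hz1 hz2]]].
    by exists a0; split=> // i; rewrite subrr normr0.
  have [[ht ft]|nt] := pselect (refl t /\ act t z = z); last first.
    exists z; split=> // t'; rewrite inE => /orP[/eqP-> ht ft|]; last exact: hz2.
    by apply: nt.
  have [z' Az' hz'] := hA _ ht.
  pose ze e := z + e *: (z' - z); have Aze e : A (ze e) by apply: aA.
  have n1 : near0 (fun e => forall i : 'I_n, i \in enum 'I_n ->
      0 < (eps - (z 0 i - a0 0 i)) + e * (- (z' - z) 0 i) /\
      0 < (eps + (z 0 i - a0 0 i)) + e * ((z' - z) 0 i)).
    apply: near0_all => i _; have := hz1 i; rewrite ltr_norml => /andP[h1 h2].
    by apply: near0_and; apply: near0_pos; lra.
  have n2 : near0 (fun e => forall t', t' \in t :: l -> refl t' -> act t' (ze e) <> ze e).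
    apply: near0_all => t' ht'.
    have [[a [c h]]|no] := pselect (refl t'); last by exists 1.
    have val e : dot a (ze e) - c = (dot a z - c) + e * (dot a z' - dot a z).
      by rewrite /ze !dotE; ring.
    have fixP e : act t' (ze e) = ze e -> (dot a z - c) + e * (dot a z' - dot a z) = 0.
      by move/(rfl_fix h (AE _ (Aze e))) => e1; rewrite -val e1 subrr.
    have [k0|k0] := eqVneq (dot a z - c) 0.
      have et : t' = t.
        move: ht'; rewrite inE => /orP[/eqP //|/hz2 h2]; exfalso.
        by apply: h2; [exists a, c|apply/(rfl_fix h (AE _ Az))/eqP; rewrite -subr_eq0 k0].
      exists 1 => // e /andP[ep _] _ /fixP; rewrite k0 add0r => /eqP.
      rewrite mulf_eq0 gt_eqF //= => /eqP e2; apply: hz'; rewrite -et.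
      apply/(rfl_fix h (AE _ Az')); lra.
    have [e1 e1p h1] := near0_neq0 (dot a z' - dot a z) k0.
    by exists e1 => // e /h1 /eqP h2 _ /fixP.
  have [e ep [h1 h2]] := near0_exists (near0_and n1 n2).
  exists (ze e); split=> // i; have := h1 i (mem_enum _ i).
  rewrite ltr_norml !mxE => -[h3 h4]; apply/andP; split; lra.
exists z => // t ht ft; apply: (hz2 t) => //; exact: hl ht (AE _ Az) ft hz1.
Qed.

Lemma side_avg t q (I : finType) (F : I -> V) : refl t -> E q -> (0 < #|I|)%N ->
  (forall i, E (F i)) -> (forall i, side t q (F i)) ->
  side t q (#|I|%:R^-1 *: \sum_i F i).
Proof.
move=> [a [c h]] Eq I0 EF hF.
have c0 : (#|I|%:R : R) != 0 by rewrite pnatr_eq0 -lt0n.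
have [Ee _] := paff_avg (cs_paff S 1%g) aE I0 EF.
rewrite (sideE h) // dotZr dot_sumr.
have -> : #|I|%:R^-1 * \sum_i dot a (F i) - c = #|I|%:R^-1 * \sum_i (dot a (F i) - c).
  by rewrite sumrB mulrBr sumr_const -(mulr_natl c) mulKf.
rewrite mulrCA mulr_sumr pmulr_rgt0 ?invr_gt0 ?ltr0n //.
have [i0 _] := card_gt0P I0.
rewrite (bigD1 i0) //= ltr_pwDl //; first by rewrite -(sideE h).
by apply: sumr_ge0 => i _; rewrite ltW // -(sideE h).
Qed.

Lemma orbit_avg f s q : paff E f s -> E q -> iter n`! f q = q ->
  let e := (n`!)%:R^-1 *: \sum_(i < n`!) iter i f q in E e /\ f e = e.
Proof.
move=> hf Eq fq; have N0 : (0 < #|'I_(n`!)|)%N by rewrite card_ord fact_gt0.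
have Ei i : E (iter i f q) by elim: i => //= i IH; apply: hf.1.
have [] := paff_avg hf aE N0 (fun i : 'I_(n`!) => Ei i).
rewrite card_ord => h1 h2; split=> //; rewrite {}h2; congr (_ *: _).
case: (n`!) fq => [|N] fq; first by rewrite !big_ord0.
rewrite big_ord_recr big_ord_recl /= addrC; congr (_ + _); first exact: fq.

Qed.

(** Replaces the theorem that pointwise stabilizers are generated by reflections. An iterate of [y]
    is a translation with a fixed point, so [q] has a finite orbit; its average is fixed by [y] and
    on the side of [q] for all mirrors containing [A]. Hence no mirror contains every fixed point of
    [y], and [y] fixes a regular point. *)
Lemma rigid (A : set V) (y : W) q : Wa y -> A !=set0 -> A `<=` E ->
  (forall x, A x -> act y x = x) -> E q ->
  (forall t, refl t -> (forall x, A x -> act t x = x) -> side t q (act y q)) ->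
  y = 1%g.
Proof.
move=> Wy [a Aa] AE fA Eq hq; have Ea := AE _ Aa.
have fN : iter n`! (act y) q = q.
  rewrite (paff_translation (cs_paff S y) Ea) //.
  have -> : iter n`! (act y) a = a by elim: (n`!) => //= k ->; apply: fA.
  by rewrite subrr addr0.
have [Ee fe] := orbit_avg (cs_paff S y) Eq fN.
set e := (X in E X) in Ee fe.
have Ei i : E (iter i (act y) q) by elim: i => //= i IH; apply: (act_E S).
have hi i t : refl t -> (forall x, A x -> act t x = x) -> side t q (iter i (act y) q).
  elim: i t => [|i IH] t ht tA /=.
    by have h := hq _ ht tA; apply: (side_trans ht Eq (act_E S y Eq) Eq h); rewrite side_sym.
  apply: (side_trans ht Eq (act_E S y Eq)); [exact: (act_E S)|exact: hq|].
  rewrite sideJV //; apply: IH; first exact: reflJV.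
  move=> x Ax; have Ex := AE _ Ax.
  by rewrite (cs_actM S) // fA // (cs_actM S) // tA // -{1}(fA _ Ax) (actK S).
have [||||z [Ez fz] rz] := @reg_exists (fun x => E x /\ act y x = x).
- by exists e.
- move=> u v w k [Eu fu] [Ev fv] [Ew fw]; split; first exact: aE.
  rewrite (actD S) //; last by apply: (dirZ _ aE); apply: dirB.
  by rewrite linearZ /= -(actB S) // fu fv fw.
- by move=> x [].
- move=> t ht; apply: contrapT => no.
  have tfix x : E x -> act y x = x -> act t x = x.
    by move=> Ex fx; apply: contrapT => h; apply: no; exists x.
  have : side t q e.
    have N0 : (0 < #|'I_(n`!)|)%N by rewrite card_ord fact_gt0.
    rewrite /e -{1}(card_ord n`!); apply: side_avg => // i; apply: hi => // x Ax.
    by apply: tfix; [apply: AE|apply: fA].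
  by rewrite side_sym => /side_fix; apply; apply: tfix.
- exact: (reg_free Wy Ez rz fz).
Qed.

End Chambers.

(** * Length, straightness and traces of mirrors *)

Section Length.
Variables (R : realType) (n : nat) (E : set 'rV[R]_n) (W : groupType).
Variables (act : W -> 'rV[R]_n -> 'rV[R]_n) (ws : W -> 'S_n).
Variables (Wa : set W) (C : set 'rV[R]_n) (p : 'rV[R]_n).
Hypothesis S : cox_system E act ws Wa C p.
Local Notation V := 'rV[R]_n.
Implicit Types (x y z a v : V) (t w u : W) (c : R).
Local Notation refl := (refl E act Wa).
Local Notation reg := (reg E act Wa).
Local Notation side := (side act).
Local Notation sep := (sep act).
Local Notation length := (length act E Wa C).

Lemma sep_addb t x y z : refl t -> E x -> E y -> E z -> reg x -> reg y -> reg z ->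
  sep t x z = sep t x y (+) sep t y z.
Proof.
move=> ht Ex Ey Ez rx ry rz; have [a [c h]] := ht.
have nz v : E v -> reg v -> dot a v - c != 0.
  by move=> Ev rv; rewrite subr_eq0; apply/eqP => /(rfl_fix h Ev); apply: rv.
rewrite !(sepE h) // !mulr_lt0 !nz //=.
by case: (_ < 0); case: (_ < 0); case: (_ < 0).
Qed.

Lemma simple_refl r : simple_reflection act E Wa C r -> refl r.
Proof. by move=> [Wr [hm _]]; apply: (mirror_fixP S). Qed.

(** A wall has a point [y] on no other mirror, reached from a point [x] of the alcove. A mirror
    other than that of [r] keeps [p], [x], [y], [act r x] and [act r p] on one side. *)
Lemma simple_sep r t : simple_reflection act E Wa C r -> refl t ->
  sep t p (act r p) = (t == r).
Proof.
move=> hr ht; have rr := simple_refl hr; have [a [c h]] := rr.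
have [Wr [_ [y [Hy hy [x Cx hx]]]]] := hr.
have Ep := base_E S; have Ex := alcove_sub S Cx; have [Ey fy] := Hy.
have [->|nt] := eqVneq t r.
  rewrite (sepE h) ?(rfl_val h) //; last exact: (act_E S).
  rewrite mulrN oppr_lt0 -expr2 lt_def sqr_ge0 sqrf_eq0 andbT subr_eq0.
  by apply/eqP => /(rfl_fix h Ep); apply: (base_reg S).
have off t1 : refl t1 -> t1 != r -> act t1 y <> y.
  move=> [a1 [c1 h1]] n1 f1; move/eqP: n1; apply.
  have eF : fixset act E t1 = fixset act E r.
    by apply: hy; [apply: (mirror_rfl S h1)|].
  have [] // := rfl_uniq S h1 h => z Ez /(rfl_fix h1 Ez) ez; apply/(rfl_fix h Ez).
  by have : fixset act E t1 z by []; rewrite eF => -[].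
have nsep t1 : refl t1 -> t1 != r -> side t1 y x.
  move=> r1 n1; have [a1 [c1 h1]] := r1.
  rewrite (sideE h1) // ltNge; apply/negP => le0.
  have k0 : dot a1 y - c1 != 0.
    by rewrite subr_eq0; apply/eqP => /(rfl_fix h1 Ey); apply: off.
  have sq : 0 < (dot a1 y - c1) ^+ 2 by rewrite lt_def sqr_ge0 sqrf_eq0 k0.
  have dz : dot a1 y - dot a1 x != 0.
    by apply: contraTneq le0 => e; rewrite -ltNge (_ : dot a1 x = dot a1 y) -?expr2 //; lra.
  have hd : 0 < (dot a1 y - dot a1 x) ^+ 2 by rewrite lt_def sqr_ge0 sqrf_eq0 dz.
  pose q := (dot a1 y - c1) / (dot a1 y - dot a1 x).
  have eq' : q = ((dot a1 y - c1) * (dot a1 y - dot a1 x)) / (dot a1 y - dot a1 x) ^+ 2.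
    by rewrite /q; field.
  have q01 : 0 < q <= 1.
    rewrite eq'; apply/andP; split.
      by rewrite divr_gt0 //; move: le0 sq; rewrite expr2; lra.
    by rewrite ler_pdivrMr // mul1r !expr2; nra.
  have Cs := hx _ q01; have Es := alcove_sub S Cs.
  apply: (side_fix (alcove_side S Cs Cs r1)).
  apply/(rfl_fix h1 Es); rewrite /segment_pt !dotE /q; by field.
apply/negbTE/side_sepN.
have Er := act_E S r Ex; have Erp := act_E S r Ep.
have s1 : side t p x by apply: (alcove_side S (cs_base S) Cx).
have s2 : side t (act r x) (act r p).
  by rewrite (sideJV S) //; apply: (alcove_side S Cx (cs_base S)); apply: (reflJV S).
have s3 : side t y x by apply: nsep.
have s4 : side t y (act r x).
  rewrite -{1}fy (sideJV S) // nsep ?(refl_inv S rr) //.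
    by rewrite -{1}(refl_inv S rr); apply: (reflJV S).
  apply: contraNneq nt => /(congr1 (fun z : W => r * z * r)%g).
  by rewrite !mulgA (refl_invol S rr) mul1g -mulgA (refl_invol S rr) mulg1 mul1g => ->.
have s5 : side t p y by apply: (side_trans ht Ep Ex Ey s1); rewrite side_sym.
by apply: (side_trans ht Ep Er Erp (side_trans ht Ep Ey Er s5 s4)).
Qed.

(** For a word [r1 ... rk] in simple reflections, the conjugates of [ri] by [r1 ... r(i-1)]: their
    mirrors are those crossed in turn by the gallery from [p] to its image. *)
Fixpoint word_refls (s : seq W) : seq W :=
  if s is r :: s' then r :: [seq (r * k * r)%g | k <- word_refls s'] else [::].

Lemma size_word_refls s : size (word_refls s) = size s.
Proof. by elim: s => //= r s IH; rewrite size_map IH. Qed.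

Lemma word_refls_refl s : (forall r, r \in s -> refl r) ->
  forall t, t \in word_refls s -> refl t.
Proof.
elim: s => //= r s IH hs t.
have rr : refl r by apply: hs; rewrite mem_head.
rewrite inE => /orP[/eqP-> //|/mapP[k hk ->]].
rewrite -{2}(refl_inv S rr); apply: (reflJ S); apply: IH => // u hu.
by apply: hs; rewrite inE hu orbT.
Qed.

Lemma word_sep s t : (forall r, r \in s -> simple_reflection act E Wa C r) -> refl t ->
  sep t p (act (\prod_(r <- s) r)%g p) = odd (count_mem t (word_refls s)).
Proof.
elim: s t => [|r s IH] t hs ht; have Ep := base_E S.
  rewrite big_nil (cs_act1 S) //; apply/negbTE/side_sepN.
  exact: (alcove_side S (cs_base S) (cs_base S)).
have hr : simple_reflection act E Wa C r by apply: hs; rewrite mem_head.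
have rr := simple_refl hr; have rp := base_reg S.
rewrite big_cons (cs_actM S) // /= oddD.
rewrite (@sep_addb t p (act r p)) //; first 1 last.
- exact: (act_E S).
- by apply: (act_E S); apply: (act_E S).
- exact: (reg_act S).
- by apply: (reg_act S); [apply: (act_E S)|apply: (reg_act S)].
rewrite (simple_sep hr ht) eq_sym oddb; congr (_ (+) _).
rewrite (sepJV S) //; last exact: (act_E S).
have rt : refl (r^-1 * t * r)%g by apply: (reflJV S).
rewrite IH //; last by move=> u hu; apply: hs; rewrite inE hu orbT.
rewrite count_map; congr odd; apply: eq_count => k /=.
apply/eqP/eqP => [->|<-]; last by rewrite (refl_inv S rr) !mulgA (refl_invol S rr) mul1g -mulgA (refl_invol S rr) mulg1.
by rewrite (refl_inv S rr) !mulgA (refl_invol S rr) mul1g -mulgA (refl_invol S rr) mulg1.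
Qed.

Lemma word_exchange s k : (forall r, r \in s -> refl r) -> k \in word_refls s ->
  exists s', [/\ (size s' < size s)%N, {subset s' <= s} &
    (k * \prod_(r <- s) r = \prod_(r <- s') r)%g].
Proof.
elim: s k => // r s IH k hs; have rr : refl r by apply: hs; rewrite mem_head.
rewrite inE => /orP[/eqP->|/mapP[k1 hk1 ->]].
  exists s; split=> //; first by move=> u hu; rewrite inE hu orbT.
  by rewrite big_cons mulgA (refl_invol S rr) mul1g.
have [|s' [h1 h2 h3]] := IH _ _ hk1; first by move=> u hu; apply: hs; rewrite inE hu orbT.
exists (r :: s'); split=> //.
  by move=> u; rewrite !inE => /orP[->|/h2 ->]; rewrite ?orbT.
by rewrite !big_cons -h3 !mulgA -(mulgA _ r r) (refl_invol S rr) mulg1.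
Qed.

Lemma word_deletion s : (forall r, r \in s -> refl r) -> ~~ uniq (word_refls s) ->
  exists s', [/\ (size s' < size s)%N, {subset s' <= s} &
    (\prod_(r <- s) r = \prod_(r <- s') r)%g].
Proof.
elim: s => // r s IH hs; have rr : refl r by apply: hs; rewrite mem_head.
have hs' u : u \in s -> refl u by move=> hu; apply: hs; rewrite inE hu orbT.
rewrite /= negb_and negbK map_inj_uniq; last by move=> u v /mulIg /mulgI.
move=> /orP[/mapP[k hk e]|/(IH hs')[s' [h1 h2 h3]]].
  have ek : k = r.
    apply: (@mulgI _ r); apply: (@mulIg _ r).
    by rewrite -e (refl_invol S rr) mul1g.
  rewrite {}ek in hk; have [s' [h1 h2 h3]] := word_exchange hs' hk.
  exists s'; split; first exact: ltn_trans h1 _.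
    by move=> u /h2 hu; rewrite inE hu orbT.
  by rewrite big_cons h3.
exists (r :: s'); split=> //; last by rewrite !big_cons h3.
by move=> u; rewrite !inE => /orP[->|/h2 ->]; rewrite ?orbT.
Qed.

Lemma has_word_exists w : exists k, has_word act E Wa C w k.
Proof.
have [u [tau [Wu htau ->]]] := aw_prod (cs_weyl S) w.
have [s hs ->] := aw_generated (cs_weyl S) Wu.
by exists (size s), s, tau.
Qed.

(** By the deletion property a minimal word crosses no mirror twice, so the mirrors crossed an odd
    number of times are all of [word_refls]. The factor [tau] keeps [p] in the alcove and crosses
    nothing. *)
Lemma length_sep w : exists l : seq W,
  [/\ uniq l, size l = length w & forall t, t \in l <-> refl t /\ sep t p (act w p)].
Proof.
have Ep := base_E S.
have [k hk] : exists k, has_word act E Wa C w k /\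
    forall k', has_word act E Wa C w k' -> (k <= k')%N.
  have ex : exists k, `[< has_word act E Wa C w k >].
    by have [k hk] := has_word_exists w; exists k; apply/asboolP.
  have [k /asboolP hk hmin] := ex_minnP ex.
  by exists k; split=> // k' hk'; apply/hmin/asboolP.
have [[s [tau [sk hs htau ew]]] kmin] := hk.
have hs' r : r \in s -> refl r by move=> /hs /simple_refl.
have us : uniq (word_refls s).
  apply: contrapT => /negP /(word_deletion hs') [s' [h1 h2 h3]].
  have : has_word act E Wa C w (size s').
    exists s', tau; split=> //; first by move=> r /h2; apply: hs.
    by rewrite ew h3.
  by move=> /kmin; rewrite leqNgt -sk h1.
exists (word_refls s); split=> //.
  rewrite size_word_refls sk /Defs.length; case: xgetP => [k' _ [h1 h2]|/(_ k)]; last by [].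
  by apply/eqP; rewrite eqn_leq h2 ?kmin //; exact: hk.1.
have cE t : refl t -> sep t p (act w p) = (t \in word_refls s).
  move=> ht; have <- : odd (count_mem t (word_refls s)) = (t \in word_refls s).
    by rewrite count_uniq_mem // oddb.
  rewrite -word_sep // ew (cs_actM S) //.
  set u := (\prod_(r <- s) r)%g.
  have Et := act_E S tau Ep.
  have Ct : C (act tau p) by rewrite -htau; exists p => //; apply: (cs_base S).
  have rp := base_reg S.
  rewrite (@sep_addb t p (act u p)) //; try (by apply: (act_E S)); first 1 last.
  - exact: (reg_act S).
  - by apply: (reg_act S) => //; apply: (reg_act S).
  rewrite (_ : sep t (act u p) _ = false) ?addbF //.
  apply/negbTE/side_sepN; rewrite (sideJV S) //.
  by apply: (alcove_side S (cs_base S) Ct); apply: (reflJV S).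
move=> t; split=> [ht|[ht]]; last by rewrite cE.
by have rt := word_refls_refl hs' ht; rewrite cE.
Qed.

(* No mirror is crossed twice along the orbit of p under x. *)
Definition chain (x : W) := forall i j t, (i < j)%N -> refl t ->
  ~~ (sep t (act (x ^+ i)%g p) (act (x ^+ i.+1)%g p) &&
      sep t (act (x ^+ j)%g p) (act (x ^+ j.+1)%g p)).

(** Step [i] crosses the [length x] mirrors in [A i], and [L m] collects those of the first [m]
    steps. A mirror separates the two ends when it is crossed an odd number of times, so the length
    of [x ^+ m] equals the size of [L m] exactly when [L m] has no repetition. *)
Lemma straight_chainP (x : W) :
  (forall m, length (x ^+ m)%g = (m * length x)%N) <-> chain x.
Proof.
have Ep := base_E S; have rp := base_reg S.
have [l [ul sl hl]] := length_sep x.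
pose A i := [seq (x ^+ i * t * x^-1 ^+ i)%g | t <- l].
have sA i : size (A i) = length x by rewrite size_map.
have uA i : uniq (A i) by rewrite map_inj_uniq // => u v /mulIg /mulgI.
have hA i t : refl t -> sep t (act (x ^+ i)%g p) (act (x ^+ i.+1)%g p) = (t \in A i).
  move=> ht; rewrite expgSr (cs_actM S) // (sepJV S) //; last exact: (act_E S).
  have rt : refl ((x ^+ i)^-1 * t * x ^+ i)%g by apply: (reflJV S).
  apply/idP/mapP => [h|[t' /hl [rt' h] ->]].
    exists ((x ^+ i)^-1 * t * x ^+ i)%g; first by apply/hl.
    by rewrite expVgn !mulgA mulgV mul1g mulgK.
  by rewrite expVgn !mulgA mulVg mul1g mulgVK.
have rA i t : t \in A i -> refl t.
  by move=> /mapP[t' /hl [rt' _] ->]; rewrite expVgn; apply: (reflJ S).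
pose L m := flatten [seq A i | i <- iota 0 m].
have LS m : L m.+1 = L m ++ A m by rewrite /L -addn1 iotaD map_cat flatten_cat /= cats0.
have sL m : size (L m) = (m * length x)%N.
  by elim: m => // m IH; rewrite LS size_cat IH sA mulSn addnC.
have hL m t : refl t -> sep t p (act (x ^+ m)%g p) = odd (count_mem t (L m)).
  move=> ht; elim: m => [|m IH].
    rewrite expg0 (cs_act1 S) //; apply/negbTE/side_sepN.
    exact: (alcove_side S (cs_base S) (cs_base S)).
  have Em := act_E S (x ^+ m)%g Ep; have Em1 := act_E S (x ^+ m.+1)%g Ep.
  rewrite LS count_cat oddD (@sep_addb t p (act (x ^+ m)%g p)) //; try exact: (reg_act S).
  by rewrite IH hA // (count_uniq_mem _ (uA m)) oddb.
have rL m t : t \in L m -> refl t.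
  by move=> /flattenP[s /mapP[i _ ->]]; apply: rA.
split=> [hst i j t ij ht|hch m].
  have [N [uN sN hN]] := length_sep (x ^+ j.+1)%g.
  have uL : uniq (L j.+1).
    apply: (leq_size_uniq uN); last by rewrite sL sN hst.
    move=> u /hN [ru]; rewrite hL // => ho.
    by rewrite -has_pred1 has_count; case: count ho.
  rewrite !hA //; apply/negP => /andP[h1 h2].
  move: uL; rewrite LS cat_uniq => /and3P[_ /hasPn /(_ t h2) /negP h _]; apply: h.
  by apply/flattenP; exists (A i) => //; apply: map_f; rewrite mem_iota.
have uL : uniq (L m).
  elim: m => // m IH; rewrite LS cat_uniq IH uA andbT /=; apply/hasPn => t ht /=.
  apply/negP => /flattenP[s /mapP[i]]; rewrite mem_iota /= add0n => im -> hi.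
  by have := hch _ _ _ im (rA _ _ ht); rewrite !hA ?ht ?hi //; apply: rA ht.
have [N [uN sN hN]] := length_sep (x ^+ m)%g.
rewrite -sN -sL; apply: perm_size; apply: uniq_perm => // t.
have ct : odd (count_mem t (L m)) = (t \in L m) by rewrite count_uniq_mem // oddb.
by apply/idP/idP => [/hN[rt]|ht]; [|apply/hN; have rt := rL _ _ ht; split=> //];
  rewrite hL // ct.
Qed.

End Length.

(** * Traces over [F] of mirrors over [L] *)

Section Trace.
Variables (R : realType) (n : nat) (E : set 'rV[R]_n) (W : groupType).
Variables (act : W -> 'rV[R]_n -> 'rV[R]_n) (ws : W -> 'S_n).
Variables (Wa : set W) (C : set 'rV[R]_n) (p : 'rV[R]_n).
Hypothesis S : cox_system E act ws Wa C p.
Variables (tau : 'rV[R]_n -> 'rV[R]_n) (ts : 'S_n) (sg : W -> W).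
Hypothesis htau : aut E act Wa tau ts sg.
Let A : set 'rV[R]_n := E `&` [set x | tau x = x].
Variables (W' : groupType) (j : W' -> W) (ws' : W' -> 'S_n) (Wa' : set W').
Variable C' : set 'rV[R]_n.
Local Notation act' := (fun w => act (j w)).
Hypothesis S' : cox_system A act' ws' Wa' C' p.
Hypothesis fixed_Wa : forall g, Wa g -> sg g = g -> exists2 w, Wa' w & j w = g.
Local Notation V := 'rV[R]_n.
Implicit Types (x y z a v : V).
Local Notation reflF := (refl A act' Wa').
Local Notation sepF := (sep act').
Local Notation refl := (refl E act Wa).
Local Notation side := (side act).
Local Notation sep := (sep act).

Lemma tau_inj x y : E x -> E y -> tau x = tau y -> x = y.
Proof.
move=> Ex Ey e; apply/eqP; rewrite -subr_eq0 -(col_permK ts (x - y)).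
by rewrite -(aut_B htau) // e subrr linear0.
Qed.

(* The reflection over F is the element of the pointwise fixer of the trace that
   moves p to the other side; it is unique, hence fixed by the Frobenius. *)
Lemma trace_refl t x y : refl t -> A x -> A y -> sep t x y ->
  exists2 t', reflF t' &
    forall u v, A u -> A v -> sepF t' u v = sep t u v.
Proof.
move=> ht Ax Ay sxy; have Ep := base_E S; have Ap := base_E S'.
have aA : affine_set A := cs_affine S'; have aE := cs_affine S.
have AE u : A u -> E u by case.
have Atau u : A u -> tau u = u by case.
have [a [c h]] := ht; pose k u := dot a u - c.
have kfix u : E u -> act t u = u <-> k u = 0.
  move=> Eu; rewrite (rfl_fix h Eu) /k; split=> [->|/eqP]; first by rewrite subrr.
  by rewrite subr_eq0 => /eqP.
have kp : k p != 0 by apply/eqP => /(kfix _ Ep); apply: (base_reg S).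
(* [p] is off the mirror of [t], so one of [x] and [y] is strictly opposite to it. *)
have [q Aq kpq] : exists2 q, A q & k p * k q < 0.
  move: sxy; rewrite (sepE h (AE _ Ax) (AE _ Ay)) -/(k x) -/(k y) => kxy.
  have [hx|hx] := ltP (k p * k x) 0; first by exists x.
  exists y => //; have kx0 : k x != 0 by apply: contraTneq kxy => ->; rewrite mul0r ltxx.
  have : 0 < k p * k x by rewrite lt_def hx mulf_neq0.
  move=> hx'; exact: mulr_gt0_lt0 hx' kxy.
have Eq := AE _ Aq.
have kpq0 : k p - k q != 0 by apply: contraTneq kpq => e; rewrite -leNgt (_ : k q = k p) -?expr2 ?sqr_ge0 //; lra.
pose h0 := p + (k p / (k p - k q)) *: (q - p).
have Ah0 : A h0 by apply: aA.
have kh0 : k h0 = 0 by rewrite /k /h0 !dotE; move: kpq0; rewrite /k => kpq0; field; lra.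
pose H u := A u /\ k u = 0.
have Hh0 : H h0 by [].
have proj z u : A z -> k z != 0 -> A u -> H (u + (- (k u / k z)) *: (z - h0)).
  move=> Az kz Au; split; first exact: aA.
  have : k (u + (- (k u / k z)) *: (z - h0)) = k u - (k u / k z) * (k z - k h0).
    by rewrite /k !dotE; ring.
  by rewrite kh0 subr0 divfK // subrr.
(* The trace [H] is a hyperplane of [A]: fixing it and one point of [A] off it means fixing [A]. *)
have spread w z : (forall u, H u -> act w u = u) -> A z -> k z != 0 -> act w z = z ->
    forall u, A u -> act w u = u.
  move=> wH Az kz wz u Au; have Hv := proj _ _ Az kz Au.
  move: Hv; set v := (X in H X) => Hv.
  have -> : u = v + (k u / k z) *: (z - h0) by rewrite /v scaleNr subrK.
  have Ev : E v by apply/AE; case: Hv.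
  rewrite (actD S) //; last exact: (dirZ _ aE (dirB aE (AE _ Az) (AE _ Ah0))).
  by rewrite linearZ /= -(actB S _ (AE _ Az) (AE _ Ah0)) (wH _ Hv) (wH _ Hh0) wz.
pose M t1 := refl t1 /\ forall u, H u -> act t1 u = u.
have MJ w t1 : (forall u, H u -> act w u = u) -> M t1 -> M (w * t1 * w^-1)%g.
  move=> wH [r1 f1]; split; first exact: (reflJ S).
  move=> u Hu; have Eu : E u by apply/AE; case: Hu.
  have wV : act w^-1%g u = u by rewrite -{1}(wH _ Hu) (actK S).
  by rewrite !(cs_actM S) ?wV ?f1 ?wH.
have Moff t1 z : M t1 -> A z -> k z != 0 -> act t1 z <> z.
  move=> [r1 f1] Az kz e.
  by apply: (base_reg S r1); apply: (spread _ z).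
have kq : k q != 0 by apply: contraTneq kpq => ->; rewrite mulr0 ltxx.
have [||s [hs1 hs2]] := @chamber_move _ _ _ _ _ _ _ _ _ S M p q _ _ Ep Eq.
- by move=> t1 [].
- move=> t1 t2 M1 M2; rewrite -{2}(refl_inv S M1.1); apply: MJ => //; exact: M1.2.
set g := (\prod_(r <- s) r)%g in hs2.
have Wg : Wa g by apply: (prod_Wa S) => t1 /hs1 [/refl_Wa].
have gH u : H u -> act g u = u.
  move=> Hu; have Eu : E u by apply/AE; case: Hu.
  rewrite /g; elim: (s) hs1 => [|t1 l IH] hl; first by rewrite big_nil (cs_act1 S).
  rewrite big_cons (cs_actM S) // IH; last by move=> t2 h2; apply: hl; rewrite inE h2 orbT.
  by have [_] := hl t1 (mem_head _ _); apply.
have Egp := act_E S g Ep.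
have gside t1 : M t1 -> side t1 (act g p) q.
  move=> M1; have [a1 [c1 h1]] := M1.1.
  have := hs2 _ M1; rewrite (sepE h1) // (sideE h1) // -leNgt lt_def => ->.
  rewrite andbT mulf_neq0 // subr_eq0; apply/eqP => /(rfl_fix h1).
    by move=> /(_ Egp); apply: (reg_act S) M1.1 => //; apply: (base_reg S).
  by move=> /(_ Eq); apply: Moff.
(* Both [g] and [sg g] fix [H] and move [p] to the side of [q] for every mirror containing [H],
   since [p] and [q] are Frobenius-fixed; [rigid] makes them equal. *)
have fg : sg g = g.
  have fH u : H u -> act (sg g) u = u.
    by move=> Hu; have [Au _] := Hu; rewrite -{1}(Atau _ Au) -(aut_equiv htau) ?gH ?Atau //; apply: AE.
  have Wsg := aut_Wa htau Wg.
  have : (g^-1 * sg g = 1)%g; last by move=> e; rewrite -[sg g](mulKVg g) e mulg1.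
  apply: (rigid S (A := H) (q := p)) => //.
  - by apply: (WaM S) => //; apply: (WaV S).
  - by exists h0.
  - by move=> u [/AE].
  - move=> u Hu; have Eu : E u by apply/AE; case: Hu.
    by rewrite (cs_actM S) // fH // -{1}(gH _ Hu) (actK S).
  move=> t1 r1 f1.
  have M1 : M t1 by split.
  have M2 : M (g * t1 * g^-1)%g by apply: MJ.
  rewrite -(sideJ S g) //; last exact: (act_E S).
  rewrite -(cs_actM S) // mulKVg.
  apply: (side_trans M2.1 Egp Eq); [exact: (act_E S)|exact: gside|].
  have [t3 r3 e3] := aut_reflV S htau M2.1.
  have M3 : M t3.
    split=> // u Hu; have Eu : E u by apply/AE; case: Hu.
    apply: tau_inj => //; first exact: (act_E S).
    by rewrite (aut_equiv htau) // e3 Atau ?M2.2 //; case: Hu.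
  rewrite side_sym -e3 -{1}(Atau _ Ap) -{1}(Atau _ Aq) -(aut_equiv htau) //.
  by rewrite (aut_side S htau) //; apply: gside.
have [t' Wt' et'] := fixed_Wa Wg fg.
have Mt : M t by split=> // u [Au ku]; apply/(kfix _ (AE _ Au)).
(* The mirror of [t] contains [H] and separates [p] from [q], so [g] must move [p]. *)
have gp : act g p <> p.
  move=> e; have := gside _ Mt; rewrite e (sideE h) // -/(k p) -/(k q).
  by rewrite ltNge ltW.
have fixE : fixset act' A t' = A `&` [set u | dot a u = c].
  apply/seteqP; split=> u [Au /= hu]; split=> //=.
    apply/eqP; rewrite -subr_eq0 -/(k u); apply: contrapT => /negP ku.
    by apply: gp; apply: (spread _ u) => //; rewrite -et'.
  by rewrite et'; apply: gH; split=> //; rewrite /k hu subrr.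
have [a' [c' h']] : exists a' c', rfl A act' Wa' t' a' c'.
  apply: (mirror_fixP S') => //; split; last by exists t'.
  split.
  - by exists h0; rewrite fixE; split=> //=; apply/eqP; rewrite -subr_eq0 -/(k h0) kh0.
  - by rewrite fixE => eA; move: Ap; rewrite -eA => -[_ /= e]; move: kp; rewrite /k e subrr eqxx.
  - by exists a, c.
exists t'; first by exists a', c'.
pose k' u := dot a' u - c'.
have k'H u : H u -> k' u = 0.
  move=> [Au ku]; rewrite /k'; apply/eqP; rewrite subr_eq0; apply/eqP/(rfl_fix h' Au).
  by rewrite et'; apply: gH.
have k'p : k' p != 0.
  by rewrite /k' subr_eq0; apply/eqP => /(rfl_fix h' Ap); rewrite et'.
(* Two affine functions on [A] vanishing on the hyperplane [H] are proportional, hence give the same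
   separation relation. *)
have kk u : A u -> k' u = (k' p / k p) * k u.
  move=> Au; have := k'H _ (proj _ _ Ap kp Au).
  have -> : k' (u + (- (k u / k p)) *: (p - h0)) = k' u - (k u / k p) * (k' p - k' h0).
    by rewrite /k' !dotE; ring.
  rewrite (k'H _ Hh0) subr0 => /eqP; rewrite subr_eq0 => /eqP ->.
  by field.
move=> u v Au Av; rewrite (sepE h' Au Av) (sepE h (AE _ Au) (AE _ Av)).
rewrite -[dot a' u - c']/(k' u) -[dot a' v - c']/(k' v) (kk _ Au) (kk _ Av).
rewrite mulrACA pmulr_rlt0 // -expr2 lt_def sqr_ge0 sqrf_eq0 andbT.
by rewrite mulf_neq0 ?invr_neq0.
Qed.

Hypothesis jM : forall w u, j (w * u)%g = (j w * j u)%g.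
Hypothesis j1 : j 1%g = 1%g.

(** All iterates of [p] lie in [A], so a mirror over [L] crossed twice would have a trace over [F]
    crossed twice. *)
Lemma trace_straight (x : W') :
  (forall m, Defs.length act' A Wa' C' (x ^+ m)%g = (m * Defs.length act' A Wa' C' x)%N) ->
  forall m, Defs.length act E Wa C (j x ^+ m)%g = (m * Defs.length act E Wa C (j x))%N.
Proof.
move=> /(straight_chainP S') hx; apply/(straight_chainP S) => i k t ik ht.
have jX m : (j x ^+ m = j (x ^+ m))%g.
  by elim: m => [|m IH]; [rewrite !expg0 j1|rewrite !expgS IH jM].
apply/negP => /andP[s1 s2].
have Am m : A (act (j x ^+ m)%g p) by rewrite jX; apply: (act_E S' _ (base_E S')).
have [t' ht' e] := trace_refl ht (Am i) (Am i.+1) s1.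
have := hx _ _ _ ik ht'; rewrite -!jX !e //.
by rewrite s1 s2.
Qed.

End Trace.

(** * Mirrors parallel to a fixed vector *)

Section Newton.
Variables (R : realType) (n : nat) (E : set 'rV[R]_n) (W : groupType).
Variables (act : W -> 'rV[R]_n -> 'rV[R]_n) (ws : W -> 'S_n).
Variables (Wa : set W) (C : set 'rV[R]_n) (p : 'rV[R]_n).
Hypothesis S : cox_system E act ws Wa C p.
Local Notation V := 'rV[R]_n.
Implicit Types (x y z a v q : V) (t w u : W) (c : R).
Local Notation rfl := (rfl E act Wa).
Local Notation refl := (refl E act Wa).
Local Notation reg := (reg E act Wa).
Local Notation side := (side act).
Local Notation sep := (sep act).
Local Notation aut := (aut E act Wa).
Variable nu : V.
Hypothesis dnu : dir E nu.

Let aE : affine_set E := cs_affine S.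
Let Ep : E p := base_E S.

Definition fixes (s : 'S_n) := col_perm s nu = nu.
Definition nu_refl t := exists a c, rfl t a c /\ dot a nu = 0.
Definition same x y := forall t, nu_refl t -> side t x y.
Definition nu_perp z := forall t a c, rfl t a c -> dot a nu = 0 -> dot a z = 0.
Definition eqm v v' := forall z, nu_perp z -> dot v z = dot v' z.
(* eqm is equality modulo the span of the normals orthogonal to nu, tested
   against the vectors nu_perp; transm w v says that w translates by v modulo
   that span. *)
Definition transm w v := forall x, E x -> eqm (act w x - x) v.

Lemma nu_refl_refl t : nu_refl t -> refl t.
Proof. by move=> [a [c [h _]]]; exists a, c. Qed.

Lemma eqm_sym v v' : eqm v v' -> eqm v' v.
Proof. by move=> h z hz; rewrite h. Qed.

Lemma eqm_trans v v' v'' : eqm v v' -> eqm v' v'' -> eqm v v''.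
Proof. by move=> h h' z hz; rewrite h ?h'. Qed.

Lemma eqmD v1 v2 v1' v2' : eqm v1 v1' -> eqm v2 v2' -> eqm (v1 + v2) (v1' + v2').
Proof. by move=> h h' z hz; rewrite !dotDl h ?h'. Qed.

Lemma eqmN v v' : eqm v v' -> eqm (- v) (- v').
Proof. by move=> h z hz; rewrite !dotNl h. Qed.

(** [ws] chooses a permutation for each element and need not be a morphism; it is multiplicative on
    directions, where the linear part is determined. *)
Lemma ws_mul w u v : dir E v ->
  col_perm (ws (w * u)) v = col_perm (ws w) (col_perm (ws u) v).
Proof.
move=> dv; apply: (addrI (act (w * u)%g p)); rewrite -(actD S) // !(cs_actM S) //.
  rewrite (actD S) // (actD S) //; first exact: (act_E S).
  exact: (aut_dir S (aut_act S u)).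
exact: dv.
Qed.

Lemma fixesM w u : fixes (ws w) -> fixes (ws u) -> fixes (ws (w * u)%g).
Proof. by move=> h h'; rewrite /fixes ws_mul // h' h. Qed.

Lemma ws_inv w v : dir E v -> col_perm (ws w^-1) v = col_perm (ws w)^-1 v.
Proof.
move=> dv; have dv' := aut_dirV (aut_act S w) dv.
rewrite -{1}(col_permKV (ws w) v) -ws_mul // mulVg.
apply: (addrI (act 1%g p)); rewrite -(actD S) // !(cs_act1 S) //.
exact: dv'.
Qed.

Lemma fixesV w : fixes (ws w) -> fixes (ws w^-1%g).
Proof. by move=> h; rewrite /fixes ws_inv // -{1}h col_permK. Qed.

Lemma aut_dot_nu f s psi a : aut f s psi -> fixes s -> dot (col_perm s a) nu = dot a nu.
Proof. by move=> _ h; rewrite -{1}h dot_perm. Qed.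

Lemma aut_nu_refl f s psi t : aut f s psi -> fixes s -> nu_refl t -> nu_refl (psi t).
Proof.
move=> h hs [a [c [ht anu]]]; do 2!eexists; split; first exact: (aut_rfl S h ht).
by rewrite (aut_dot_nu _ h).
Qed.

Lemma aut_nu_reflV f s psi t : aut f s psi -> fixes s -> nu_refl t ->
  exists2 t', nu_refl t' & psi t' = t.
Proof.
move=> h hs [a [c [ht anu]]]; have [t' Wt' e] := aut_onto h (rfl_Wa ht); exists t' => //.
rewrite -e in ht; have [c' h'] := aut_rflV S h Wt' ht; do 2!eexists; split; first exact: h'.
by rewrite -(aut_dot_nu _ h) // col_permKV.
Qed.

Lemma aut_same f s psi x y : aut f s psi -> fixes s -> E x -> E y ->
  same x y -> same (f x) (f y).
Proof.
move=> h hs Ex Ey hxy t ht; have [t' ht' <-] := aut_nu_reflV h hs ht.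
by rewrite (aut_side S h) //; apply: hxy.
Qed.

Lemma act_same w x y : fixes (ws w) -> E x -> E y -> same x y -> same (act w x) (act w y).
Proof. exact: (aut_same (aut_act S w)). Qed.

Lemma same_sym x y : same x y -> same y x.
Proof. by move=> h t ht; rewrite side_sym; apply: h. Qed.

Lemma same_trans x y z : E x -> E y -> E z -> same x y -> same y z -> same x z.
Proof.
by move=> Ex Ey Ez h h' t ht; apply: (side_trans (nu_refl_refl ht) Ex Ey Ez); [apply: h|apply: h'].
Qed.

Lemma same_refl x : E x -> reg x -> same x x.
Proof.
move=> Ex rx t ht; have rt := nu_refl_refl ht; apply: (reg_side rt) => //.
by have [a [c h]] := rt; rewrite (sepE h) // -leNgt -expr2 sqr_ge0.
Qed.

Lemma same_act w q x : fixes (ws w) -> E q -> E x -> same q x -> same x (act w x) ->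
  same q (act w q).
Proof.
move=> hw Eq Ex h h'; have Ewx := act_E S w Ex; have Ewq := act_E S w Eq.
apply: (same_trans Eq Ex Ewq h); apply: (same_trans Ex Ewx Ewq h').
by apply: act_same => //; apply: same_sym.
Qed.

Lemma aut_perp f s psi z : aut f s psi -> fixes s -> nu_perp z -> nu_perp (col_perm s^-1 z).
Proof.
move=> h hs hz t a c ht anu; rewrite dotC dot_permV invgK dotC.
by apply: (hz _ _ _ (aut_rfl S h ht)); rewrite (aut_dot_nu _ h).
Qed.

Lemma aut_eqm f s psi v v' : aut f s psi -> fixes s -> eqm v v' ->
  eqm (col_perm s v) (col_perm s v').
Proof. by move=> h hs e z hz; rewrite !dot_permV; apply/e/(aut_perp h). Qed.

Lemma transmM w u v v' : transm w v -> transm u v' -> transm (w * u)%g (v + v').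
Proof.
move=> h h' x Ex; rewrite (cs_actM S) // -(subrK (act u x) (act w _)) -addrA.
by apply: eqmD; [apply/h/(act_E S)|apply: h'].
Qed.

Lemma transmV w v : transm w v -> transm w^-1%g (- v).
Proof.
move=> h x Ex; rewrite -{2}(actKV S w Ex) -opprB; apply/eqmN/h; exact: (act_E S).
Qed.

Lemma transm_eqm w v v' : transm w v -> eqm v v' -> transm w v'.
Proof. by move=> h h' x Ex; apply: (eqm_trans (h x Ex)). Qed.

Lemma aut_transm f s psi w v : aut f s psi -> fixes s -> transm w v ->
  transm (psi w) (col_perm s v).
Proof.
move=> h hs hw y /(aut_surj h) [x Ex <-]; rewrite -(aut_equiv h) // (aut_B h) //.
  by apply: (aut_eqm h hs); apply: hw.
exact: (act_E S).
Qed.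

Lemma nu_refl_fixes t : nu_refl t -> fixes (ws t).
Proof.
move=> [a [c [h anu]]]; apply: (addrI (act t p)); rewrite -(actD S) //.
have [_ _ _ ht] := h; rewrite !ht //; last exact: dnu.
by rewrite dotDr anu addr0 addrAC.
Qed.

Lemma nu_refl_transm t : nu_refl t -> transm t 0.
Proof.
move=> [a [c [h anu]]] x Ex z hz; have [_ _ _ ht] := h.
by rewrite ht // addrAC subrr add0r dotNl dotZl (hz _ _ _ h) // mulr0 oppr0 dot0l.
Qed.

Lemma nu_group (s : seq W) : (forall t, t \in s -> nu_refl t) ->
  let u := (\prod_(r <- s) r)%g in [/\ Wa u, fixes (ws u) & transm u 0].
Proof.
elim: s => [|t s IH] hs /=.
  rewrite big_nil; split; first exact: (Wa1 S).
    by apply: (addrI (act 1%g p)); rewrite -(actD S) // !(cs_act1 S) //; apply: dnu.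
  by move=> x Ex; rewrite (cs_act1 S) // subrr.
rewrite big_cons; have [|W1 f1 t1] := IH; first by move=> u hu; apply: hs; rewrite inE hu orbT.
have ht : nu_refl t by apply: hs; rewrite mem_head.
split; first by apply: (WaM S) => //; apply: refl_Wa (nu_refl_refl ht).
  by apply: fixesM => //; apply: nu_refl_fixes.
by rewrite -(addr0 0); apply: transmM => //; apply: nu_refl_transm.
Qed.

(** Folding along the mirrors parallel to [nu] alone: these reflections fix [nu], and their
    displacements vanish modulo [eqm]. *)
Lemma nu_move q q0 : E q -> reg q -> E q0 -> reg q0 ->
  exists u, [/\ Wa u, fixes (ws u), transm u 0 & same q0 (act u q)].
Proof.
move=> Eq rq Eq0 rq0.
have [||s [hs1 hs2]] := @chamber_move _ _ _ _ _ _ _ _ _ S nu_refl q q0 _ _ Eq Eq0.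
- exact: nu_refl_refl.
- move=> t t' ht ht'; rewrite -{2}(refl_inv S (nu_refl_refl ht)).
  exact: (aut_nu_refl (aut_act S t) (nu_refl_fixes ht)).
have [Wu fu tu] := nu_group hs1; exists (\prod_(r <- s) r)%g; split=> // t ht.
apply: (reg_side (nu_refl_refl ht)) => //; first exact: (act_E S).
  exact: (reg_act S).
by rewrite sep_sym; apply: hs2.
Qed.

Lemma iter_E (y : W) x m : E x -> E (iter m (act y) x).
Proof. by move=> Ex; elim: m => //= m; apply: (act_E S). Qed.

Lemma iter_same (y : W) q k : fixes (ws y) -> E q -> same q q -> same q (act y q) ->
  same q (iter k (act y) q).
Proof.
move=> fy Eq qq hq; elim: k => //= k IH.
have Ei := iter_E y k Eq.
apply: (same_trans Eq (act_E S y Eq)) => //; first exact: (act_E S).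
exact: act_same.
Qed.

(** All iterates keep [q] in its region, and [n!] of them add [v]. If [v] pointed towards the
    mirror, a large multiple of it would cross. *)
Lemma nu_drift (y : W) q t a c : fixes (ws y) -> E q -> same q q -> same q (act y q) ->
  rfl t a c -> dot a nu = 0 ->
  0 <= (dot a q - c) * dot a (iter n`! (act y) q - q).
Proof.
move=> fy Eq qq hq ht anu; rewrite leNgt; apply/negP => neg.
set v := iter n`! (act y) q - q in neg.
have itE k : iter (n`! * k) (act y) q = q + k%:R *: v.
  elim: k => [|k IH]; first by rewrite muln0 scale0r addr0.
  have Ei := iter_E y (n`! * k) Eq.
  rewrite mulnS iterD (paff_translation (cs_paff S y) Eq) // IH -/v -addrA.
  by rewrite -natr1 scalerDl scale1r.
set K := dot a q - c in neg; pose k := (Num.bound (K ^+ 2 / - (K * dot a v))).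
have hk : K ^+ 2 + k%:R * (K * dot a v) < 0.
  have h0 : 0 < - (K * dot a v) by rewrite oppr_gt0.
  have : K ^+ 2 / - (K * dot a v) < k%:R by apply: archi_boundP; rewrite divr_ge0 ?sqr_ge0 ?(ltW h0).
  by rewrite ltr_pdivrMr // mulrN; lra.
have := iter_same (n`! * k) fy Eq qq hq; rewrite itE => hs.
have dv : dir E v.
  by apply: dirB => //; apply: iter_E.
have := hs t; have -> : side t q (q + k%:R *: v) = (0 < K ^+ 2 + k%:R * (K * dot a v)).
  rewrite (sideE ht) //; last by apply: (dirZ _ aE dv).
  by congr (0 < _); rewrite /K !dotE; ring.
rewrite ltNge (ltW hk) => hh.
by suff : ~~ true by []; apply: hh; exists a, c.
Qed.

(** The drifts of [y] and of its inverse make [v] orthogonal to the normals orthogonal to [nu], so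
    [v] can be tested against itself, and the trivial translation part gives [v = 0]. Then [y] fixes
    a point and the line through it along [nu]; mirrors containing that line are parallel to [nu],
    and [rigid] applies. *)
Lemma nu_rigid (y : W) q : Wa y -> fixes (ws y) -> E q -> reg q -> same q (act y q) ->
  transm y 0 -> y = 1%g.
Proof.
move=> Wy fy Eq rq hq ty; have qq := same_refl Eq rq.
set f := act y; pose v := iter n`! f q - q.
have tr := paff_translation (cs_paff S y) Eq.
have Ei m x : E x -> E (iter m f x) by apply: iter_E.
have dv : dir E v by apply: dirB => //; apply: Ei.
have itK m x : E x -> iter m (act y^-1%g) (iter m f x) = x.
  move=> Ex; elim: m => // m IH; rewrite iterSr iterS /f (actK S) //; exact: Ei.
have v0 : v = 0.
  have perp : nu_perp v.
    move=> t a c ht anu; have kq : dot a q - c != 0.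
      by rewrite subr_eq0; apply/eqP => /(rfl_fix ht Eq); apply: rq; exists a, c.
    have h1 := nu_drift fy Eq qq hq ht anu.
    have hqV : same q (act y^-1%g q).
      apply: same_sym; rewrite -{2}(actK S y Eq).
      by apply: act_same => //; [exact: fixesV|exact: (act_E S)].
    have h2 := nu_drift (fixesV fy) Eq qq hqV ht anu.
    have e : iter n`! (act y^-1%g) q = q - v.
      have Eqv : E (q - v) by apply: (dirN aE dv).
      rewrite -[RHS](itK n`!) // tr //.
      by rewrite -/f -/v subrK.
    move: h1 h2; rewrite e addrAC subrr add0r dotNr -/v mulrN oppr_ge0 => h1 h2.
    have /eqP : (dot a q - c) * dot a v = 0 by apply/eqP; rewrite eq_le h1 h2.
    by rewrite mulf_eq0 (negPf kq) => /eqP.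
  apply/eqP; rewrite -dot_eq0; apply/eqP.
  have itm m x : E x -> eqm (iter m f x - x) 0.
    move=> Ex; elim: m => [|m IH]; first by rewrite subrr.
    rewrite iterS -(subrK (iter m f x) (f _)) -addrA -(addr0 0).
    by apply: eqmD => //; apply/ty/Ei.
  by rewrite (itm n`! q Eq v perp) dot0l.
have fN : iter n`! f q = q by apply/eqP; rewrite -subr_eq0 -/v v0.
have [Ee fe] := orbit_avg S (cs_paff S y) Eq fN.
set e := (X in E X) in Ee fe.
apply: (rigid S (A := [set x | exists k, x = e + k *: nu]) (q := q)) => //.
- by exists e; exists 0; rewrite scale0r addr0.
- by move=> x [k ->]; apply: (dirZ _ aE dnu).
- by move=> x [k ->]; rewrite (actD S) //; [rewrite fe linearZ /= fy|apply: dirZ].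
move=> t [a [c ht]] hfix; apply: hq; exists a, c; split=> //.
have E1 : E (e + 1 *: nu) by apply: (dirZ _ aE dnu).
have /(rfl_fix ht Ee) h0 : act t e = e by apply: hfix; exists 0; rewrite scale0r addr0.
have /(rfl_fix ht E1) : act t (e + 1 *: nu) = e + 1 *: nu by apply: hfix; exists 1.
by rewrite dotDr h0 scale1r => /(canRL (addKr _)); rewrite addNr.
Qed.

End Newton.

Lemma seq_min (R : realType) (l : seq R) (P : R -> Prop) : (exists2 x, x \in l & P x) ->
  exists x, [/\ x \in l, P x & forall y, y \in l -> P y -> x <= y].
Proof.
elim: l => [[x] //|x l IH [y]]; rewrite inE => hy Py.
have [[z [zl Pz hz]]|no] := pselect (exists z, [/\ z \in l, P z & forall y, y \in l -> P y -> z <= y]).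
  have [Px|nPx] := pselect (P x); last first.
    exists z; split=> //; first by rewrite inE zl orbT.
    by move=> u; rewrite inE => /orP[/eqP-> //|]; apply: hz.
  have [xz|zx] := leP x z.
    exists x; split=> //; first exact: mem_head.
    by move=> u; rewrite inE => /orP[/eqP-> //|ul Pu]; apply: (le_trans xz); apply: hz.
  exists z; split=> //; first by rewrite inE zl orbT.
  by move=> u; rewrite inE => /orP[/eqP-> _|ul Pu]; [exact: ltW|exact: hz].
have hn u : u \in l -> ~ P u by move=> ul Pu; apply/no/IH; exists u.
move: hy => /orP[/eqP e|/hn //]; exists x; rewrite mem_head -e; split=> // u.
by rewrite inE => /orP[/eqP-> //|/hn].
Qed.

(** * Roots and their lattice *)

Section Roots.
Variables (R : realType) (n : nat) (E : set 'rV[R]_n) (W : groupType).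
Variables (act : W -> 'rV[R]_n -> 'rV[R]_n) (ws : W -> 'S_n).
Variables (Wa : set W) (C : set 'rV[R]_n) (p : 'rV[R]_n).
Hypothesis S : cox_system E act ws Wa C p.
Local Notation V := 'rV[R]_n.
Implicit Types (x y z a b g v q : V) (t w u : W) (c : R).
Local Notation rfl := (rfl E act Wa).
Local Notation refl := (refl E act Wa).
Local Notation aut := (aut E act Wa).

Let aE : affine_set E := cs_affine S.
Let Ep : E p := base_E S.

Definition hyp a c := exists t, rfl t a c.

(* Coroots: the mirrors orthogonal to b are equally spaced, and the product of
   the reflections in two consecutive ones is the translation by b. *)
Definition root b := b != 0 /\
  exists c0, forall c, hyp b c <-> exists k : int, c = c0 + k%:~R * (dot b b / 2).

Lemma hyp_dir a c : hyp a c -> dir E a.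
Proof. by move=> [t h]; apply: rfl_dir h. Qed.

Lemma hyp_neq0 a c : hyp a c -> a != 0.
Proof. by move=> [t h]; apply: rfl_neq0 h. Qed.

Lemma hypZ k a c : k != 0 -> hyp a c -> hyp (k *: a) (k * c).
Proof. by move=> k0 [t h]; exists t; apply: (rfl_scale S h). Qed.

Lemma hypZV k a c : k != 0 -> hyp (k *: a) c -> hyp a (k^-1 * c).
Proof.
move=> k0 h; have := hypZ (invr_neq0 k0) h.
by rewrite scalerA mulVf // scale1r.
Qed.

Lemma root_hyp b : root b -> exists c, hyp b c.
Proof. by move=> [_ [c h]]; exists c; apply/h; exists 0; rewrite mul0r addr0. Qed.

Lemma root_dir b : root b -> dir E b.
Proof. by move=> /root_hyp [c /hyp_dir]. Qed.

Lemma root_shift b c (k : int) : root b -> hyp b c -> hyp b (c + k%:~R * (dot b b / 2)).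
Proof.
move=> [_ [c0 h]] /h [m ->]; apply/h; exists (m + k).
by rewrite intrD mulrDl addrA.
Qed.

Lemma root_diff b c c' : root b -> hyp b c -> hyp b c' ->
  exists k : int, c' = c + k%:~R * (dot b b / 2).
Proof.
move=> [_ [c0 h]] /h [m ->] /h [m' ->]; exists (m' - m).
by rewrite intrB; ring.
Qed.

Lemma rfl_const t a c c' : rfl t a c -> rfl t a c' -> c = c'.
Proof.
move=> h h'; have [Ey hy] := rfl_proj S h Ep.
set y := p - _ in Ey hy.
by rewrite -hy; apply/(rfl_fix h' Ey)/(rfl_fix h Ey).
Qed.

Lemma aut_hyp f s psi a c : aut f s psi ->
  hyp (col_perm s a) (c - dot a p + dot (col_perm s a) (f p)) <-> hyp a c.
Proof.
move=> h; split=> [[t ht]|[t ht]]; last by exists (psi t); apply: (aut_rfl S h ht).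
have [t' Wt' e] := aut_onto h (rfl_Wa ht); subst t.
have [c' ht'] := aut_rflV S h Wt' ht; rewrite col_permK in ht'.
have := rfl_const ht (aut_rfl S h ht') => /addIr /addIr ->.
by exists t'.
Qed.

Lemma aut_root f s psi b : aut f s psi -> root b -> root (col_perm s b).
Proof.
move=> h [b0 [c0 hc]]; split.
  by apply: contra_neq b0 => e; rewrite -(col_permK s b) e linear0.
exists (c0 - dot b p + dot (col_perm s b) (f p)) => c.
rewrite dot_perm; set d := dot (col_perm s b) (f p).
have {1}-> : c = (c - d + dot b p) - dot b p + d by ring.
rewrite (aut_hyp _ _ h) hc; split=> -[k e]; exists k.
  by rewrite -(addrA c0) addrAC -(subrK d c) (_ : c - d = c0 + k%:~R * (dot b b / 2) - dot b p); [ring|rewrite -e; ring].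
by rewrite e; ring.
Qed.

Lemma hyp_perm t b c g : rfl t b c -> dir E g ->
  col_perm (ws t) g = g - (2 * dot b g / dot b b) *: b.
Proof.
move=> h dg; apply: (addrI (act t p)); rewrite -(actD S) //.
have [_ b0 _ ht] := h; rewrite !ht //; last exact: dg.
have p0 : dot b b != 0 by rewrite dot_eq0.
by apply/rowP => i; rewrite !mxE dotDr; field.
Qed.

Lemma root_translation b : root b -> exists2 w, Wa w & forall x, E x -> act w x = x + b.
Proof.
move=> rb; have [c [t ht]] := root_hyp rb.
have [u hu] := root_shift 1 rb (ex_intro _ t ht).
exists (u * t)%g; first by apply: (WaM S); [apply: rfl_Wa hu|apply: rfl_Wa ht].
move=> x Ex; have Etx := act_E S t Ex; rewrite (cs_actM S) //.
have [_ b0 _ hu'] := hu; have [_ _ _ ht'] := ht.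
have p0 : dot b b != 0 by rewrite dot_eq0.
rewrite hu' // ht' //; apply/rowP => i; rewrite !mxE !dotE; by field.
Qed.

Lemma translation_perm w v g : (forall x, E x -> act w x = x + v) -> dir E g ->
  col_perm (ws w) g = g.
Proof.
move=> hw dg; apply: (addrI (act w p)); rewrite -(actD S) // !hw //; last exact: dg.
by rewrite addrAC.
Qed.

Lemma translation_hyp w v a c : (forall x, E x -> act w x = x + v) -> hyp a c ->
  hyp a (c + dot a v).
Proof.
move=> hw h; have da := hyp_dir h; have e := translation_perm hw da.
have /(aut_hyp a c (aut_act S w)) := h; rewrite e hw // dotDr.
by congr hyp; ring.
Qed.

(** The translation by [b] permutes the mirrors orthogonal to [g], whose spacing is
    [dot g g / 2]. *)
Lemma root_int b g : root b -> root g -> exists k : int, 2 * dot g b = k%:~R * dot g g.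
Proof.
move=> rb rg; have [w Ww hw] := root_translation rb; have [c hc] := root_hyp rg.
have [k e] := root_diff rg hc (translation_hyp hw hc); exists k.
by move: e => /addrI ->; field.
Qed.

Lemma root_refl b g : root b -> root g -> root (g - (2 * dot b g / dot b b) *: b).
Proof.
move=> rb rg; have [c [t ht]] := root_hyp rb.
rewrite -(hyp_perm ht (root_dir rg)); exact: aut_root (aut_act S t) rg.
Qed.

Lemma rootN b : root b -> root (- b).
Proof.
move=> rb; have := root_refl rb rb; have b0 : dot b b != 0 by rewrite dot_eq0; case: rb.
rewrite mulfK // (_ : b - 2 *: b = - b) //.
by rewrite -{1}(scale1r b) -scalerBl (_ : 1 - 2 = -1) ?scaleN1r //; ring.
Qed.

(** [b] and [k *: b] have the same mirrors; comparing the two spacings shows that [k] and its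
    inverse are integers. *)
Lemma root_reduced k b : root b -> root (k *: b) -> k = 1 \/ k = -1.
Proof.
move=> rb rkb; have b0 : dot b b != 0 by rewrite dot_eq0; case: rb.
have k0 : k != 0.
  by case: rkb => [+ _]; apply: contra_neq => ->; rewrite scale0r.
have [c hc] := root_hyp rb; have hkc := hypZ k0 hc.
have [m em] : exists m : int, 1 = m%:~R * k.
  have [m e] := root_diff rkb hkc (hypZ k0 (root_shift 1 rb hc)); exists m.
  move: e; rewrite !dotE mulrDr => /addrI e.
  apply: (mulfI b0); apply: (mulfI k0); move: e; rewrite mul1r => e.
  have -> : k * (dot b b * 1) = 2 * (k * (dot b b / 2)) by field.
  by rewrite e; field.
have [m' em'] : exists m' : int, k = m'%:~R.
  have := hypZV k0 (root_shift 1 rkb hkc); rewrite mulrDr mulKf // => h.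
  have [m' e] := root_diff rb hc h; exists m'; move: e => /addrI; rewrite !dotE mul1r => e.
  apply: (mulIf b0); apply: (mulIf (invr_neq0 (_ : 2 != 0 :> R))); first by rewrite pnatr_eq0.
  by rewrite -(mulrA _ _ 2^-1) -(mulrA _ _ 2^-1) -e; field.
move: em; rewrite em' -intrM -[1]/(1%:~R) => /intr_inj e.
have : (`|m| * `|m'|)%N == 1%N by rewrite -abszM -e.
rewrite muln_eq1 => /andP[_ /eqP].
by case: (m') => [[|[|?]]|[|?]] // _; [left|right].
Qed.

(* If two distinct mirrors are parallel, reflecting them in each other makes
   their whole family equally spaced. *)
Lemma parallel_root a c c' : hyp a c -> hyp a c' -> c != c' ->
  exists2 k, k != 0 & root (k *: a).
Proof.
wlog lt : c c' / c < c' => [th hc hc' ne|].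
  by have [h|h|h] := ltgtP c c'; [apply: (th c c')|apply: (th c' c); rewrite // eq_sym|rewrite h eqxx in ne].
move=> hc hc' _; have da := hyp_dir hc; have a0 := hyp_neq0 hc; have p0 := dot_gt0 a0.
have n0 : dot a a != 0 by rewrite gt_eqF.
have refl c1 c2 : hyp a c1 -> hyp a c2 -> hyp a (2 * c1 - c2).
  move=> [t1 h1] h2.
  have ea : col_perm (ws t1) a = - a.
    rewrite (hyp_perm h1 da) mulfK // -{1}(scale1r a) -scalerBl (_ : 1 - 2 = -1) ?scaleN1r //; ring.
  have /(aut_hyp a c2 (aut_act S t1)) := h2; rewrite ea => h3.
  have m1 : (-1 : R) != 0 by rewrite oppr_eq0 oner_eq0.
  have := hypZ m1 h3; rewrite scaleN1r opprK; congr hyp.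
  by have := rfl_val h1 Ep; rewrite dotNl => e; lra.
have add2 c1 c2 c3 : hyp a c1 -> hyp a c2 -> hyp a c3 -> hyp a (c3 + 2 * (c2 - c1)).
  by move=> h1 h2 h3; have := refl _ _ h2 (refl _ _ h1 h3); congr hyp; ring.
pose q k := p + ((k - dot a p) / dot a a) *: a.
have Eq k : E (q k) by apply: (dirZ _ aE da).
have dq k : dot a (q k) = k by rewrite /q !dotE; field.
have [l hl] := sep_finite S (Eq c) (Eq (c' + 1)).
pose val t := xget 0 [set k | rfl t a k].
have valE t k : rfl t a k -> val t = k.
  by move=> h; rewrite /val; case: xgetP => [k' _ h'|/(_ k)] //; apply: rfl_const h' h.
have inl k : hyp a k -> c < k -> k <= c' -> k \in [seq val t | t <- l].
  move=> [t ht] k1 k2; rewrite -(valE _ _ ht); apply/map_f/hl; first by exists a, k.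
  rewrite (sepE ht) // !dq; nra.
(* [c1] is the next constant after [c]: finitely many mirrors separate the points at levels [c] and
   [c' + 1], so a minimum exists. *)
have [|c1 [_ [h1 lt1] min1]] := @seq_min R [seq val t | t <- l] (fun k => hyp a k /\ c < k).
  by exists c'; first exact: inl.
have {}min1 k : hyp a k -> c < k -> c1 <= k.
  move=> hk lk; have [k'|k'] := leP k c'; first by apply: min1 => //; apply: inl.
  by apply: le_trans (ltW k'); apply: min1 => //; apply: inl.
pose d := c1 - c; have d0 : 0 < d by rewrite subr_gt0.
have dn0 : d != 0 by rewrite gt_eqF.
have up (m : int) k : hyp a k -> hyp a (k + m%:~R * (2 * d)).
  have pos (j : nat) k0 : hyp a k0 -> hyp a (k0 + j%:R * (2 * d)).
    elim: j k0 => [|j IH] k0 h0; first by rewrite mul0r addr0.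
    by have := IH _ (add2 _ _ _ hc h1 h0); congr hyp; rewrite -natr1 /d; ring.
  have neg (j : nat) k0 : hyp a k0 -> hyp a (k0 - j%:R * (2 * d)).
    elim: j k0 => [|j IH] k0 h0; first by rewrite mul0r subr0.
    by have := IH _ (add2 _ _ _ h1 hc h0); congr hyp; rewrite -natr1 /d; ring.
  case: m => j h0; first exact: pos.
  by have := neg j.+1 _ h0; congr hyp; rewrite NegzE mulrNz mulNr.
have spaced k : hyp a k <-> exists m : int, k = c + m%:~R * d.
  split=> [hk|[m ->]].
    (* Shifted into the interval from [c] to [c + 2 * d], the constant is [c] or [c1]: beyond [c1],
       its reflection in [c1] would fall strictly between [c] and [c1]. *)
    pose j := Num.floor ((k - c) / (2 * d)); pose k1 := k + (- j)%:~R * (2 * d).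
    have hk1 : hyp a k1 by apply: up.
    have d2 : 0 < 2 * d by rewrite mulr_gt0.
    have [lb ub] : c <= k1 /\ k1 < c + 2 * d.
      have := floor_itv ((k - c) / (2 * d)); rewrite -/j => /andP[].
      rewrite ler_pdivlMr // ltr_pdivrMr // intrD mulrDl mul1r => l1 l2.
      by rewrite /k1 mulrNz mulNr; split; lra.
    have [e|ne] := eqVneq k1 c.
      by exists (2 * j); rewrite intrM -e /k1 mulrNz; ring.
    have cl : c < k1 by rewrite lt_def ne.
    have l1 := min1 _ hk1 cl.
    have [e|ne1] := eqVneq k1 c1.
      by exists (2 * j + 1); rewrite intrD intrM; move: e; rewrite /k1 mulrNz /d => e; lra.
    have l2 : c1 < k1 by rewrite lt_def ne1.
    have := min1 _ (refl _ _ h1 hk1); rewrite leNgt => /(_ _)/negP; case; rewrite /d in ub; lra.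
  have : exists j : int, m = 2 * j \/ m = 2 * j + 1.
    exists (m %/ 2)%Z; rewrite {1 3}(divz_eq m 2) mulrC.
    have := modz_ge0 m (isT : (2 != 0 :> int)); have := ltz_pmod m (isT : (0 < 2 :> int)).
    by case: (m %% 2)%Z => [[|[|]]|] // _ _; [left; rewrite addr0|right].
  move=> [j [->|->]]; rewrite ?intrD intrM; first by have := up j c hc; congr hyp; ring.
  by have := up j c1 h1; congr hyp; rewrite /d; ring.
(* The scaling for which the spacing of the mirrors becomes half the square norm of the normal. *)
have k0 : 2 * d / dot a a != 0 by rewrite !mulf_neq0 ?invr_neq0 ?pnatr_eq0.
exists (2 * d / dot a a) => //; split; first by rewrite scaler_eq0 negb_or k0.
exists (2 * d / dot a a * c) => k.
have -> : hyp (2 * d / dot a a *: a) k <-> hyp a ((2 * d / dot a a)^-1 * k).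
  split; first exact: hypZV.
  by move=> /(hypZ k0); rewrite mulVKf.
rewrite spaced; split=> -[m e]; exists m.
  by rewrite -[k](mulVKf k0) e !dotE; field.
by rewrite e !dotE; field; rewrite n0 dn0.
Qed.

Lemma single_dot t a c b : rfl t a c -> (forall k, k != 0 -> ~ root (k *: a)) -> root b ->
  dot a b = 0.
Proof.
move=> ht no rb; have [w Ww hw] := root_translation rb.
have h : hyp a c by exists t.
apply: contrapT => ab; have [|k k0 rk] := parallel_root h (translation_hyp hw h).
  by apply/eqP => e; apply: ab; apply: (addrI c); rewrite addr0 -e.
exact: no rk.
Qed.

(** The linear part of the reflection in a root is one of finitely many permutations; it determines
    the line of the root, which contains only two roots. *)
Lemma root_finite : exists l : seq V, forall b, b \in l <-> root b.
Proof.
pose pick (s : 'S_n) := xget 0 [set b | root b /\ exists t c, rfl t b c /\ ws t = s].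
pose l := [seq b <- flatten [seq [:: pick s; - pick s] | s <- enum 'S_n] | `[< root b >]].
exists l => b; rewrite mem_filter; split=> [/andP[/asboolP]|rb] //.
apply/andP; split; first exact/asboolP.
have [c [t ht]] := root_hyp rb.
have : root (pick (ws t)) /\ exists t' c', rfl t' (pick (ws t)) c' /\ ws t' = ws t.
  rewrite /pick; case: xgetP => [b' _ [] //|/(_ b) []].
  by split=> //; exists t, c.
move: (erefl (pick (ws t))); set g := {1}(pick _) => eg; rewrite -eg => -[rg [t' [c' [ht' e]]]].
apply/flattenP; exists [:: g; - g]; last first.
  have db := root_dir rb; have dg := root_dir rg.
  have e1 := hyp_perm ht db; have e2 := hyp_perm ht' db.
  rewrite e e1 in e2.
  have b0 : dot b b != 0 by rewrite dot_eq0; case: rb.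
  have g0 : dot g g != 0 by rewrite dot_eq0; case: rg.
  have eb : b = (dot g b / dot g g) *: g.
    move: e2 => /addrI /oppr_inj; rewrite mulfK // => e2.
    apply: (scalerI (_ : 2 != 0 :> R)); first by rewrite pnatr_eq0.
    by rewrite e2 scalerA mulrA.
  move: rb; rewrite eb => /(root_reduced rg) [] ->.
    by rewrite scale1r mem_head.
  by rewrite scaleN1r !inE eqxx orbT.
by rewrite eg; apply/mapP; exists (ws t) => //; rewrite mem_enum.
Qed.

End Roots.

(** * Simple roots for an ordering adapted to [nu] *)

Section Base.
Variables (R : realType) (n : nat) (E : set 'rV[R]_n) (W : groupType).
Variables (act : W -> 'rV[R]_n -> 'rV[R]_n) (ws : W -> 'S_n).
Variables (Wa : set W) (C : set 'rV[R]_n) (p : 'rV[R]_n).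
Hypothesis S : cox_system E act ws Wa C p.
Local Notation V := 'rV[R]_n.
Implicit Types (x y z a b g v q : V) (t w u : W) (c : R).
Local Notation rfl := (rfl E act Wa).
Local Notation aut := (aut E act Wa).
Local Notation root := (root E act Wa).
Variable nu : V.
Hypothesis dnu : dir E nu.

Let aE : affine_set E := cs_affine S.
Let Ep : E p := base_E S.

(** A base of simple roots for the ordering by [rho], a generic vector near [nu], so that [nu] is
    dominant. By [nb_d] and [nb_b] the dual family [d] spans the same space as [b]. *)
Record nu_base (k : nat) (b d : 'I_k -> V) (rho : V) : Prop := NuBase {
  nb_root : forall i, root (b i);
  nb_dual : forall i j, dot (b i) (d j) = (i == j)%:R;
  nb_d : exists D : 'I_k -> 'I_k -> R, forall j, d j = \sum_i D j i *: b i;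
  nb_b : exists G : 'I_k -> 'I_k -> R, forall j, b j = \sum_i G j i *: d i;
  nb_comb : forall g, root g -> exists m : 'I_k -> nat,
    g = \sum_j (m j)%:R *: b j \/ g = - \sum_j (m j)%:R *: b j;
  nb_pos : forall g, root g -> 0 < dot g nu -> exists m : 'I_k -> nat,
    g = \sum_j (m j)%:R *: b j;
  nb_nu : forall i, 0 <= dot (b i) nu;
  nb_dir : dir E rho;
  nb_gen : forall g, root g -> dot g rho != 0;
  nb_rho : forall g, root g -> 0 < dot g nu -> 0 < dot g rho
}.

Lemma generic_vector (l : seq V) : (forall b, b \in l -> b != 0 /\ dir E b) ->
  exists2 eta, dir E eta & forall b, b \in l -> dot b eta != 0.
Proof.
elim: l => [|b l IH] hl; first by exists 0 => //; exact: dir0.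
have [|eta deta heta] := IH; first by move=> g hg; apply: hl; rewrite inE hg orbT.
have [b0 db] := hl b (mem_head _ _).
have [h|h] := eqVneq (dot b eta) 0; last first.
  by exists eta => // g; rewrite inE => /orP[/eqP->|/heta].
have [e ep he] : exists2 e, 0 < e & forall g, g \in l -> dot g eta + e * dot g b != 0.
  by apply/near0_exists/near0_all => g hg; apply/near0_neq0/heta.
exists (eta + e *: b); first by apply: dirD => //; apply: (dirZ _ aE).
move=> g; rewrite dotDr dotZr inE => /orP[/eqP->|/he //].
by rewrite h add0r mulf_neq0 ?gt_eqF // dot_gt0.
Qed.

(** A small generic perturbation of [nu]: since there are finitely many roots, all positive values
    at [nu] stay positive. *)
Lemma generic_near_nu : exists rho, [/\ dir E rho, forall g, root g -> dot g rho != 0 &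
  forall g, root g -> 0 < dot g nu -> 0 < dot g rho].
Proof.
have [l hl] := root_finite S.
have [|eta deta heta] := @generic_vector l.
  by move=> b /hl rb; split; [case: rb|apply: root_dir rb].
have [e ep he] : exists2 e, 0 < e & forall g, g \in l ->
    0 < e /\ (dot g nu + e * dot g eta != 0 /\ (0 < dot g nu -> 0 < dot g nu + e * dot g eta)).
  apply/near0_exists/near0_all => g hg; apply: near0_and; first by exists 1 => // e /andP[].
  have [h|h] := eqVneq (dot g nu) 0.
    exists 1 => // e /andP[e0 _]; rewrite h ltxx add0r; split=> //.
    by apply: mulf_neq0; [rewrite gt_eqF|apply: heta].
  apply: near0_and; first exact: near0_neq0.
  have [h'|h'] := ltP 0 (dot g nu); last by exists 1.
  by have [e1 e1p h1] := near0_pos (dot g eta) h'; exists e1 => // e /h1.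
exists (nu + e *: eta); split; first by apply: dirD => //; apply: (dirZ _ aE).
  by move=> g /hl /he [_ []]; rewrite dotDr dotZr.
by move=> g /hl /he [_ []]; rewrite dotDr dotZr.
Qed.

Section Simple.
Variable rho : V.
Hypothesis rho_gen : forall g, root g -> dot g rho != 0.

Definition pos b := root b /\ 0 < dot b rho.
Definition simple b := pos b /\ ~ exists g h, [/\ pos g, pos h & b = g + h].

Lemma pos_or_neg b : root b -> pos b \/ pos (- b).
Proof.
move=> rb; have := rho_gen rb; rewrite neq_lt => /orP[h|h]; [right|left]; split=> //.
  exact: (rootN S rb).
by rewrite dotNl oppr_gt0.
Qed.

(** A positive product makes both Cartan integers at least 1. If one is 1, a reflection shows that
    [b - g] is a root; if both are at least 2, [b - g] has nonpositive norm. As a root, [b - g] or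
    its opposite is positive and decomposes [b] or [g]. *)
Lemma simple_obtuse b g : simple b -> simple g -> b != g -> dot b g <= 0.
Proof.
move=> [[rb pb] ib] [[rg pg] ig] bg; rewrite leNgt; apply/negP => d0.
have b0 : 0 < dot b b by apply: dot_gt0; case: rb.
have g0 : 0 < dot g g by apply: dot_gt0; case: rg.
have [k hk] := root_int S rb rg; have [m hm] := root_int S rg rb.
have k1 : 1 <= k by rewrite -gtz0_ge1 -(ltr0z R) -(pmulr_lgt0 _ g0) -hk mulr_gt0 // dotC.
have m1 : 1 <= m by rewrite -gtz0_ge1 -(ltr0z R) -(pmulr_lgt0 _ b0) -hm mulr_gt0.
have rbg : root (b - g).
  have [ek|nk] := eqVneq k 1.
    have := root_refl S rg rb; rewrite hk ek mulfK ?gt_eqF // scale1r; exact.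
  have [em|nm] := eqVneq m 1.
    have := root_refl S rb rg; rewrite hm em mulfK ?gt_eqF // scale1r => /(rootN S).
    by rewrite opprB.
  have k2 : 2%:~R <= k%:~R :> R by rewrite ler_int -[2]/(1 + 1) lez1D lt_def nk.
  have m2 : 2%:~R <= m%:~R :> R by rewrite ler_int -[2]/(1 + 1) lez1D lt_def nm.
  have : dot (b - g) (b - g) <= 0.
    rewrite !dotE (dotC g b); have := dotC g b; move: hk hm k2 m2.
    set K := k%:~R; set M := m%:~R => hk hm k2 m2 eC.
    have : 2 * dot g g <= K * dot g g by rewrite ler_pM2r.
    have : 2 * dot b b <= M * dot b b by rewrite ler_pM2r.
    by rewrite -hk -hm; lra.
  by rewrite leNgt dot_gt0 // subr_eq0.
have [pbg|pgb] := pos_or_neg rbg.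
  by apply: ib; exists (b - g), g; split=> //; rewrite subrK.
by apply: ig; exists (- (b - g)), b; split=> //; rewrite opprB subrK.
Qed.

Lemma simple_list : exists Bs : seq V, uniq Bs /\ forall b, b \in Bs <-> simple b.
Proof.
have [l hl] := root_finite S; exists [seq b <- undup l | `[< simple b >]].
split; first by rewrite filter_uniq // undup_uniq.
move=> b; rewrite mem_filter mem_undup; split=> [/andP[/asboolP]|sb] //.
by apply/andP; split; [apply/asboolP|apply/hl; case: sb => [[]]].
Qed.

Variable Bs : seq V.
Hypotheses (uBs : uniq Bs) (BsP : forall b, b \in Bs <-> simple b).
Local Notation k := (size Bs).
Local Notation b_ := (fun j : 'I_k => Bs`_j).

Lemma b_simple (j : 'I_k) : simple (b_ j).
Proof. by apply/BsP/mem_nth. Qed.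

Lemma pos_comb g : pos g -> exists m : 'I_k -> nat, g = \sum_j (m j)%:R *: b_ j.
Proof.
have [l hl] := root_finite S.
(* Counting the roots of smaller [rho]-value gives the measure for decomposing positive roots. *)
pose ht g := count (fun h => dot h rho < dot g rho) l.
have ht_lt g0 h : root g0 -> dot g0 rho < dot h rho -> (ht g0 < ht h)%N.
  move=> /hl gl lt; rewrite /ht.
  have -> : count (fun h1 => dot h1 rho < dot h rho) l =
      (count (fun h1 => dot h1 rho < dot g0 rho)%R l +
       count (fun h1 => ~~ (dot h1 rho < dot g0 rho) && (dot h1 rho < dot h rho))%R l)%N.
    rewrite -count_predUI (eq_count (a2 := fun h1 => dot h1 rho < dot h rho)).
      rewrite (eq_count (a1 := predI _ _) (a2 := pred0)) ?count_pred0 ?addn0 // => h1 /=.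
      by case: (_ < _).
    by move=> h1 /=; case: (boolP (dot h1 rho < dot g0 rho)) => //= h2; rewrite (lt_trans h2 lt).
  rewrite -[X in (X < _)%N]addn0 ltn_add2l -has_count; apply/hasP; exists g0 => //=.
  by rewrite ltxx lt.
suff main N g0 : (ht g0 <= N)%N -> pos g0 -> exists m : 'I_k -> nat, g0 = \sum_j (m j)%:R *: b_ j.
  exact: main (leqnn _).
elim: N g0 => [|N IH] {}g hN pg.
all: have [[g1 [g2 [p1 p2 e]]]|no] := pselect (exists g1 g2, [/\ pos g1, pos g2 & g = g1 + g2]).
- have : (ht g1 < ht g)%N.
    by apply: ht_lt; [case: p1|rewrite e dotDl ltrDl; case: p2].
  by move: hN; rewrite leqn0 => /eqP ->.
- have /BsP/(nthP 0)[i ik e] : simple g by [].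
  exists (fun j => (val j == i)%:R); rewrite (bigD1 (Ordinal ik)) //= eqxx scale1r e big1 ?addr0 //.
  by move=> j; rewrite -val_eqE /= => /negPf ->; rewrite scale0r.
- have l1 : (ht g1 < ht g)%N by apply: ht_lt; [case: p1|rewrite e dotDl ltrDl; case: p2].
  have l2 : (ht g2 < ht g)%N by apply: ht_lt; [case: p2|rewrite e dotDl ltrDr; case: p1].
  have [||m1 e1] := IH g1 => //; first by rewrite -ltnS (leq_trans l1).
  have [||m2 e2] := IH g2 => //; first by rewrite -ltnS (leq_trans l2).
  exists (fun j => (m1 j + m2 j)%N); rewrite e {1}e1 {1}e2 -big_split /=.
  by apply: eq_bigr => j _; rewrite natrD scalerDl.
- have /BsP/(nthP 0)[i ik e] : simple g by [].
  exists (fun j => (val j == i)%:R); rewrite (bigD1 (Ordinal ik)) //= eqxx scale1r e big1 ?addr0 //.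
  by move=> j; rewrite -val_eqE /= => /negPf ->; rewrite scale0r.
Qed.

(** Splitting the relation by sign writes one vector [v] over two disjoint sets of simple roots;
    obtuseness gives [dot v v <= 0], and pairing with [rho] then kills every coefficient. *)
Lemma simple_free (c : 'I_k -> R) : \sum_j c j *: b_ j = 0 -> forall j, c j = 0.
Proof.
move=> e; pose v := \sum_(j | 0 < c j) c j *: b_ j.
have ev : v = \sum_(j | ~~ (0 < c j)) (- c j) *: b_ j.
  apply/eqP; rewrite -subr_eq0 -sumrN; apply/eqP; rewrite -[RHS]e.
  rewrite [RHS](bigID (fun j => 0 < c j)) /=; congr (_ + _).
  by apply: eq_bigr => j _; rewrite scaleNr opprK.
have v0 : v = 0.
  apply/eqP; rewrite -dot_eq0 eq_le dot_ge0 andbT {2}ev /v dot_suml.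
  apply: sumr_le0 => i ci; rewrite dot_sumr; apply: sumr_le0 => j cj.
  rewrite dotZl dotZr mulrA; apply: mulr_ge0_le0.
    by rewrite mulr_ge0 ?(ltW ci) // oppr_ge0 leNgt.
  apply: simple_obtuse; try exact: b_simple.
  by rewrite nth_uniq //; apply: contraNneq cj => /val_inj <-.
have np (j : 'I_k) : ~~ (0 < c j).
  apply/negP => cj; have : 0 < dot v rho.
    rewrite /v dot_suml (bigD1 j) //= ltr_pwDl //.
      by rewrite dotZl mulr_gt0 //; case: (b_simple j) => [[]].
    apply: sumr_ge0 => i /andP[ci _]; rewrite dotZl mulr_ge0 ?(ltW ci) // ltW //.
    by case: (b_simple i) => [[]].
  by rewrite v0 dot0l ltxx.
move=> j; apply/eqP/negPn/negP => cj.
have cj' : 0 < - c j by rewrite oppr_gt0 lt_def eq_sym cj leNgt np.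
have : 0 < dot v rho.
  rewrite ev dot_suml (bigD1 j) //= ltr_pwDl //.
    by rewrite dotZl mulr_gt0 //; case: (b_simple j) => [[]].
  apply: sumr_ge0 => i /andP[ci _]; rewrite dotZl mulr_ge0 ?oppr_ge0 ?leNgt // -leNgt ltW //.
  by case: (b_simple i) => [[]].
by rewrite v0 dot0l ltxx.
Qed.

Lemma simple_dual : exists d : 'I_k -> V,
  [/\ forall i j, dot (b_ i) (d j) = (i == j)%:R,
      exists D : 'I_k -> 'I_k -> R, forall j, d j = \sum_i D j i *: b_ i &
      exists G : 'I_k -> 'I_k -> R, forall j, b_ j = \sum_i G j i *: d i].
Proof.
pose G : 'M[R]_k := \matrix_(i, j) dot (b_ i) (b_ j).
have uG : G \in unitmx.
  rewrite -row_free_unit; apply: inj_row_free => v vG.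
  pose z := \sum_j v 0 j *: b_ j.
  have zb j : dot z (b_ j) = 0.
    rewrite /z dot_suml; have /rowP /(_ j) := vG; rewrite !mxE => e; apply: etrans e.
    by apply: eq_bigr => i _; rewrite dotZl mxE.
  have z0 : z = 0.
    apply/eqP; rewrite -dot_eq0 {2}/z dot_sumr big1 // => j _.
    by rewrite dotZr zb mulr0.
  by apply/rowP => j; rewrite mxE; apply: simple_free z0 j.
pose d (j : 'I_k) := \sum_i invmx G j i *: b_ i.
exists d; split.
- move=> i j; rewrite /d dot_sumr.
  have := mulVmx uG => /matrixP /(_ j i); rewrite !mxE eq_sym => <-.
  by apply: eq_bigr => h _; rewrite dotZr mxE dotC.
- by exists (fun j i => invmx G j i).
exists (fun j i => G j i) => j; rewrite /d.
under eq_bigr => i _ do rewrite scaler_sumr.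
rewrite exchange_big /=.
have e i : (\sum_h G j h * invmx G h i) = (j == i)%:R.
  by have := mulmxV uG => /matrixP /(_ j i); rewrite !mxE.
under eq_bigr => i _ do (under eq_bigr => h _ do rewrite scalerA; rewrite -scaler_suml e).
rewrite (bigD1 j) //= eqxx scale1r big1 ?addr0 // => i.
by rewrite eq_sym => /negPf ->; rewrite scale0r.
Qed.

End Simple.

Lemma nu_base_exists : exists k (b d : 'I_k -> V) rho, nu_base b d rho.
Proof.
have [rho [drho gen hrho]] := generic_near_nu.
have [Bs [uBs BsP]] := simple_list rho.
have [d [d1 d2 d3]] := simple_dual gen uBs BsP.
have bs := b_simple BsP.
have cmb := pos_comb BsP.
exists (size Bs), (fun j => Bs`_j), d, rho; split=> //.
- by move=> i; case: (bs i) => [[]].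
- by move=> g /(pos_or_neg gen) [/cmb [m ->]|/cmb [m e]]; exists m; [left|right; rewrite -e opprK].
- by move=> g rg hg; apply: cmb; split=> //; apply: hrho.
- move=> i; have [[ri pi] _] := bs i; rewrite leNgt; apply/negP => h.
  have : 0 < dot (- Bs`_i) rho by apply: hrho; [apply: (rootN S ri)|rewrite dotNl oppr_gt0].
  by rewrite dotNl oppr_gt0 ltNge ltW.
Qed.

End Base.

(** * The root lattice and the stabilizer of [nu] *)

Section Lattice.
Variables (R : realType) (n : nat) (E : set 'rV[R]_n) (W : groupType).
Variables (act : W -> 'rV[R]_n -> 'rV[R]_n) (ws : W -> 'S_n).
Variables (Wa : set W) (C : set 'rV[R]_n) (p : 'rV[R]_n).
Hypothesis S : cox_system E act ws Wa C p.
Local Notation V := 'rV[R]_n.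
Implicit Types (x y z a g v q : V) (t w u : W) (c : R).
Local Notation rfl := (rfl E act Wa).
Local Notation refl := (refl E act Wa).
Local Notation aut := (aut E act Wa).
Local Notation hyp := (hyp E act Wa).
Local Notation root := (root E act Wa).
Local Notation side := (side act).
Local Notation sep := (sep act).
Variable nu : V.
Hypothesis dnu : dir E nu.
(** Satisfied by Newton vectors, by [newton_multi]. It forces mirrors without parallel translates to
    be parallel to [nu]. *)
Hypothesis nu_multi : forall a c, hyp a c -> dot a nu != 0 -> exists2 c', hyp a c' & c != c'.
Local Notation fixes := (fixes nu).
Local Notation nu_perp := (nu_perp E act Wa nu).
Local Notation eqm := (eqm E act Wa nu).
Local Notation transm := (transm E act Wa nu).
Local Notation nu_refl := (nu_refl E act Wa nu).
Local Notation same := (same E act Wa nu).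

Let aE : affine_set E := cs_affine S.
Let Ep : E p := base_E S.

Variables (k : nat) (b d : 'I_k -> V) (rho : V).
Hypothesis hb : nu_base E act Wa nu b d rho.

Definition lattice z := exists m : 'I_k -> int, z = \sum_j (m j)%:~R *: b j.

Lemma latticeD z z' : lattice z -> lattice z' -> lattice (z + z').
Proof.
move=> [m ->] [m' ->]; exists (fun j => m j + m' j); rewrite -big_split.
by apply: eq_bigr => j _; rewrite intrD scalerDl.
Qed.

Lemma latticeZ (i : int) z : lattice z -> lattice (i%:~R *: z).
Proof.
move=> [m ->]; exists (fun j => i * m j); rewrite scaler_sumr.
by apply: eq_bigr => j _; rewrite intrM scalerA.
Qed.

Lemma latticeN z : lattice z -> lattice (- z).
Proof. by move=> /(latticeZ (-1)); rewrite scaleN1r. Qed.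

Lemma lattice0 : lattice 0.
Proof. by exists (fun=> 0); rewrite big1 // => j _; rewrite scale0r. Qed.

Lemma lattice_root g : root g -> lattice g.
Proof.
have nat_lat (m : 'I_k -> nat) : lattice (\sum_j (m j)%:R *: b j).
  by exists (fun j => (m j)%:Z); apply: eq_bigr.
by move=> /(nb_comb hb) [m [->|->]]; [|apply: latticeN].
Qed.

Lemma lattice_dir z : lattice z -> dir E z.
Proof.
by move=> [m ->]; apply: dir_sum => j _; apply: (dirZ _ aE); apply: root_dir (nb_root hb j).
Qed.

Lemma lattice_translation z : lattice z -> exists2 w, Wa w & forall x, E x -> act w x = x + z.
Proof.
have TD v' v : (exists2 w, Wa w & forall x, E x -> act w x = x + v') ->
    (exists2 w, Wa w & forall x, E x -> act w x = x + v) ->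
    exists2 w, Wa w & forall x, E x -> act w x = x + (v' + v).
  move=> [w Ww hw] [w' Ww' hw']; exists (w * w')%g; first exact: (WaM S).
  move=> x Ex; rewrite (cs_actM S) // hw ?hw' //; last by rewrite -hw' //; apply: (act_E S).
  by rewrite -addrA (addrC v).
have T0 : exists2 w, Wa w & forall x, E x -> act w x = x + 0.
  by exists 1%g; [apply: (Wa1 S)|move=> x Ex; rewrite (cs_act1 S) // addr0].
move=> [m ->]; apply: (big_ind (fun z => exists2 w, Wa w & forall x, E x -> act w x = x + z)) => // j _.
have T1 := root_translation S (nb_root hb j).
have TN v : (exists2 w, Wa w & forall x, E x -> act w x = x + v) ->
    exists2 w, Wa w & forall x, E x -> act w x = x + (- v).
  move=> [w Ww hw]; exists w^-1%g; first exact: (WaV S).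
  by move=> x Ex; apply: (addIr v); rewrite subrK -hw ?(actKV S) //; apply: (act_E S).
have Tn (h : nat) v : (exists2 w, Wa w & forall x, E x -> act w x = x + v) ->
    exists2 w, Wa w & forall x, E x -> act w x = x + h%:R *: v.
  move=> Tv; elim: h => [|h IH]; first by rewrite scale0r.
  by rewrite -natr1 scalerDl scale1r; apply: TD.
case: (m j) => h; first exact: Tn.
by rewrite NegzE mulrNz scaleNr; apply: TN; apply: Tn.
Qed.

Lemma parallel_or_single t a c : rfl t a c ->
  (exists2 l, l != 0 & root (l *: a)) \/ forall g, root g -> dot a g = 0.
Proof.
move=> ht; have [|no] := pselect (exists2 l, l != 0 & root (l *: a)); first by left.
by right=> g; apply: (single_dot S ht) => l l0 rl; apply: no; exists l.
Qed.

Lemma single_nu t a c : rfl t a c -> (forall g, root g -> dot a g = 0) -> dot a nu = 0.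
Proof.
move=> ht hs; apply/eqP/negPn/negP => an; have h : hyp a c by exists t.
have [c' h' cc] := nu_multi h an; have [l l0 rl] := parallel_root S h h' cc.
have := hs _ rl; rewrite dotZr => /eqP; rewrite mulf_eq0 (negPf l0) dot_eq0.
by rewrite (negPf (rfl_neq0 ht)).
Qed.

Lemma dual_coord (m : 'I_k -> R) j : dot (\sum_i m i *: b i) (d j) = m j.
Proof.
rewrite dot_suml (bigD1 j) //= dotZl (nb_dual hb) eqxx mulr1 big1 ?addr0 // => i ij.
by rewrite dotZl (nb_dual hb) (negPf ij) mulr0.
Qed.

Lemma dual_perp j z : (forall i, dot (b i) z = 0) -> dot (d j) z = 0.
Proof.
have [D ->] := nb_d hb; move=> h; rewrite dot_suml big1 // => i _.
by rewrite dotZl h mulr0.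
Qed.

Lemma base_perp j z : (forall i, dot (d i) z = 0) -> dot (b j) z = 0.
Proof.
have [G ->] := nb_b hb; move=> h; rewrite dot_suml big1 // => i _.
by rewrite dotZl h mulr0.
Qed.

Lemma root_perp g z : root g -> (forall i, dot (b i) z = 0) -> dot g z = 0.
Proof.
move=> /lattice_root [m ->] h; rewrite dot_suml big1 // => i _.
by rewrite dotZl h mulr0.
Qed.

(** Up to sign, a root orthogonal to [nu] is a nonnegative combination of simple roots with
    nonnegative products with [nu], so [b j] does not occur in it. Normals of mirrors without
    translates are orthogonal to the root span, which contains [d j]. *)
Lemma dual_nu_perp j : 0 < dot (b j) nu -> nu_perp (d j).
Proof.
move=> bj t a c ht anu; have [[l l0 rl]|hs] := parallel_or_single ht; last first.
  by rewrite dotC; apply: dual_perp => i; rewrite dotC; apply: hs; apply: (nb_root hb).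
suff : dot (l *: a) (d j) = 0 by rewrite dotZl => /eqP; rewrite mulf_eq0 (negPf l0) => /eqP.
have lnu : dot (l *: a) nu = 0 by rewrite dotZl anu mulr0.
have main (m : 'I_k -> nat) : dot (\sum_j (m j)%:R *: b j) nu = 0 -> (m j)%:R = 0 :> R.
  rewrite dot_suml => /eqP; rewrite psumr_eq0; last first.
    by move=> i _; rewrite dotZl mulr_ge0 ?ler0n // (nb_nu hb).
  move=> /allP /(_ j (mem_index_enum j)); rewrite dotZl mulf_eq0 (gt_eqF bj) orbF.
  by move/eqP.
have [m [e|e]] := nb_comb hb rl; rewrite e in lnu *.
  by rewrite dual_coord main.
by rewrite dotNl dual_coord main ?oppr0 //; move: lnu; rewrite dotNl => /eqP; rewrite oppr_eq0 => /eqP.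
Qed.

(** The remaining [b j] are normals orthogonal to [nu], which [eqm] does not see. *)
Lemma lattice_eqm z z' : lattice z -> lattice z' ->
  (forall j, 0 < dot (b j) nu -> dot z (d j) = dot z' (d j)) -> eqm z z'.
Proof.
move=> [m ->] [m' ->] h w hw; rewrite !dot_suml; apply: eq_bigr => j _.
rewrite !dotZl; have [bj|bj] := ltP 0 (dot (b j) nu).
  by have := h j bj; rewrite !dual_coord => ->.
have bj0 : dot (b j) nu = 0 by apply/eqP; rewrite eq_le bj (nb_nu hb).
have [c [t ht]] := root_hyp (nb_root hb j).
by rewrite (hw _ _ _ ht bj0) !mulr0.
Qed.

Lemma lattice_aut f s psi z : aut f s psi -> lattice z -> lattice (col_perm s z).
Proof.
move=> h [m ->]; rewrite linear_sum /=.
elim/big_rec: _ => [|j z' _ hz']; first exact: lattice0.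
apply: latticeD => //; rewrite linearZ /=; apply: latticeZ; apply: lattice_root.
by apply: (aut_root S h); apply: (nb_root hb).
Qed.

Lemma aut_rootV f s psi g : aut f s psi -> root g -> root (col_perm s^-1 g).
Proof.
move=> h rg; pose g' := col_perm s^-1 g; have e : col_perm s g' = g by rewrite col_permKV.
have [g0 [c0 hc]] := rg; split.
  by apply: contra_neq g0 => e0; rewrite -e /g' e0 linear0.
have nn : dot g' g' = dot g g by rewrite dot_perm.
exists (c0 - dot g (f p) + dot g' p) => c; rewrite -/g' nn.
rewrite -(aut_hyp S g' c h) e hc; split=> -[m em]; exists m.
  have -> : c = (c - dot g' p + dot g (f p)) - dot g (f p) + dot g' p by ring.
  by rewrite em; ring.
by rewrite em; ring.
Qed.

Lemma root_coord g : root g -> g = \sum_i dot g (d i) *: b i.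
Proof.
move=> /lattice_root [m e]; rewrite {1}e; apply: eq_bigr => j _.
by rewrite e dual_coord.
Qed.

(** [col_perm s (b i)] has the same product with [nu] as [b i]. If it is positive, this root has
    natural coordinates; if it is zero, the root is orthogonal to [d j]. *)
Lemma perm_coord (s : 'S_n) : (forall g, root g -> root (col_perm s g)) -> fixes s ->
  forall i j, 0 < dot (b j) nu -> exists m : nat,
    dot (col_perm s (b i)) (d j) = m%:R /\ (dot (b i) nu = 0 -> m = 0%N).
Proof.
move=> sr fs i j bj; have ri := sr _ (nb_root hb i).
have enu : dot (col_perm s (b i)) nu = dot (b i) nu by rewrite -{1}fs dot_perm.
have := nb_nu hb i; rewrite le_eqVlt => /orP[/eqP e|h].
  exists 0%N; split=> //; have [c [t ht]] := root_hyp ri.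
  by apply: (dual_nu_perp bj ht); rewrite enu -e.
have [|m em] := nb_pos hb ri; first by rewrite enu.
exists (m j); split; first by rewrite em dual_coord.
by move=> e; rewrite e ltxx in h.
Qed.

Lemma perm_compose (s t : 'S_n) i l : (forall g, root g -> root (col_perm t g)) ->
  (forall g, col_perm s (col_perm t g) = g) ->
  (i == l)%:R = \sum_h dot (col_perm t (b i)) (d h) * dot (col_perm s (b h)) (d l).
Proof.
move=> rt st; rewrite -(nb_dual hb) -{1}(st (b i)) (root_coord (rt _ (nb_root hb i))).
rewrite linear_sum dot_suml; apply: eq_bigr => h _.
by rewrite linearZ dotZl -root_coord //; apply/rt/(nb_root hb).
Qed.

(* The matrix of s in the base, restricted to the coordinates not orthogonal to
   nu, and that of its inverse are nonnegative and integral: s permutes these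
   coordinates. *)
Lemma aut_coord f s psi l : aut f s psi -> fixes s -> 0 < dot (b l) nu ->
  exists h, forall v, dot (col_perm s v) (d l) = dot v (d h).
Proof.
move=> hs fs bl.
have rs g : root g -> root (col_perm s g) by apply: (aut_root S hs).
have rsV g : root g -> root (col_perm s^-1 g) by apply: (aut_rootV hs).
have fsV : fixes s^-1%g by have := col_permK s nu; rewrite [col_perm s nu]fs.
pose A i j := dot (col_perm s (b i)) (d j).
pose A' i j := dot (col_perm s^-1 (b i)) (d j).
have AN i j : 0 < dot (b j) nu -> exists m : nat, A i j = m%:R /\ (dot (b i) nu = 0 -> m = 0%N).
  exact: perm_coord.
have A'N i j : 0 < dot (b j) nu -> exists m : nat, A' i j = m%:R /\ (dot (b i) nu = 0 -> m = 0%N).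
  exact: perm_coord.
have e1 i : (i == l)%:R = \sum_h A' i h * A h l.
  by apply: perm_compose => // g; apply: col_permKV.
have e2 i j : (i == j)%:R = \sum_h A i h * A' h j.
  by apply: perm_compose => // g; apply: col_permK.
(* A diagonal entry of the product of the two matrices is 1, so some term is nonzero; zero entries
   of the reverse product are sums of nonnegative terms and force the rest of column [l] to
   vanish. *)
have [h nz] : exists h, A' l h * A h l != 0.
  apply: contrapT => no; have := e1 l; rewrite eqxx big1 => [/eqP|i _]; first by rewrite oner_eq0.
  by apply/eqP/negPn/negP => ni; apply: no; exists i.
have [m [em mz]] := AN h l bl.
have bh : 0 < dot (b h) nu.
  rewrite lt_def (nb_nu hb) andbT; apply: contraNneq nz => /mz e0.
  by rewrite em e0 mulr0.
have [m' [em' _]] := A'N l h bh.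
have off i : i != h -> A i l = 0.
  move=> ih; have /esym/eqP := e2 i h; rewrite (negPf ih) psumr_eq0; last first.
    move=> j _; have [j' [ej jz]] := A'N j h bh.
    have := nb_nu hb j; rewrite le_eqVlt => /orP[/eqP e|bj].
      by rewrite ej jz ?mulr0.
    by have [i' [-> _]] := AN i j bj; rewrite ej mulr_ge0.
  move=> /allP /(_ l (mem_index_enum l)); rewrite mulf_eq0 => /orP[/eqP //|/eqP z].
  by move: nz; rewrite z mul0r eqxx.
have one : A h l = 1.
  have := e1 l; rewrite eqxx (bigD1 h) //= big1 ?addr0; last first.
    by move=> i ih; rewrite off ?mulr0.
  rewrite em em' -natrM => /eqP; rewrite eqr_nat eq_sym muln_eq1 => /andP[_ /eqP ->].
  by [].
exists h => v.
(* [vb] is the part of [v] in the root span; the rest [u] is orthogonal to every [d i], before and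
   after [s]. *)
pose vb := \sum_i dot v (d i) *: b i; pose u := v - vb.
have ud i : dot (d i) u = 0 by rewrite dotC /u dotBl /vb dual_coord subrr.
have ub i : dot (b i) u = 0 by apply: base_perp.
have su : dot (col_perm s u) (d l) = 0.
  rewrite dotC; apply: dual_perp => i; rewrite dotC dot_permV dotC.
  by apply: root_perp => //; apply: rsV; apply: (nb_root hb).
have ev : v = vb + u by rewrite /u addrC subrK.
rewrite {1}ev linearD dotDl su addr0 /vb.
rewrite linear_sum dot_suml (bigD1 h) //= linearZ dotZl -/(A h l) one mulr1 big1 ?addr0 //.
by move=> i ih; rewrite linearZ /= dotZl -/(A i l) off ?mulr0.
Qed.

(** On the coordinates seen by [eqm], [col_perm s] is a permutation and [q] an integral shift; the
    floor respects both. As [z] depends only on [v], it serves several automorphisms at once. *)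
Lemma lattice_floor v : exists2 z, lattice z & forall f s psi q, aut f s psi -> fixes s ->
  lattice q -> eqm (v - col_perm s v) q -> eqm (z - col_perm s z) q.
Proof.
exists (\sum_j (Num.floor (dot v (d j)))%:~R *: b j); first by exists (fun j => Num.floor (dot v (d j))).
set z := \sum_j _; have lz : lattice z by eexists.
move=> f s psi q hs fs lq e; apply: lattice_eqm => //.
  by apply: latticeD => //; apply/latticeN/(lattice_aut hs).
move=> l bl; have [h eh] := aut_coord hs fs bl.
have := e _ (dual_nu_perp bl); rewrite !dotBl !eh /z !dual_coord.
have [m ->] := lq; rewrite dual_coord => e3.
have -> : dot v (d l) = dot v (d h) + (m l)%:~R by rewrite -e3; ring.
by rewrite floorDrz // intrKfloor intrD; ring.
Qed.

Lemma dual_dir j : dir E (d j).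
Proof.
have [D ->] := nb_d hb; apply: dir_sum => i _.
by apply: (dirZ _ aE); apply: root_dir (nb_root hb i).
Qed.

Lemma base_hyp j : exists c, hyp (b j) c.
Proof. exact: root_hyp (nb_root hb j). Qed.

(* A base point lying on a mirror orthogonal to each simple root. *)
Definition special : V := p + \sum_j (projT1 (cid (base_hyp j)) - dot (b j) p) *: d j.
Local Notation o := special.

Lemma special_E : E o.
Proof. by apply: dir_sum => // j _; apply: (dirZ _ aE); apply: dual_dir. Qed.

Lemma special_base j : hyp (b j) (dot (b j) o).
Proof.
have -> : dot (b j) o = projT1 (cid (base_hyp j)); last exact: (projT2 (cid (base_hyp j))).
rewrite /special dotDr dot_sumr (bigD1 j) //= dotZr (nb_dual hb) eqxx mulr1 big1.
  by rewrite addr0 addrC subrK.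
by move=> i ij; rewrite dotZr (nb_dual hb) eq_sym (negPf ij) mulr0.
Qed.

Lemma special_fix w a : act w o = o -> hyp a (dot a o) ->
  hyp (col_perm (ws w) a) (dot (col_perm (ws w) a) o).
Proof.
move=> fo /(aut_hyp S _ _ (aut_act S w)); congr hyp.
have : dot (col_perm (ws w) a) (act w p - o) = dot a (p - o).
  by rewrite -{1}fo (actB S) ?dot_perm //; apply: special_E.
by rewrite !dotBr => e; lra.
Qed.

Lemma special_refl t g : rfl t g (dot g o) -> act t o = o.
Proof. by move=> h; apply/(rfl_fix h special_E). Qed.

(* Reflecting in a simple root having positive product with a positive root
   decreases its height. *)
Lemma special_pos N (m : 'I_k -> nat) : (\sum_j m j <= N)%N ->
  root (\sum_j (m j)%:R *: b j) -> hyp (\sum_j (m j)%:R *: b j) (dot (\sum_j (m j)%:R *: b j) o).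
Proof.
elim: N m => [|N IH] m hN; set g := \sum_j (m j)%:R *: b j => rg.
  have [g0 _] := rg; case/eqP: g0; rewrite /g big1 // => j _.
  by move: hN; rewrite leqn0 sum_nat_eq0 => /forallP /(_ j) /eqP ->; rewrite scale0r.
have gd j : dot g (d j) = (m j)%:R by apply: dual_coord.
have [[j e]|nb] := pselect (exists j, g = b j); first by rewrite e; apply: special_base.
have [j gj] : exists j, 0 < dot g (b j).
  apply: contrapT => no; have [g0 _] := rg; have := dot_gt0 g0.
  rewrite {2}/g dot_sumr ltNge => /negP; apply; apply: sumr_le0 => j _.
  rewrite dotZr mulr_ge0_le0 // leNgt; apply/negP => h; apply: no; by exists j.
have rj := nb_root hb j; have [b0 _] := rj; have bb := dot_gt0 b0.
have [c hc] := root_int S rg rj.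
pose g' := g - c%:~R *: b j.
have rg' : root g'.
  by have := root_refl S rj rg; rewrite hc mulfK ?gt_eqF.
have c0 : 0 < c.
  by rewrite -(ltr0z R) -(pmulr_lgt0 _ bb) -hc mulr_gt0 // dotC.
have g'd i : dot g' (d i) = (m i)%:R - (i == j)%:R * c%:~R.
  by rewrite /g' dotBl gd dotZl (nb_dual hb) mulrC eq_sym.
have hg' : hyp g' (dot g' o).
  have [m' [e|e]] := nb_comb hb rg'; last first.
    case: nb; exists j; have mi i : i != j -> m i = 0%N.
      move=> ij; have := g'd i; rewrite (negPf ij) mul0r subr0 e dotNl dual_coord => /eqP.
      by rewrite eq_sym -subr_eq0 opprK -natrD pnatr_eq0 addn_eq0 => /andP[/eqP].
    have eg : g = (m j)%:R *: b j.
      rewrite /g (bigD1 j) //= big1 ?addr0 // => i ij; by rewrite (mi _ ij) scale0r.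
    move: rg; rewrite eg => /(root_reduced S rj)[->|em]; first by rewrite scale1r.
    have : (0 : R) <= -1 by rewrite -em.
    by rewrite ler0N1.
  rewrite e; apply: IH; last by rewrite -e.
  have lt : (\sum_i m' i < \sum_i m i)%N; last by rewrite -ltnS (leq_trans lt).
  have mm i : i != j -> m' i = m i.
    move=> ij; have := g'd i; rewrite (negPf ij) mul0r subr0 e dual_coord => /eqP.
    by rewrite eqr_nat => /eqP.
  rewrite [X in (X < _)%N](bigD1 j) // [X in (_ < X)%N](bigD1 j) //=.
  rewrite (eq_bigr m) ?ltn_add2r // -(ltr_nat R).
  have := g'd j; rewrite eqxx mul1r e dual_coord => ->.
  by rewrite ltrBlDr ltrDl ltr0z.
have [t ht] := special_base j.
have -> : g = col_perm (ws t) g'.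
  rewrite (hyp_perm S ht (root_dir rg')) /g' dotBr dotZr.
  have -> : 2 * (dot (b j) g - c%:~R * dot (b j) (b j)) / dot (b j) (b j) = - c%:~R.
    by rewrite mulrBr hc; field; rewrite gt_eqF.
  by rewrite scaleNr opprK subrK.
exact: special_fix (special_refl ht) hg'.
Qed.

Lemma special_root g : root g -> hyp g (dot g o).
Proof.
move=> rg; have [m [e|e]] := nb_comb hb rg.
  by rewrite e; apply: (special_pos (leqnn _)); rewrite -e.
have rN : root (- g) by apply: (rootN S).
have := rN; rewrite e opprK => rg'; have := special_pos (leqnn _) rg'.
have m1 : (-1 : R) != 0 by rewrite oppr_eq0 oner_eq0.
by move=> /(hypZ S m1); rewrite scaleN1r mulN1r -dotNl.
Qed.

Definition special_mirror t := exists2 g, root g & rfl t g (dot g o).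
(* Such a mirror has no parallel translate, by parallel_root. *)
Definition single_mirror t := exists a c, rfl t a c /\ forall g, root g -> dot a g = 0.

Lemma single_nu_refl t : single_mirror t -> nu_refl t.
Proof. by move=> [a [c [ht hs]]]; exists a, c; split=> //; apply: single_nu ht hs. Qed.

Lemma single_conj w t : single_mirror t -> single_mirror (w^-1 * t * w)%g.
Proof.
move=> [a [c [ht hs]]]; have h := aut_act S w^-1%g.
have e := aut_rfl S h ht; rewrite invgK in e.
do 2!eexists; split; first exact: e.
move=> g rg; rewrite dot_permV; apply: hs.
by have := aut_rootV h rg.
Qed.

(** Induction on a word: a reflection with parallel translates is the parallel special one followed
    by a lattice translation; one without translates is conjugated past the special factors and
    stays of that kind. *)
Lemma weyl_decomp (y : W) : Wa y -> exists z s s', [/\ lattice z,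
  forall t, t \in s -> special_mirror t, forall t, t \in s' -> single_mirror t &
  forall x, E x -> act y x = act (\prod_(r <- s) r)%g (act (\prod_(r <- s') r)%g x) + z].
Proof.
move=> Wy; have [l hl ->] := aw_generated (cs_weyl S) Wy.
elim: l hl {Wy} => [|t l IH] hl.
  exists 0, [::], [::]; split=> // [|x Ex]; first exact: lattice0.
  by rewrite !big_nil !(cs_act1 S) // addr0.
have [|z [s [s' [lz hs hs' e]]]] := IH.
  by move=> u hu; apply: hl; rewrite inE hu orbT.
have [a [c ht]] := simple_refl S (hl t (mem_head _ _)).
have lz' : lattice (col_perm (ws t) z) by apply: lattice_aut (aut_act S t) lz.
have e' x : E x -> act (t * \prod_(r <- l) r)%g x =
    act t (act (\prod_(r <- s) r)%g (act (\prod_(r <- s') r)%g x)) + col_perm (ws t) z.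
  move=> Ex; rewrite (cs_actM S) // e // (actD S) //; last exact: lattice_dir.
  by do 2!apply: (act_E S).
have [[h h0 rh]|sg] := parallel_or_single ht.
  have htg := rfl_scale S ht h0; set g := h *: a in htg rh.
  have [u hu] := special_root rh.
  have [m em] := root_diff rh (ex_intro _ u hu) (ex_intro _ t htg).
  exists (m%:~R *: g + col_perm (ws t) z), (u :: s), s'; split=> //.
  - by apply: latticeD => //; apply: latticeZ; apply: lattice_root.
  - by move=> t'; rewrite inE => /orP[/eqP->|/hs //]; exists g.
  move=> x Ex; have Ev := act_E S (\prod_(r <- s') r)%g Ex.
  have Ey := act_E S (\prod_(r <- s) r)%g Ev.
  rewrite [in LHS]big_cons e' // big_cons (cs_actM S) //.
  move: Ey; set y1 := act _ (act _ x) => Ey.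
  have [_ g0 _ hu'] := hu; have [_ _ _ ht'] := htg; rewrite hu' // ht' //.
  have gg : dot g g != 0 by rewrite dot_eq0.
  by rewrite em; apply/rowP => i; rewrite !mxE; field.
pose w := (\prod_(r <- s) r)%g.
exists (col_perm (ws t) z), s, ((w^-1 * t * w)%g :: s'); split=> //.
  move=> t'; rewrite inE => /orP[/eqP->|/hs' //]; apply: single_conj; by exists a, c.
move=> x Ex; have Ev := act_E S (\prod_(r <- s') r)%g Ex.
rewrite [in LHS]big_cons e' // big_cons -/w; congr (_ + _).
by rewrite -!(cs_actM S) // !mulgA mulgV mul1g.
Qed.

(** The position of the image of [o + rho] is compared mirror by mirror. For roots not orthogonal to
    [nu] the side is dictated by [nu], which [w] fixes; for the others it is corrected by [m], a
    product of reflections in mirrors parallel to [nu]. So [m * w] is trivial. *)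
Lemma special_stab (s : seq W) : (forall t, t \in s -> special_mirror t) ->
  fixes (ws (\prod_(r <- s) r)%g) -> transm (\prod_(r <- s) r)%g 0.
Proof.
move=> hs; set w := (\prod_(r <- s) r)%g => fw.
have Eo := special_E.
have fo (l : seq W) : (forall t, t \in l -> special_mirror t) -> act (\prod_(r <- l) r)%g o = o.
  elim: l => [|t l IH] hl; first by rewrite big_nil (cs_act1 S).
  rewrite big_cons (cs_actM S) // IH; last by move=> u hu; apply: hl; rewrite inE hu orbT.
  by have [|g _ ht] := hl t; [exact: mem_head|exact: special_refl ht].
pose M t := exists g, [/\ root g, dot g nu = 0 & rfl t g (dot g o)].
have MS t : M t -> special_mirror t by move=> [g [rg _ h]]; exists g.
have MN t : M t -> nu_refl t by move=> [g [_ gn h]]; exists g, (dot g o).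
have Erho : E (o + rho) by apply: (nb_dir hb).
have Ww : Wa w by apply: (prod_Wa S) => t /hs [g _ h]; apply: rfl_Wa h.
have Ew := act_E S w Erho.
have [||s2 [hs2 hm]] := @chamber_move _ _ _ _ _ _ _ _ _ S M (act w (o + rho)) (o + rho) _ _ Ew Erho.
- by move=> t /MN; apply: nu_refl_refl.
- move=> t t' Mt [g [rg gn h]]; have rt := nu_refl_refl (MN _ Mt).
  have ft : act t o = o by have [g' _ h'] := MS _ Mt; apply: special_refl h'.
  have fnt := nu_refl_fixes S dnu (MN _ Mt).
  have rtg := aut_root S (aut_act S t) rg; exists (col_perm (ws t) g); split=> //.
    by rewrite -{1}fnt dot_perm gn.
  have := aut_rfl S (aut_act S t) h; rewrite (refl_inv S rt); congr (rfl _ _ _).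
  have : dot (col_perm (ws t) g) (act t p - o) = dot g (p - o).
    by rewrite -{1}ft (actB S) ?dot_perm.
  by rewrite !dotBr => e; lra.
set m := (\prod_(r <- s2) r)%g in hm.
have [Wm fm tm] := nu_group S dnu (fun t h => MN t (hs2 t h)).
rewrite -/m in Wm fm tm.
suff e : (m * w = 1)%g.
  have -> : w = m^-1%g by rewrite -[w](mulKg m) e mulg1.
  by rewrite -oppr0; apply: (transmV S).
have fmw := fixesM S dnu fm fw.
have mwo : act (m * w)%g o = o.
  by rewrite (cs_actM S) // (fo _ hs) fo // => t /hs2 /MS.
apply: (rigid S (A := [set o]) (q := o + rho)) => //.
- exact: (WaM S).
- by exists o.
- by move=> x ->.
- by move=> x ->.
move=> t [a [c ht]] hfix; have /(rfl_fix ht Eo) eo : act t o = o by apply: hfix.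
have [[h h0 rh]|sg] := parallel_or_single ht; last first.
  (* [o - p] lies in the root span, so a mirror without translates through [o] would contain the
     regular point [p]. *)
  exfalso; apply: (base_reg S (ex_intro _ a (ex_intro _ c ht))).
  apply/(rfl_fix ht Ep); rewrite -eo /special dotDr dot_sumr big1 ?addr0 // => j _.
  rewrite dotZr (dotC a) dual_perp ?mulr0 // => i; rewrite dotC; exact: sg (nb_root hb i).
have htg := rfl_scale S ht h0; rewrite -eo -dotZl in htg; set g := h *: a in htg rh.
have Emw := act_E S (m * w)%g Erho.
rewrite (sideE htg) // (actD S) //; last exact: (nb_dir hb).
rewrite mwo !(dotDr g o) !(addrC (dot g o)) !addrK.
pose g' := col_perm (ws (m * w)%g)^-1 g.
have rg' : root g' by apply: aut_rootV (aut_act S _) rh.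
have eg' : dot g (col_perm (ws (m * w)%g) rho) = dot g' rho.
  by rewrite dotC dot_permV dotC.
have enu : dot g' nu = dot g nu by rewrite /g' dot_permV invgK fmw.
rewrite eg'; have [gn|gn|gn] := ltgtP (dot g nu) 0.
- have n1 : dot g rho < 0.
    by rewrite -oppr_gt0 -dotNl; apply: (nb_rho hb); [apply: (rootN S)|rewrite dotNl oppr_gt0].
  have n2 : dot g' rho < 0.
    by rewrite -oppr_gt0 -dotNl; apply: (nb_rho hb); [apply: (rootN S)|rewrite dotNl oppr_gt0 enu].
  by rewrite nmulr_rgt0.
- by apply: mulr_gt0; apply: (nb_rho hb) => //; rewrite enu.
have Mt : M t by exists g.
have := hm _ Mt; rewrite -(cs_actM S) // sep_sym (sepE htg) // (actD S) //; last exact: (nb_dir hb).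
rewrite mwo !(dotDr g o) !(addrC (dot g o)) !addrK eg' -leNgt le_eqVlt => /orP[|//].
by rewrite eq_sym mulf_eq0 (negPf (nb_gen hb rh)) (negPf (nb_gen hb rg')).
Qed.

Lemma weyl_transm (y : W) : Wa y -> fixes (ws y) -> exists2 z, lattice z & transm y z.
Proof.
move=> Wy fy; have [z [s [s' [lz hs hs' e]]]] := weyl_decomp Wy.
exists z => //; have dz := lattice_dir lz.
set w := (\prod_(r <- s) r)%g in e; set v := (\prod_(r <- s') r)%g in e.
have [Wv fv tv] := nu_group S dnu (fun t h => single_nu_refl (hs' t h)).
rewrite -/v in Wv fv tv.
have fw : fixes (ws w).
  have : act y (p + nu) = act y p + nu by rewrite (actD S) // fy.
  rewrite !e //; last exact: dnu.
  rewrite !(actD S) ?fv //; last exact: (act_E S).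
  by rewrite addrAC => /addrI.
have tw : transm w 0 by apply: special_stab.
move=> x Ex; rewrite e // addrAC -[X in eqm _ X]add0r; apply: eqmD => //.
by rewrite -(cs_actM S) //; have := transmM S tw tv; rewrite addr0; apply.
Qed.

End Lattice.

(** * Twisted conjugation of straight elements *)

Section Twisted.
Variables (R : realType) (n : nat) (E : set 'rV[R]_n) (W : groupType).
Variables (act : W -> 'rV[R]_n -> 'rV[R]_n) (ws : W -> 'S_n).
Variables (Wa : set W) (C : set 'rV[R]_n) (p : 'rV[R]_n).
Hypothesis S : cox_system E act ws Wa C p.
Local Notation V := 'rV[R]_n.
Local Notation rfl := (rfl E act Wa).
Local Notation refl := (refl E act Wa).
Local Notation reg := (reg E act Wa).
Local Notation aut := (aut E act Wa).
Local Notation hyp := (hyp E act Wa).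
Local Notation side := (side act).
Local Notation sep := (sep act).
Local Notation same := (same E act Wa).
Local Notation eqm := (eqm E act Wa).
Local Notation transm := (transm E act Wa).
Local Notation N := (n`!).

Let aE : affine_set E := cs_affine S.
Let Ep : E p := base_E S.
Let rp : reg p := base_reg S.

Lemma aut_iter f s psi m : aut f s psi -> aut (iter m f) (s ^+ m)%g (iter m psi).
Proof.
move=> h; elim: m => [|m IH]; last by rewrite expgS; exact: (aut_comp h IH).
split=> //.
- by split=> // x y _ _; rewrite expg0 col_perm1.
- by move=> y Ey; exists y.
- by move=> w Ww; exists w.
Qed.

Lemma aut_same_move f s psi nu x y : aut f s psi -> E x -> E y -> same nu x y ->
  same (col_perm s nu) (f x) (f y).
Proof.
move=> h Ex Ey hxy t [a [c [ht anu]]].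
have [t' Wt' e] := aut_onto h (rfl_Wa ht); rewrite -e in ht *.
rewrite (aut_side S h) //; apply: hxy.
have [c' h'] := aut_rflV S h Wt' ht; do 2!eexists; split; first exact: h'.
by rewrite -(dot_perm s) col_permKV.
Qed.

Lemma aut_fixes f s psi nu u : dir E nu -> aut f s psi -> fixes nu s -> fixes nu (ws u) ->
  fixes nu (ws (psi u)).
Proof.
move=> dnu h fs fu; have Efp := aut_E h Ep.
apply: (addrI (act (psi u) (f p))); rewrite -(actD S) //.
have -> : f p + nu = f (p + nu) by rewrite (aut_D h) // fs.
rewrite -!(aut_equiv h) ?(actD S) ?fu //; last exact: dnu.
by rewrite (aut_D h) ?fs //; apply: (act_E S).
Qed.

Lemma same_mul nu g h : fixes nu (ws g) -> same nu p (act g p) -> same nu p (act h p) ->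
  same nu p (act (g * h)%g p).
Proof.
move=> fg sg sh; have Eg := act_E S g Ep; have Eh := act_E S h Ep.
rewrite (cs_actM S) //; apply: (same_trans Ep Eg _ sg); first exact: (act_E S).
exact: (act_same S fg Ep Eh sh).
Qed.

Lemma same_inv nu g : dir E nu -> fixes nu (ws g) -> same nu p (act g p) ->
  same nu p (act g^-1%g p).
Proof.
move=> dnu fg sg; apply: same_sym; rewrite -{2}(actK S g Ep).
apply: (act_same S _ Ep (act_E S g Ep) sg); exact: (fixesV S dnu).
Qed.

(* tau is the Frobenius on the apartment and sg the one on the group. *)
Variables (tau : V -> V) (ts : 'S_n) (sg : W -> W).
Hypothesis htau : aut tau ts sg.
Hypothesis sgM : forall w u, sg (w * u)%g = (sg w * sg u)%g.
Hypothesis taup : tau p = p.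

Lemma sg1 : sg 1%g = 1%g.
Proof. by apply: (@mulgI _ (sg 1%g)); rewrite -sgM !mulg1. Qed.

Lemma sgV w : sg w^-1%g = (sg w)^-1%g.
Proof. by apply: (@mulgI _ (sg w)); rewrite -sgM !mulgV sg1. Qed.

Definition tw (x : W) : V -> V := act x \o tau.
Definition tws (x : W) : 'S_n := (ws x * ts)%g.
Definition twg (x w : W) : W := (x * sg w * x^-1)%g.

Lemma aut_tw x : aut (tw x) (tws x) (twg x).
Proof. exact: (aut_comp (aut_act S x) htau). Qed.

Lemma twgM x w u : twg x (w * u)%g = (twg x w * twg x u)%g.
Proof. by rewrite /twg sgM !mulgA mulgVK. Qed.

Lemma twgV x w : twg x w^-1%g = (twg x w)^-1%g.
Proof. by rewrite /twg sgV !invMg invgK !mulgA. Qed.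

(** The mean displacement of [p] over [N] steps; the iterate of order [N] is the translation by [N]
    times this vector. *)
Definition newton (x : W) : V := N%:R^-1 *: (iter N (tw x) p - p).

Section Newton.
Variable x : W.
Local Notation nu := (newton x).
Let N0 : (N%:R : R) != 0. Proof. by rewrite pnatr_eq0 -lt0n fact_gt0. Qed.

Lemma newton_dir : dir E nu.
Proof.
apply: (dirZ _ aE); apply: dirB => //.
exact: (aut_E (aut_iter N (aut_tw x)) Ep).
Qed.

Lemma newton_iter y : E y -> iter N (tw x) y = y + N%:R *: nu.
Proof.
move=> Ey; rewrite (paff_translation (aut_paff (aut_tw x)) Ep) //.
by rewrite /newton scalerA mulfV // scale1r.
Qed.

(** Commuting with [tw x] entails commuting with the translation that is its [N]-th iterate. *)
Lemma newton_commute g s psi : aut g s psi ->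
  (forall y, E y -> g (tw x y) = tw x (g y)) -> fixes nu s.
Proof.
move=> h gc; apply: (scalerI N0); apply: (addrI (g p)).
rewrite -newton_iter; last exact: (aut_E h).
have -> : iter N (tw x) (g p) = g (iter N (tw x) p).
  elim: (N) => //= m ->; rewrite gc //.
  exact: (aut_E (aut_iter m (aut_tw x)) Ep).
rewrite newton_iter // (aut_D h) //; last exact: (dirZ _ aE newton_dir).
by rewrite [in RHS]linearZ.
Qed.

Lemma newton_tws : fixes nu (tws x).
Proof. exact: (newton_commute (aut_tw x)). Qed.

(** The translation by [N%:R *: nu] permutes the mirrors and displaces this one. *)
Lemma newton_multi a c : hyp a c -> dot a nu != 0 -> exists2 c', hyp a c' & c != c'.
Proof.
move=> h an; have hN := aut_iter N (aut_tw x).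
have e : col_perm (tws x ^+ N)%g a = a by rewrite -col_perm_iter col_perm_order.
have := h; rewrite -(aut_hyp S a c hN) e newton_iter // => h'; eexists; first exact: h'.
rewrite dotDr dotZr addrA subrK -subr_eq0 opprD addrA subrr add0r oppr_eq0.
by rewrite mulf_neq0.
Qed.

Hypothesis sgx : sg x = x.

Lemma tau_tw y : E y -> tau (tw x y) = tw x (tau y).
Proof. by move=> Ey; rewrite /tw /= (aut_equiv htau) ?sgx //; apply: (aut_E htau). Qed.

Lemma newton_ts : fixes nu ts.
Proof. exact: (newton_commute htau tau_tw). Qed.

Lemma sgX m : sg (x ^+ m)%g = (x ^+ m)%g.
Proof. by elim: m => [|m IH]; rewrite ?expg0 ?sg1 // expgS sgM sgx IH. Qed.

Lemma iter_tw m : iter m (tw x) p = act (x ^+ m)%g p.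
Proof.
elim: m => [|m IH]; first by rewrite expg0 (cs_act1 S).
by rewrite iterS IH /tw /= (aut_equiv htau) // sgX taup expgS (cs_actM S).
Qed.

Hypothesis chx : chain E act Wa p x.

Let Ei m : E (act (x ^+ m)%g p). Proof. exact: (act_E S). Qed.
Let ri m : reg (act (x ^+ m)%g p). Proof. exact: (reg_act S). Qed.

(** A mirror parallel to [nu] crossed at step [m] would be crossed again at step [N + m], which is
    the translate of that step along [nu]; [chain] forbids it. *)
Lemma newton_same m : same nu p (act (x ^+ m)%g p).
Proof.
elim: m => [|m IH]; first by rewrite expg0 (cs_act1 S) //; apply: (same_refl Ep rp).
apply: (same_trans Ep (Ei m) (Ei _) IH) => t ht.
have [a [c [h anu]]] := ht; have rt : refl t by exists a, c.
apply: (reg_side rt) => //; apply/negP => s1.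
have sh j : act (x ^+ (N + j))%g p = act (x ^+ j)%g p + N%:R *: nu.
  by rewrite -!iter_tw iterD newton_iter // iter_tw.
have dN := dirZ N%:R aE newton_dir.
have := chx (i := m) (j := N + m) (t := t) _ rt.
rewrite -[X in (X < _)%N]add0n ltn_add2r fact_gt0 => /(_ isT); rewrite s1 /=.
rewrite -addnS !sh (sepE h) ?dotDr ?(dotZr N%:R) ?anu ?mulr0 ?addr0; try exact: dN.
by rewrite -(sepE h) // s1.
Qed.

(* The average of the orbit of p under tw x - nu, hence a fixed point of it. *)
Definition newton_pt : V := N%:R^-1 *: \sum_(i < N) iter i (fun y => tw x y - nu) p.
Local Notation e := newton_pt.
Let ft y := tw x y - nu.

Let ft_paff : paff E ft (tws x).
Proof.
split=> [y Ey|y z Ey Ez].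
  by apply: (dirN aE newton_dir); apply: (aut_E (aut_tw x)).
by rewrite /ft opprB addrA subrK (aut_B (aut_tw x)).
Qed.

Let ft_iter i : iter i ft p = act (x ^+ i)%g p - i%:R *: nu.
Proof.
elim: i => [|i IH]; first by rewrite expg0 (cs_act1 S) // scale0r subr0.
rewrite iterS IH {1}/ft -scaleNr (aut_D (aut_tw x)) //; last exact: (dirZ _ aE newton_dir).
rewrite linearZ /= newton_tws -iter_tw -iterS iter_tw -natr1 scalerDl scale1r scaleNr.
by rewrite opprD addrA.
Qed.

Lemma newton_pt_E : E e.
Proof.
have [|h _] := orbit_avg S ft_paff Ep; last exact: h.
by rewrite ft_iter -iter_tw newton_iter // addrK.
Qed.

Lemma newton_pt_tw : tw x e = e + nu.
Proof.
have [|_ h] := orbit_avg S ft_paff Ep; last first.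
  have {}h : ft e = e := h.
  by rewrite -{2}h /ft subrK.
by rewrite ft_iter -iter_tw newton_iter // addrK.
Qed.

Lemma newton_pt_tau : tau e = e.
Proof.
have c0 : (0 < #|'I_N|)%N by rewrite card_ord fact_gt0.
have Ef (i : 'I_N) : E (iter i ft p).
  by rewrite ft_iter -scaleNr; apply: (dirZ _ aE newton_dir).
have [_] := paff_avg (aut_paff htau) aE c0 Ef.
rewrite card_ord -/e => ->; congr (_ *: _); apply: eq_bigr => i _.
rewrite ft_iter -scaleNr (aut_D htau) //; last exact: (dirZ _ aE newton_dir).
by rewrite linearZ /= newton_ts (aut_equiv htau) // sgX taup.
Qed.

End Newton.

(* Q is the lattice of roots. *)
Lemma newton_lattice x : exists Q : V -> Prop, [/\ Q 0, forall q, Q q -> Q (- q),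
  forall y, Wa y -> fixes (newton x) (ws y) -> exists2 q, Q q & transm (newton x) y q &
  forall v, exists z zeta, [/\ Wa zeta, fixes (newton x) (ws zeta),
     same (newton x) p (act zeta p), transm (newton x) zeta z &
     forall f s psi q, aut f s psi -> fixes (newton x) s -> Q q ->
       eqm (newton x) (v - col_perm s v) q -> eqm (newton x) (z - col_perm s z) q]].
Proof.
have dnu := newton_dir x; have mul := @newton_multi x.
have [k [b [d [rho hb]]]] := nu_base_exists S dnu.
exists (lattice b); split; first exact: lattice0.
- by move=> q; apply: latticeN.
- by move=> y; apply: (weyl_transm S dnu mul hb).
move=> v; have [z lz hz] := lattice_floor S hb v.
have [w Ww hw] := lattice_translation S hb lz.
(* The translation by [z] may move [p] to another region; [u] brings it back and leaves the
   translation part unchanged. *)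
have [u [Wu fu tu su]] := nu_move S dnu (act_E S w Ep) (reg_act S (w := w) Ep rp) Ep rp.
exists z, (u * w)%g; split=> //.
- exact: (WaM S).
- by apply: (fixesM S dnu fu); apply: (translation_perm S hw dnu).
- by rewrite (cs_actM S).
- rewrite -[z]add0r; apply: (transmM S tu) => y Ey.
  by rewrite hw // addrAC subrr add0r.
Qed.

Lemma Wa_sg w : Wa w -> Wa (sg w). Proof. exact: (aut_Wa htau). Qed.

Lemma same_psi nu f s psi w : aut f s psi -> fixes nu s -> dir E nu -> fixes nu (ws w) ->
  same nu p (f p) -> same nu p (act w p) -> same nu p (act (psi w) p).
Proof.
move=> h fs dnu fw sf sw; have Ef := aut_E h Ep.
apply: (same_act S (aut_fixes dnu h fs fw) Ep Ef sf).
rewrite -(aut_equiv h) //; exact: (aut_same S h fs Ep (act_E S w Ep) sw).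
Qed.

(** The defect [y] of Frobenius-invariance of [w] fixes [nu] and keeps [p] in its region, so only
    its translation part [q] matters. Up to [eqm], [q] is [v - col_perm ts v] for a real [v]
    invariant under the linear part of [tw x]. Rounding [v] gives [zeta], commuting with [tw x], and
    [w * zeta] is Frobenius-fixed. *)
Lemma conj_descent x x' w : sg x = x -> chain E act Wa p x ->
  sg x' = x' -> chain E act Wa p x' -> Wa w -> (w * x * (sg w)^-1 = x')%g ->
  exists v, [/\ Wa v, sg v = v & (v * x * v^-1 = x')%g].
Proof.
move=> sx cx sx' cx' Ww ew.
pose nu := newton x; pose nu' := newton x'.
have dnu : dir E nu := newton_dir x; have dnu' : dir E nu' := newton_dir x'.
have fx := newton_tws x; have fx' := newton_tws x'.
have ft : fixes nu ts := newton_ts sx; have ft' : fixes nu' ts := newton_ts sx'.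
have N0 : (N%:R : R) != 0 by rewrite pnatr_eq0 -lt0n fact_gt0.
have intert v : (v * x * (sg v)^-1 = x')%g -> forall y, E y -> act v (tw x y) = tw x' (act v y).
  move=> ev y Ey; have Et := aut_E htau Ey.
  rewrite /tw /= (aut_equiv htau) // -!(cs_actM S) // -ev mulgVK.
  by [].
have nuE v : (v * x * (sg v)^-1 = x')%g -> col_perm (ws v) nu = nu'.
  move=> ev; apply: (scalerI N0); apply: (addrI (act v p)).
  rewrite -[RHS]newton_iter; last exact: (act_E S).
  rewrite -linearZ -(actD S) //; last exact: (dirZ _ aE dnu).
  rewrite -newton_iter //; elim: (N) => //= m IH.
  by rewrite intert // ?IH //; apply: (aut_E (aut_iter m (aut_tw x)) Ep).
have sx1 : same nu p (tw x p).
  by have := newton_same sx cx 1; rewrite expg1 /tw /= taup.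
have sx1' : same nu' p (tw x' p).
  by have := newton_same sx' cx' 1; rewrite expg1 /tw /= taup.
(* After moving by a reflection group element commuting with tw x', w sends the
   region of p for nu to that for nu'. *)
have {Ww ew w} [w [Ww ew sw]] : exists w, [/\ Wa w, (w * x * (sg w)^-1 = x')%g &
    same nu' p (act w p)].
  have Ewp := act_E S w Ep.
  have [u [Wu fu tu su]] := nu_move S dnu' Ewp (reg_act S (w := w) Ep rp) Ep rp.
  (* Both sides carry [act w (tw x p)] to the region of [p], fix [nu'] and have no translation part;
     [nu_rigid] makes them equal. *)
  have eu : twg x' u = u.
    suff : (twg x' u * u^-1 = 1)%g by apply: divg1_eq.
    have Wpu : Wa (twg x' u) by apply: (aut_Wa (aut_tw x')).
    have fpu : fixes nu' (ws (twg x' u)) by apply: (aut_fixes dnu' (aut_tw x')).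
    have Etp := aut_E (aut_tw x) Ep.
    pose q := act u (act w (tw x p)).
    have Ewx := act_E S w Etp; have Eq : E q by apply: (act_E S).
    have Euw := act_E S u Ewp; have Etp' := aut_E (aut_tw x') Ep.
    have pq : same nu' p q.
      apply: (same_trans Ep Euw Eq su).
      have := aut_same_move (aut_act S (u * w)%g) Ep Etp sx1.
      by rewrite (ws_mul S _ _ dnu) nuE // fu !(cs_actM S).
    apply: (nu_rigid S dnu' (q := q)) => //.
    - by apply: (WaM S) => //; apply: (WaV S).
    - by apply: (fixesM S dnu') => //; apply: (fixesV S dnu').
    - apply: (reg_act S) => //; apply: (reg_act S) => //.
      by rewrite /tw /= taup; apply: (reg_act S).
    - have -> : act (twg x' u * u^-1)%g q = tw x' (act u (act w p)).
        by rewrite (cs_actM S) // /q (actK S) // intert // -(aut_equiv (aut_tw x')).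
      apply: (same_trans Eq Ep); first exact: (aut_E (aut_tw x')).
        exact: same_sym.
      apply: (same_trans Ep Etp') => //; first exact: (aut_E (aut_tw x')).
      exact: (aut_same S (aut_tw x') fx' Ep Euw su).
    - have := transmM S (aut_transm S (aut_tw x') fx' tu) (transmV S tu).
      by rewrite linear0 oppr0 addr0.
  exists (u * w)%g; split; [exact: (WaM S)| |by rewrite (cs_actM S)].
  have -> : (u * w * x * (sg (u * w))^-1 = u * (w * x * (sg w)^-1) * (sg u)^-1)%g.
    by rewrite sgM invMg !mulgA.
  by rewrite ew -{1}eu /twg mulgVK mulgK.
have e0 := nuE _ ew.
have [Q [Q0 QN Qy Qz]] := newton_lattice x.
pose y := (w^-1 * sg w)%g.
have Ewp := act_E S w Ep.
have sgw : same nu' p (act (sg w) p).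
  rewrite -{2}taup -(aut_equiv htau) // -{1}taup.
  exact: (aut_same S htau ft' Ep Ewp sw).
have nuV : col_perm (ws w^-1%g) nu' = nu by rewrite (ws_inv S _ dnu') -e0 col_permK.
have sgnu : col_perm (ws (sg w)) nu = nu'.
  apply: (addrI (act (sg w) p)); rewrite -(actD S) //.
  have -> : p + nu = tau (p + nu) by rewrite (aut_D htau) // taup ft.
  rewrite -(aut_equiv htau); last exact: dnu.
  by rewrite (actD S) // e0 (aut_D htau) // ft' (aut_equiv htau) // taup.
have Wy : Wa y by apply: (WaM S); [apply: (WaV S)|apply: Wa_sg].
have fy : fixes nu (ws y) by rewrite /fixes (ws_mul S _ _ dnu) sgnu nuV.
have sy : same nu p (act y p).
  rewrite /y (cs_actM S) // -{1}(actK S w Ep) -nuV.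
  apply: (aut_same_move (aut_act S w^-1%g)) => //; first exact: (act_E S).
  apply: (same_trans Ewp Ep) => //; [exact: (act_E S)|exact: same_sym].
have [q Qq tq] := Qy y Wy fy.
pose e := newton_pt x; pose e' := newton_pt x'.
have Ee : E e by apply: newton_pt_E. have Ee' : E e' by apply: newton_pt_E.
pose v := act w^-1%g e' - e.
have EwV := act_E S w^-1%g Ee'.
have dv : dir E v by apply: dirB.
have ev : act w^-1%g e' = e + v by rewrite /v addrC subrK.
(* As [e] and [e'] are Frobenius-fixed, [y] sends [e + col_perm ts v] to [e + v]. *)
have vts : eqm nu (v - col_perm ts v) q.
  have etv : tau (act w^-1%g e') = e + col_perm ts v.
    by rewrite ev (aut_D htau) // newton_pt_tau.
  have ey : act y (tau (act w^-1%g e')) = act w^-1%g e'.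
    rewrite /y (cs_actM S); last exact: (aut_E htau).
    by rewrite -(aut_equiv htau) // (actKV S) // newton_pt_tau.
  have := tq _ (aut_E htau EwV); rewrite ey etv ev.
  by rewrite opprD addrACA subrr add0r.
(* [tw x] moves both [e] and [act w^-1%g e'] by [nu], the second because [act w] carries [tw x] to
   [tw x']. *)
have vx : col_perm (tws x) v = v.
  apply: (addrI (tw x e)); rewrite -(aut_D (aut_tw x)) // -ev.
  rewrite newton_pt_tw // -/nu addrAC -ev -[in RHS]nuV -(actD S) // /nu' -newton_pt_tw //.
  rewrite -[LHS](actK S w); last exact: (aut_E (aut_tw x)).
  by rewrite intert // (actKV S).
have [z [zeta [Wz fz sz tz hz]]] := Qz v.
have hz1 := hz _ _ _ _ htau ft Qq vts.
have hz2 : eqm nu (z - col_perm (tws x) z) 0.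
  by apply: (hz _ _ _ _ (aut_tw x) fx Q0); rewrite vx subrr.
have fsz : fixes nu (ws (sg zeta)) by apply: (aut_fixes dnu htau).
have ssz : same nu p (act (sg zeta) p).
  by apply: (same_psi htau) => //; rewrite taup; apply: (same_refl Ep rp).
have fVz := fixesV S dnu fz.
have y1 : (zeta^-1 * (y * sg zeta) = 1)%g.
  apply: (nu_rigid S dnu _ _ Ep rp).
  - by apply: (WaM S); [apply: (WaV S)|apply: (WaM S) => //; apply: Wa_sg].
  - by apply: (fixesM S dnu) => //; apply: (fixesM S dnu).
  - apply: same_mul => //; first exact: same_inv.
    exact: same_mul.
  - apply: (transm_eqm (transmM S (transmV S tz) (transmM S tq (aut_transm S htau ft tz)))).
    by move=> c hc; have := hz1 c hc; rewrite !dotE !dot0l; lra.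
have x1 : (twg x zeta * zeta^-1 = 1)%g.
  have fpz : fixes nu (ws (twg x zeta)) by apply: (aut_fixes dnu (aut_tw x)).
  apply: (nu_rigid S dnu _ _ Ep rp).
  - by apply: (WaM S); [apply: (aut_Wa (aut_tw x))|apply: (WaV S)].
  - exact: (fixesM S dnu).
  - apply: same_mul => //; last exact: same_inv.
    exact: (same_psi (aut_tw x)).
  - apply: (transm_eqm (transmM S (aut_transm S (aut_tw x) fx tz) (transmV S tz))).
    by rewrite -opprB -oppr0; apply: eqmN.
have xz : (x * sg zeta * x^-1 = zeta)%g by apply: divg1_eq.
have sv : sg (w * zeta)%g = (w * zeta)%g.
  rewrite sgM -[sg w](mulKVg w) -/y -mulgA; congr (_ * _)%g.
  by rewrite -[(y * _)%g](mulKVg zeta) y1 mulg1.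
exists (w * zeta)%g; split=> //; first exact: (WaM S).
have exz : (zeta * x = x * sg zeta)%g by rewrite -{1}xz mulgVK.
by rewrite -{2}sv sgM invMg -ew !mulgA -(mulgA w zeta x) exz !mulgA mulgK.
Qed.

Hypothesis Wab : forall a b, Wa (a * b * a^-1 * b^-1)%g.

(** It suffices to find [h] with [twg x h = h] and [g * h^-1] in [Wa]. For [h0], the translation [t]
    corrected to keep [p] in its region, the defect [y] lies in [Wa] and has translation part
    [col_perm (tws x) d - d]. Rounding [d] to a lattice vector gives [zeta] in [Wa] with the same
    defect, whence [h]. *)
Lemma conj_orbit x g a t d : sg x = x -> chain E act Wa p x -> sg g = g ->
  Wa a -> g = (a * t)%g -> (forall y, E y -> act t y = y + d) ->
  exists2 w, Wa w & (w * x * (sg w)^-1 = g * x * g^-1)%g.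
Proof.
move=> sx cx gg Wa_a eg ht.
pose nu := newton x; have dnu : dir E nu := newton_dir x; have fx := newton_tws x.
have sx1 : same nu p (tw x p).
  by have := newton_same sx cx 1; rewrite expg1 /tw /= taup.
have [u [Wu fu tu su]] := nu_move S dnu (act_E S t Ep) (reg_act S (w := t) Ep rp) Ep rp.
have [Q [Q0 QN Qy Qz]] := newton_lattice x.
pose h0 := (u * t)%g.
have fh : fixes nu (ws h0).
  by apply: (fixesM S dnu) => //; apply: (translation_perm S ht dnu).
have th : transm nu h0 d.
  rewrite -[d]add0r; apply: (transmM S tu) => y Ey.
  by rewrite ht // addrAC subrr add0r.
have sh : same nu p (act h0 p) by rewrite (cs_actM S).
have fph : fixes nu (ws (twg x h0)) by apply: (aut_fixes dnu (aut_tw x)).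
have fVh := fixesV S dnu fh.
pose y := (twg x h0 * h0^-1)%g.
(* Modulo [Wa], [sg h0] is [t] because [g] is Frobenius-fixed, and [x] commutes with [t] by
   [Wab]. *)
have Wy : Wa y.
  pose b := (sg u * (sg a)^-1 * a)%g.
  have Wb : Wa b by do 2?[apply: (WaM S)] => //; [apply: Wa_sg|apply: (WaV S); apply: Wa_sg].
  have et : sg h0 = (b * t)%g.
    rewrite /h0 sgM /b -!mulgA; congr (_ * _)%g.
    by rewrite -eg -[in RHS]gg eg sgM mulKg.
  have -> : y = ((x * b * x^-1) * (x * t * x^-1 * t^-1) * u^-1)%g.
    by rewrite /y /twg et /h0 invMg !mulgA mulgVK.
  apply: (WaM S); last exact: (WaV S).
  by apply: (WaM S) => //; apply: (WaJ S).
have fy : fixes nu (ws y) by apply: (fixesM S dnu).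
have sy : same nu p (act y p).
  apply: same_mul => //; last exact: same_inv.
  exact: (same_psi (aut_tw x)).
have [q Qq tq] := Qy y Wy fy.
have ty := transmM S (aut_transm S (aut_tw x) fx th) (transmV S th).
have dq : eqm nu (d - col_perm (tws x) d) (- q).
  by rewrite -opprB; apply: eqmN; apply: (eqm_trans (eqm_sym (ty _ Ep))); apply: tq.
have [z [zeta [Wz fz sz tz hz]]] := Qz d.
have hz1 := hz _ _ _ _ (aut_tw x) fx (QN _ Qq) dq.
have fpz : fixes nu (ws (twg x zeta)) by apply: (aut_fixes dnu (aut_tw x)).
have spz : same nu p (act (twg x zeta) p) by apply: (same_psi (aut_tw x)).
pose h := (zeta^-1 * h0)%g.
have y1 : ((twg x zeta)^-1 * (y * zeta) = 1)%g.
  apply: (nu_rigid S dnu _ _ Ep rp).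
  - apply: (WaM S); last exact: (WaM S).
    by apply: (WaV S); apply: (aut_Wa (aut_tw x)).
  - by apply: (fixesM S dnu); [apply: (fixesV S dnu)|apply: (fixesM S dnu)].
  - apply: same_mul; [exact: (fixesV S dnu)|exact: same_inv|exact: same_mul].
  - apply: (transm_eqm (transmM S (transmV S (aut_transm S (aut_tw x) fx tz)) (transmM S tq tz))).
    by move=> c hc; have := hz1 c hc; rewrite !dotE !dot0l; lra.
have hh : twg x h = h.
  rewrite /h twgM twgV; have -> : twg x h0 = (y * h0)%g by rewrite /y mulgVK.
  have -> : y = (twg x zeta * zeta^-1)%g.
    by rewrite -[y](mulgK zeta) -[(y * zeta)%g](mulKVg (twg x zeta)) y1 mulg1.
  by rewrite -(mulgA _ _ h0) mulKg.
exists (g * h^-1)%g.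
  have -> : (g * h^-1 = a * (u^-1 * zeta))%g.
    by rewrite eg /h /h0 !invMg invgK !mulgA mulgK.
  by apply: (WaM S) => //; apply: (WaM S) => //; apply: (WaV S).
have eh : (x * sg h = h * x)%g by rewrite -{2}hh /twg mulgVK.
have -> : ((sg (g * h^-1))^-1 = sg h * g^-1)%g.
  by rewrite sgM sgV gg (invMg g) invgK.
by rewrite mulgA -(mulgA _ x (sg h)) eh mulgA mulgVK.
Qed.

End Twisted.

Lemma meval_rmorph (m : nat) (k A B : comNzRingType) (f : {rmorphism k -> A})
  (g : {rmorphism A -> B}) (q : {mpoly k[m]}) (v : 'I_m -> A) :
  meval (g \o v) (map_mpoly (g \o f) q) = g (meval v (map_mpoly f q)).
Proof.
rewrite [q]mpolyE (raddf_sum (map_mpoly (g \o f))) (raddf_sum (map_mpoly f)).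
rewrite (raddf_sum (meval (g \o v))) (raddf_sum (meval v)) (raddf_sum g).
apply: eq_bigr => c _ /=.
rewrite !map_mpolyZ !map_mpolyX !mevalZ !mevalX rmorphM rmorph_prod.
by congr (_ * _); apply: eq_bigr => i _; rewrite rmorphXn.
Qed.

(** * The Frobenius on the group and on the apartment *)

Section TwistedEvaluation.
Variables (L : fieldType) (K : closedFieldType) (iota : {rmorphism L -> K}).
Variable s : {rmorphism L -> L}.
Hypothesis s_bij : bijective s.
Hypothesis char0 : has_pchar0 L.
Hypothesis alg : forall z : K, algebraicOver iota z.

Lemma primitive_seq (zs : seq K) : exists th : K, forall z, z \in zs ->
  exists q : {poly L}, (map_poly iota q).[th] = z.
Proof.
elim: zs => [|z zs [th IH]]; first by exists 0.
have [q nzq rq] := alg z; have [r nzr rr] := alg th.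
have [m [[q1 h1] [q2 h2]]] := pchar0_PET nzr rr nzq rq char0.
exists (z *+ m - th) => z'; rewrite inE => /orP[/eqP->|/IH[q' <-]]; first by exists q2.
by exists (q' \Po q1); rewrite map_comp_poly horner_comp h1.
Qed.

Lemma minimal_poly (th : K) : exists mu : {poly L}, [/\ mu != 0, poly.root (map_poly iota mu) th &
  forall q, q != 0 -> poly.root (map_poly iota q) th -> (size mu <= size q)%N].
Proof.
have ex : exists k, `[< exists q : {poly L}, [/\ q != 0, poly.root (map_poly iota q) th & size q = k] >].
  by have [q nzq rq] := alg th; exists (size q); apply/asboolP; exists q.
have [k /asboolP[mu [nzmu rmu smu]] hk] := ex_minnP ex.
exists mu; split=> // q nzq rq; rewrite smu; apply: hk; apply/asboolP; by exists q.
Qed.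

(* An isomorphism L(th) -> L(th') extending s, on the level of the evaluation
   maps from L[X]. *)
Lemma twisted_evals (zs : seq K) : exists ev ev' : {rmorphism {poly L} -> K},
  [/\ forall c, ev c%:P = iota c, forall c, ev' c%:P = iota (s c),
      forall q, (ev q == 0) = (ev' q == 0) & forall z, z \in zs -> exists q, ev' q = z].
Proof.
have [th' gen] := primitive_seq zs; have [mu [nzmu rmu min]] := minimal_poly th'.
have [g sg gs] := s_bij.
have g0 : g 0 = 0 by rewrite -{1}(rmorph0 s) sg.
have lift (q : {poly L}) : exists q0, map_poly s q0 = q.
  exists (\poly_(i < size q) g q`_i); apply/polyP => i; rewrite coef_map coef_poly.
  by have [h|h] := ltnP i (size q); [apply: gs|rewrite raddf0 nth_default].
have [mu0 emu] := lift mu.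
have size_s q : size (map_poly s q) = size q by rewrite size_map_poly.
have nz0 : mu0 != 0 by rewrite -(map_poly_eq0 s) emu.
have [th rth] : exists th, poly.root (map_poly iota mu0) th.
  apply/closed_rootP; rewrite size_map_poly -size_s emu; apply/negP => /eqP s1.
  have /size_poly1P [c c0 ec] : size mu == 1%N by rewrite s1.
  by move: rmu; rewrite ec map_polyC rootC fmorph_eq0 (negPf c0).
pose ev := horner_eval th \o map_poly iota.
pose ev' := horner_eval th' \o (map_poly iota \o map_poly s).
exists ev, ev'; split.
- by move=> c; rewrite /ev /= /horner_eval map_polyC hornerC.
- by move=> c; rewrite /ev' /= /horner_eval !map_polyC hornerC.
- move=> q; rewrite /ev /ev' /= /horner_eval; apply/idP/idP => [rq|rq].
    suff : mu0 %| q.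
      rewrite -(dvdp_map s) emu => /dvdpP [r ->].
      by rewrite rmorphM hornerM (eqP (rmu : _ == 0)) mulr0.
    (* [s] turns [mu0] into a minimal polynomial, so the nonconstant factor [d] is associate to
       [mu0]. *)
    pose d := gcdp mu0 q.
    have rd : poly.root (map_poly iota d) th by rewrite gcdp_map root_gcd rth.
    have nzd : d != 0 by rewrite gcdp_eq0 negb_and nz0.
    have sd : (1 < size d)%N.
      by rewrite -(size_map_poly iota); apply: (root_size_gt1 (a := th)); rewrite // map_poly_eq0.
    have /dvdpP [h eh] : map_poly s d %| mu by rewrite -emu dvdp_map dvdp_gcdl.
    have := rmu; rewrite eh rmorphM rootM => /orP[rh|rd'].
      have nzh : h != 0 by apply: contraNneq nzmu => h0; rewrite eh h0 mul0r.
      have := min _ nzh rh; rewrite eh size_mul ?map_poly_eq0 // size_s.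
      by rewrite -subn1 -addnBA ?(ltnW sd) // -[X in (_ <= X)%N -> _]addn0 leq_add2l leqn0 subn_eq0 leqNgt sd.
    have sdm : (size mu0 <= size d)%N.
      by rewrite -size_s emu -(size_s d); apply: min => //; rewrite map_poly_eq0.
    have : d %= mu0.
      by rewrite -(dvdp_size_eqp (dvdp_gcdl _ _)) eqn_leq sdm dvdp_leq // dvdp_gcdl.
    by move=> /eqp_dvdl <-; apply: dvdp_gcdr.
  have : mu %| map_poly s q.
    apply/modp_eq0P/eqP/negPn/negP => nzr.
    have rr : poly.root (map_poly iota (map_poly s q %% mu)) th'.
      rewrite /poly.root; move: rq; rewrite {1}(divp_eq (map_poly s q) mu) rmorphD rmorphM.
      by rewrite hornerD hornerM (eqP (rmu : _ == 0)) mulr0 add0r.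
    by have := min _ nzr rr; rewrite leqNgt ltn_modp nzmu.
  rewrite -emu dvdp_map => /dvdpP [r ->].
  by rewrite rmorphM hornerM (eqP (rth : _ == 0)) mulr0.
move=> z /gen [q <-]; have [q0 <-] := lift q.
by exists q0.
Qed.

End TwistedEvaluation.

Lemma unit_perm (k : fieldType) (n : nat) (P : 'M[k]_n) : P \in unitmx ->
  exists s : 'S_n, forall i, P i (s i) != 0.
Proof.
rewrite unitmxE unitfE => h; apply: contrapT => no; case/eqP: h.
rewrite /determinant big1 // => s _.
have [i hi] : exists i, P i (s i) = 0.
  by apply: contrapT => ni; apply: no; exists s => i; apply/eqP => e; apply: ni; exists i.
by rewrite (bigD1 i) //= hi mul0r mulr0.
Qed.

(** * Frobenius and closed sets defined over [F] *)

Section Forms.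
Variables (D : padic_datum) (B : group_datum D).
Local Notation n := (gdim B).
Local Notation L := (pL D).
Local Notation K := (pK D).
Local Notation sigma := (sig D).
Local Notation iota := (iLK D).
Local Notation defF := (defined_over (iLK D \o iFL D)).
Implicit Types (g h s t u : 'M[L]_n) (X G : set 'M[K]_n).
Local Notation frob := (@frob D B).
Local Notation ptsL := (@ptsL D B).

Lemma char0_L : [pchar (pL D)] =i pred0.
Proof.
move=> q; rewrite -(pF_char D) !inE; congr (_ && _).
by rewrite -(rmorph_nat (iFL D)) fmorph_eq0.
Qed.

(** The evaluations have the same kernel and agree on constants from [F], which [sigma] fixes; so
    both points satisfy the same equations over [F]. *)
Lemma evals_defined X (ev ev' : {rmorphism {poly L} -> K}) (M : 'M[{poly L}]_n) :
  (forall c, ev c%:P = iota c) -> (forall c, ev' c%:P = iota (sigma c)) ->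
  (forall q, (ev q == 0) = (ev' q == 0)) -> defF X ->
  X (map_mx ev M) <-> X (map_mx ev' M).
Proof.
move=> e1 e2 e3 [I ->].
pose f : {rmorphism pF D -> {poly L}} := polyC \o iFL D.
have uE (e : {rmorphism {poly L} -> K}) : (map_mx e M \in unitmx) = (e (\det M) != 0).
  by rewrite unitmxE det_map_mx unitfE.
have pE (e : {rmorphism {poly L} -> K}) (q : {mpoly (pF D)[n * n]}) :
    (forall c, e (iFL D c)%:P = iota (iFL D c)) ->
    meval (fun i => mxvec (map_mx e M) 0 i) (map_mpoly (iota \o iFL D) q) =
    e (meval (fun i => mxvec M 0 i) (map_mpoly f q)).
  move=> he; rewrite -meval_rmorph.
  have -> : (e \o f : pF D -> K) = iota \o iFL D by apply: funext => c /=.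
  by apply: meval_eq => i /=; rewrite -map_mxvec mxE.
split=> -[u h]; (split; first by move: u; rewrite !uE e3).
  move=> q Iq; apply/eqP; rewrite pE; last by move=> c; rewrite e2 sig_F.
  by rewrite -e3 -pE ?h.
move=> q Iq; apply/eqP; rewrite pE // e3 -pE ?h //.
by move=> c; rewrite e2 sig_F.
Qed.

Lemma twist_point (x : 'M[K]_n) : exists (ev ev' : {rmorphism {poly L} -> K}) (M : 'M[{poly L}]_n),
  [/\ forall c, ev c%:P = iota c, forall c, ev' c%:P = iota (sigma c),
      forall q, (ev q == 0) = (ev' q == 0) & map_mx ev' M = x].
Proof.
have [ev [ev' [e1 e2 e3 e4]]] := twisted_evals (sig_bij D) char0_L (@pK_algebraic D)
  [seq x ij.1 ij.2 | ij <- enum {: 'I_n * 'I_n}].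
have hx i j : exists q, ev' q = x i j.
  by apply: e4; apply/mapP; exists (i, j); rewrite ?mem_enum.
exists ev, ev', (\matrix_(i, j) projT1 (cid (hx i j))); split=> //.
by apply/matrixP => i j; rewrite !mxE; apply: projT2 (cid (hx i j)).
Qed.

Lemma evals_const (ev : {rmorphism {poly L} -> K}) (f : L -> K) g :
  (forall c, ev c%:P = f c) -> map_mx ev (map_mx polyC g) = map_mx f g.
Proof. by move=> e; apply/matrixP => i j; rewrite !mxE e. Qed.

Lemma map_frob g : map_mx iota (frob g) = map_mx (iota \o sigma) g.
Proof. by apply/matrixP => i j; rewrite !mxE. Qed.

Lemma ptsL_frob X g : defF X -> ptsL X (frob g) <-> ptsL X g.
Proof.
move=> dX; have [ev [ev' [_ [e1 e2 e3 _]]]] := twist_point 0.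
rewrite /Defs.ptsL /= map_frob -(evals_const _ e1) -(evals_const (f := iota \o sigma) _ e2).
by split=> /(evals_defined _ e1 e2 e3 dX).
Qed.

Lemma ptsL_unit G g : mx_subgroup G -> ptsL G g -> g \in unitmx.
Proof. by move=> [h _ _ _] /h /=; rewrite map_unitmx. Qed.

Lemma ptsL_mul G g h : mx_subgroup G -> ptsL G g -> ptsL G h -> ptsL G (g *m h).
Proof. by move=> [_ _ hM _]; rewrite /Defs.ptsL /= map_mxM; apply: hM. Qed.

Lemma mx_conjM (k : fieldType) (m : nat) (a b x : 'M[k]_m) :
  a \in unitmx -> b \in unitmx -> mx_conj (a *m b) x = mx_conj a (mx_conj b x).
Proof.
move=> ua ub; rewrite /mx_conj; have -> : invmx (a *m b) = invmx b *m invmx a.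
  rewrite -[RHS]mul1mx -(mulVmx (_ : a *m b \in unitmx)) ?unitmx_mul ?ua //.
  by rewrite -!mulmxA (mulmxA b) mulmxV // mul1mx mulmxV // mulmx1.
by rewrite !mulmxA.
Qed.

Lemma mx_conjK (k : fieldType) (m : nat) (a x : 'M[k]_m) :
  a \in unitmx -> mx_conj (invmx a) (mx_conj a x) = x.
Proof. by move=> ua; rewrite /mx_conj invmxK !mulmxA mulVmx // mul1mx mulmxKV. Qed.

Lemma mx_conjKV (k : fieldType) (m : nat) (a x : 'M[k]_m) :
  a \in unitmx -> mx_conj a (mx_conj (invmx a) x) = x.
Proof. by move=> ua; rewrite /mx_conj invmxK !mulmxA mulmxV // mul1mx mulmxK. Qed.

Lemma map_mx_conj (k k' : fieldType) (f : {rmorphism k -> k'}) (m : nat) (a x : 'M[k]_m) :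
  map_mx f (mx_conj a x) = mx_conj (map_mx f a) (map_mx f x).
Proof. by rewrite /mx_conj !map_mxM map_invmx. Qed.

Lemma frob_conj a x : frob (mx_conj a x) = mx_conj (frob a) (frob x).
Proof. exact: map_mx_conj. Qed.

Lemma frobM a b : frob (a *m b) = frob a *m frob b.
Proof. exact: map_mxM. Qed.

Lemma frob_unit a : (frob a \in unitmx) = (a \in unitmx).
Proof. exact: map_unitmx. Qed.

Lemma frob_inv a : frob (invmx a) = invmx (frob a).
Proof. exact: map_invmx. Qed.

(** The condition bears on all points of [X] over [K], where no Frobenius is given. A point is
    written [map_mx ev' M], and [map_mx ev M] serves as its inverse Frobenius image. *)
Lemma normalizer_frob G X g : mx_subgroup G -> defF G -> defF X ->
  ptsL (normalizer G X) g -> ptsL (normalizer G X) (frob g).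
Proof.
move=> sG dG dX [Gg nX]; have ug := ptsL_unit sG Gg.
split; first exact/(ptsL_frob g dG).
have evc (ev : {rmorphism {poly L} -> K}) (f : {rmorphism L -> K}) (M : 'M[{poly L}]_n) a :
    (forall c, ev c%:P = f c) ->
    map_mx ev (map_mx polyC a *m M *m map_mx polyC (invmx a)) = mx_conj (map_mx f a) (map_mx ev M).
  by move=> e; rewrite /mx_conj !map_mxM -map_invmx !(evals_const (f := f) _ e).
pose sf : {rmorphism L -> K} := iota \o sigma.
have ugK : map_mx iota g \in unitmx by rewrite map_unitmx.
have usK : map_mx sf g \in unitmx by rewrite map_unitmx.
rewrite map_frob; apply/seteqP; split=> [_ [x Xx <-]|x Xx].
  have [ev [ev' [M [e1 e2 e3 ex]]]] := twist_point x.
  have XM : X (map_mx ev M) by apply/(evals_defined _ e1 e2 e3 dX); rewrite ex.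
  rewrite -ex -(evc _ sf _ _ e2); apply/(evals_defined _ e1 e2 e3 dX).
  by rewrite (evc _ iota _ _ e1) -nX; exists (map_mx ev M).
have [ev [ev' [M [e1 e2 e3 ex]]]] := twist_point x.
have XM : X (map_mx ev M) by apply/(evals_defined _ e1 e2 e3 dX); rewrite ex.
have [y Xy ey] : [set mx_conj (map_mx iota g) y | y in X] (map_mx ev M) by rewrite nX.
exists (mx_conj (invmx (map_mx sf g)) x); last exact: mx_conjKV.
rewrite -ex -map_invmx -(evc _ sf _ _ e2); apply/(evals_defined _ e1 e2 e3 dX).
by rewrite (evc _ iota _ _ e1) map_invmx -ey mx_conjK.
Qed.

Lemma normalizer_mul G X g h : mx_subgroup G -> ptsL (normalizer G X) g ->
  ptsL (normalizer G X) h -> ptsL (normalizer G X) (g *m h).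
Proof.
move=> sG [Gg nXg] [Gh nXh]; split; first exact: ptsL_mul.
have ug : map_mx iota g \in unitmx by rewrite map_unitmx; apply: ptsL_unit Gg.
have uh : map_mx iota h \in unitmx by rewrite map_unitmx; apply: ptsL_unit Gh.
rewrite map_mxM; apply/seteqP; split=> [_ [x Xx <-]|x].
  rewrite mx_conjM // -nXg; eexists; last by [].
  by rewrite -nXh; exists x.
rewrite -{1}nXg => -[y + <-]; rewrite -{1}nXh => -[z Xz <-].
by exists z => //; rewrite mx_conjM.
Qed.

End Forms.

(** * Frobenius on weights, root subgroups and parahoric subgroups *)

Section Weights.
Variables (D : padic_datum) (B : group_datum D).
Local Notation n := (gdim B).
Local Notation L := (pL D).
Local Notation K := (pK D).
Local Notation sigma := (sig D).
Local Notation iota := (iLK D).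
Local Notation hd := (gdiag B).
Local Notation NS := (ptsL (gNS B)).
Local Notation SL := (ptsL (gS B)).
Implicit Types (g h s t u : 'M[L]_n).

Lemma gG_group : mx_subgroup (gG B).
Proof. by have [] := gG_reductive B. Qed.

Lemma gG_def : defined_over (iLK D \o iFL D) (gG B).
Proof. by have [] := gG_reductive B. Qed.

Lemma hd_unit : hd \in unitmx.
Proof. by have [] := gdiagP B. Qed.

Lemma NS_frob g : NS g -> NS (frob g).
Proof. exact: (normalizer_frob gG_group gG_def (gS_def B)). Qed.

Lemma NS_mul g h : NS g -> NS h -> NS (g *m h).
Proof. exact: (normalizer_mul gG_group). Qed.

Lemma NS_unit g : NS g -> g \in unitmx.
Proof. by move=> [Gg _]; apply: (ptsL_unit gG_group Gg). Qed.

Lemma T_NS t : ptsL (gT B) t -> NS t.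
Proof.
move=> [Gt cS]; split=> //; apply/seteqP; split=> [_ [x Sx <-]|x Sx]; first by rewrite cS.
by exists x => //; rewrite cS.
Qed.

Lemma SL_frob s : SL s -> SL (frob s).
Proof. by move=> h; apply/(ptsL_frob _ (gS_def B)). Qed.

Lemma SL_frob_onto s : SL s -> exists2 s0, SL s0 & frob s0 = s.
Proof.
move=> hs; have [f sf fs] := sig_bij D.
have e : frob (map_mx f s) = s by apply/matrixP => i j; rewrite !mxE; apply: fs.
by exists (map_mx f s) => //; apply/(ptsL_frob _ (gS_def B)); rewrite e.
Qed.

Lemma NS_conj g s : NS g -> SL s -> SL (mx_conj g s).
Proof.
move=> [_ nS] hs; rewrite /ptsL /= map_mx_conj -nS; by exists (map_mx iota s).
Qed.

Lemma wt_diag s i j : SL s -> mx_conj hd s i j = (wt s i) *+ (i == j).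
Proof.
move=> hs; have [_ /(_ _ hs)] := gdiagP B; rewrite -map_mx_conj.
move=> /is_diag_mxP h; have [->|ij] := eqVneq i j; first by rewrite mulr1n.
by have := h i j ij; rewrite mxE mulr0n => /eqP; rewrite fmorph_eq0 => /eqP.
Qed.

Lemma intertwine_entry (P U V : 'M[L]_n) (a b : 'I_n -> L) i j :
  (forall i j, U i j = a i *+ (i == j)) -> (forall i j, V i j = b i *+ (i == j)) ->
  P *m U = V *m P -> P i j != 0 -> a j = b i.
Proof.
move=> hU hV /matrixP /(_ i j); rewrite !mxE (bigD1 j) //= big1; last first.
  by move=> k kj; rewrite hU (negPf kj) mulr0.
rewrite [RHS](bigD1 i) //= big1; last by move=> k ki; rewrite hV eq_sym (negPf ki) mul0r.
rewrite hU hV !eqxx !mulr1n !addr0 mulrC => e P0; exact: (mulIf P0).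
Qed.

(** In the coordinates of [gdiag], [g] intertwines two diagonal matrices, so a nonzero entry matches
    two weights; invertibility yields a permutation of nonzero entries. *)
Lemma NS_perm g : NS g -> exists s : 'S_n, forall i,
  forall x, SL x -> wt x (s i) = wt (mx_conj g x) i.
Proof.
move=> Ng; have ug := NS_unit Ng; have uh := hd_unit.
pose P := mx_conj hd g.
have uP : P \in unitmx by rewrite !unitmx_mul uh ug unitmx_inv uh.
have [s hs] := unit_perm uP; exists s => i x Sx.
apply: (intertwine_entry (P := P) (U := mx_conj hd x) (V := mx_conj hd (mx_conj g x))) (hs i).
- by move=> j k; apply: wt_diag.
- by move=> j k; apply: wt_diag; apply: NS_conj.
- by rewrite /P /mx_conj !mulmxA !mulmxKV.
Qed.

(** [gdiag] is not assumed to be defined over [F]; this matrix compares it with its Frobenius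
    conjugate, and its nonzero entries match weights with their twists. *)
Definition fmx : 'M[L]_n := hd *m invmx (frob hd).

Lemma fmx_unit : fmx \in unitmx.
Proof. by rewrite unitmx_mul hd_unit unitmx_inv frob_unit hd_unit. Qed.

Lemma fmx_conj u : mx_conj hd (frob u) = fmx *m frob (mx_conj hd u) *m invmx fmx.
Proof.
have uf : frob hd \in unitmx by rewrite frob_unit hd_unit.
have -> : hd = fmx *m frob hd by rewrite /fmx mulmxKV.
rewrite [in RHS](_ : fmx *m frob hd = hd); last by rewrite /fmx mulmxKV.
by rewrite mx_conjM ?fmx_unit // frob_conj.
Qed.

Lemma frob_wt_diag s i j : SL s -> frob (mx_conj hd s) i j = (sigma (wt s i)) *+ (i == j).
Proof. by move=> hs; rewrite mxE wt_diag // rmorphMn. Qed.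

Lemma fmx_wt i j : fmx i j != 0 -> forall s, SL s -> sigma (wt s j) = wt (frob s) i.
Proof.
move=> h s Ss; apply: (intertwine_entry (a := fun k => sigma (wt s k)) (b := wt (frob s))
  (P := fmx) (U := frob (mx_conj hd s)) (V := mx_conj hd (frob s))) h.
- by move=> a b; apply: frob_wt_diag.
- by move=> a b; apply: wt_diag; apply: SL_frob.
- by rewrite fmx_conj mulmxKV // fmx_unit.
Qed.

Lemma fmx_wtV i j : invmx fmx i j != 0 -> forall s, SL s -> sigma (wt s i) = wt (frob s) j.
Proof.
move=> h s Ss; symmetry.
apply: (intertwine_entry (a := wt (frob s)) (b := fun k => sigma (wt s k))
  (P := invmx fmx) (U := mx_conj hd (frob s)) (V := frob (mx_conj hd s))) h.
- by move=> a b; apply: wt_diag; apply: SL_frob.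
- by move=> a b; apply: frob_wt_diag.
- by rewrite fmx_conj -(mulmxA fmx) mulKmx ?fmx_unit.
Qed.

Definition fperm : 'S_n := projT1 (cid (unit_perm fmx_unit)).

Lemma fperm_wt i s : SL s -> sigma (wt s (fperm i)) = wt (frob s) i.
Proof. by apply: fmx_wt; exact: (projT2 (cid (unit_perm fmx_unit)) i). Qed.

Lemma chr_frob c s : SL s -> chr (fun i => c (fperm i)) (frob s) = sigma (chr c s).
Proof.
move=> Ss; rewrite /chr rmorph_prod [RHS](reindex_inj (@perm_inj _ fperm)) /=.
by apply: eq_bigr => i _; rewrite -fperm_wt // fmorphXz.
Qed.

(** A nonzero entry of the twist of [u - 1] comes from a nonzero entry at some [a], [b], framed by
    nonzero entries of [fmx] and its inverse, which transport the weights. *)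
Lemma root_group_frob c u : root_group c u -> root_group (fun i => c (fperm i)) (frob u).
Proof.
move=> [Gu h]; split; first exact/(ptsL_frob _ gG_def).
move=> j l; rewrite fmx_conj => nz.
have e : fmx *m frob (mx_conj hd u) *m invmx fmx =
    fmx *m (frob (mx_conj hd u) - 1%:M) *m invmx fmx + 1%:M.
  by rewrite mulmxBr mulmxBl mulmx1 mulmxV ?fmx_unit // subrK.
have {nz} : (fmx *m (frob (mx_conj hd u) - 1%:M) *m invmx fmx) j l != 0.
  move: nz; rewrite e mxE [X in _ + X]mxE; apply: contraNneq => ->.
  by rewrite add0r.
rewrite mxE => nz; have [b hb] : exists b, (fmx *m (frob (mx_conj hd u) - 1%:M)) j b * invmx fmx b l != 0.
  apply: contrapT => no; move/eqP: nz; apply; apply: big1 => b _.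
  by apply/eqP/negPn/negP => nb; apply: no; exists b.
move: hb; rewrite mulf_eq0 negb_or mxE => /andP[ha Qbl].
have [a hab] : exists a, fmx j a * (frob (mx_conj hd u) - 1%:M) a b != 0.
  apply: contrapT => no; move/eqP: ha; apply; apply: big1 => a _.
  by apply/eqP/negPn/negP => na; apply: no; exists a.
move: hab; rewrite mulf_eq0 negb_or => /andP[Qja].
have -> : (frob (mx_conj hd u) - 1%:M) a b = sigma (mx_conj hd u a b) - (a == b)%:R.
  by move: (mx_conj hd u) => X; rewrite !mxE.
rewrite -(rmorph_nat sigma) -rmorphB fmorph_eq0 subr_eq0 => hab.
have [m m0 hm] := h a b hab.
exists m => // s' /SL_frob_onto [s Ss <-].
rewrite -(fmx_wt Qja Ss) -(fmx_wtV Qbl Ss) -fmorph_div hm //.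
by rewrite chr_frob // rmorphXn.
Qed.

Section Apartment.
Variable R : realType.
Variable I : breve_datum B R.
Local Notation V := 'rV[R]_n.
Local Notation pi := (bpi I).
Local Notation act := (bact I).
Local Notation sA := (bsA I).
Local Notation sW := (bsig I).
Local Notation ap := (apt B R).
Local Notation TP := (torus_parahoric B).

Lemma apt_affine : affine_set ap.
Proof.
move=> x y z a hx hy hz c hc; rewrite /pairing.
have := hx c hc; have := hy c hc; have := hz c hc; rewrite /pairing => ez ey ex.
have -> : \sum_i (c i)%:~R * (x + a *: (y - z)) 0 i =
    (\sum_i (c i)%:~R * x 0 i) + a * ((\sum_i (c i)%:~R * y 0 i) - \sum_i (c i)%:~R * z 0 i).
  rewrite -sumrB mulr_sumr -big_split; apply: eq_bigr => i _.
  by rewrite !mxE /=; ring.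
by rewrite ex ey ez; ring.
Qed.

Lemma pi_onto w : exists2 g, NS g & pi g = w.
Proof. by have [_ h _ _] := bpiP I; apply: h. Qed.

Lemma pi_mul g h : NS g -> NS h -> pi (g *m h) = (pi g * pi h)%g.
Proof. by have [h1 _ _ _] := bpiP I; apply: h1. Qed.

Lemma act_paff w : exists s : 'S_n, paff ap (act w) s.
Proof.
have [g Ng <-] := pi_onto w; have [s hs] := NS_perm Ng; exists s.
have [h1 _ _ h4 _] := bactP I; split=> [x|x y hx hy]; first exact: h1.
apply/rowP => i; have := h4 g i (s i) Ng (hs i) x y hx hy.
by rewrite !mxE.
Qed.

Lemma sA_paff : paff ap sA fperm.
Proof.
have [h1 h2 _] := bsAP I; split=> // x y hx hy; apply/rowP => i.
have := h2 i (fperm i) (fun s Ss => fperm_wt i Ss) x y hx hy.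
by rewrite !mxE.
Qed.

Lemma sW_mul w w' : sW (w * w')%g = (sW w * sW w')%g.
Proof.
have [g Ng <-] := pi_onto w; have [h Nh <-] := pi_onto w'.
rewrite -pi_mul // !bsigP //; last exact: NS_mul.
by rewrite frobM pi_mul //; apply: NS_frob.
Qed.

Lemma sW1 : sW 1%g = 1%g.
Proof. by apply: (@mulgI _ (sW 1%g)); rewrite -sW_mul !mulg1. Qed.

Lemma TP_NS t : TP t -> NS t.
Proof. by have [_ _ h _] := bpiP I; apply: h. Qed.

Lemma TP_frob t : TP t -> TP (frob t).
Proof.
move=> ht; have Nt := TP_NS ht; have [_ _ _ h] := bpiP I.
apply/h; first exact: NS_frob.
have /h e := Nt; move/e: ht => e1.
by rewrite -bsigP // e1 sW1.
Qed.

Lemma filtered_frob c x u : ap x -> filtered_root_group pi act c x u ->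
  filtered_root_group pi act (fun i => c (fperm i)) (sA x) (frob u).
Proof.
move=> hx [Gu [u1 [u2 [y [h1 h2 Nm [hy fy] le]]]]]; split; first exact: root_group_frob.
have [a1 a2 a3] := bsAP I.
exists (frob u1), (frob u2), (sA y); split.
- exact: (root_group_frob h1).
- exact: (root_group_frob h2).
- by rewrite -!frobM; apply: NS_frob.
- by split; [apply: a1|rewrite -!frobM -bsigP // -a3 // fy].
have -> : pairing (fun i => c (fperm i)) (sA x) - pairing (fun i => c (fperm i)) (sA y) =
    pairing c x - pairing c y => //.
rewrite /pairing -!sumrB [RHS](reindex_inj (@perm_inj _ fperm)) /=.
apply: eq_bigr => i _; rewrite -!mulrBr; congr (_ * _).
have [_ h] := sA_paff; have := h _ _ hx hy => /rowP /(_ i).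
by rewrite !mxE.
Qed.

Lemma nontrivial_frob c : @nontrivial_chr D B c -> @nontrivial_chr D B (fun i => c (fperm i)).
Proof.
move=> [s Ss hs]; exists (frob s); first exact: SL_frob.
by rewrite chr_frob // fmorph_eq1.
Qed.

Lemma generated_frob (X Y : set 'M[L]_n) : (forall x, X x -> x \in unitmx) ->
  (forall x, X x -> generated Y (frob x)) ->
  forall g, generated X g -> generated Y (frob g).
Proof.
move=> uX XY g hg H sH YH; have [Hu H1 HM HV] := sH.
have : [set x | x \in unitmx /\ H (frob x)] g; last by case.
apply: hg => [|x Xx]; last by split; [apply: uX|apply: XY].
split=> [x []||x y [ux hx] [uy hy]|x [ux hx]] //.
- by split; [exact: unitmx1|rewrite /Defs.frob map_mx1].
- by split; [rewrite unitmx_mul ux uy|rewrite frobM; apply: HM].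
- by split; [rewrite unitmx_inv|rewrite frob_inv; apply: HV].
Qed.

Lemma generated_sub (X : set 'M[L]_n) x : X x -> generated X x.
Proof. by move=> Xx H _; apply. Qed.

Lemma generated_unit (X : set 'M[L]_n) g : (forall x, X x -> x \in unitmx) ->
  generated X g -> g \in unitmx.
Proof.
move=> uX hg; apply: (hg [set x | x \in unitmx]) => //; split=> [x //||x y /= ux uy|x /= ux].
- exact: unitmx1.
- by rewrite unitmx_mul ux uy.
- by rewrite unitmx_inv.
Qed.

Lemma parahoric_gen_unit x u :
  (TP `|` [set u | ptsL (gG B) u /\
     exists2 c, @nontrivial_chr D B c & filtered_root_group pi act c x u]) u -> u \in unitmx.
Proof.
by move=> [/TP_NS /NS_unit //|[Gu _]]; apply: (ptsL_unit gG_group Gu).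
Qed.

Lemma parahoric_frob x g : ap x -> parahoric_at pi act (gG B) x g ->
  parahoric_at pi act (gG B) (sA x) (frob g).
Proof.
move=> hx; apply: generated_frob => [u|u [ht|[Gu [c nc fc]]]].
- exact: parahoric_gen_unit.
- by apply: generated_sub; left; apply: TP_frob.
- apply: generated_sub; right; split; first exact/(ptsL_frob _ gG_def).
  by exists (fun i => c (fperm i)); [apply: nontrivial_frob|apply: filtered_frob].
Qed.

Lemma G1_frob g : bG1L I g -> bG1L I (frob g).
Proof.
apply: generated_frob => [u [P [h [x [Gh hx ->]]] [q hq <-]]|u [P [h [x [Gh hx ->]]] [q hq <-]]].
  have uh := ptsL_unit gG_group Gh.
  have uq := generated_unit (@parahoric_gen_unit x) hq.
  by rewrite !unitmx_mul uh uq unitmx_inv.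
apply: generated_sub; exists [set mx_conj (frob h) q | q in parahoric_at pi act (gG B) (sA x)].
  exists (frob h), (sA x); split=> //; first exact/(ptsL_frob _ gG_def).
  by have [a1 _ _] := bsAP I; apply: a1.
by exists (frob q); [apply: parahoric_frob|rewrite frob_conj].
Qed.

Lemma bWa_frob w : bWa I w -> bWa I (sW w).
Proof.
move=> [g [Ng Gg] <-]; exists (frob g); last by rewrite bsigP.
by split; [apply: NS_frob|apply: G1_frob].
Qed.

(** The determinant formula fixes the displacement times the multiplicity of the weight,
    independently of the point, and this multiplicity is nonzero. *)
Lemma T_translation t x y : ptsL (gT B) t -> ap x -> ap y ->
  act (pi t) x - x = act (pi t) y - y.
Proof.
move=> Tt hx hy; have [_ _ _ _ h5] := bactP I; apply/rowP => i.
have := h5 t i x Tt hx; rewrite -(h5 t i y Tt hy) => /eqP.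
rewrite eqr_pMn2r; first by move=> /eqP e; rewrite !mxE.
rewrite card_gt0; apply/set0Pn; exists i; rewrite inE; apply/asboolP => s _.
by [].
Qed.

End Apartment.
End Weights.

(* tau has finite order because it fixes p, hence so has sg on Wa by faithfulness. *)
Lemma frobenius_aut (R : realType) (n : nat) (E : set 'rV[R]_n) (W : groupType)
  (act : W -> 'rV[R]_n -> 'rV[R]_n) (ws : W -> 'S_n) (Wa : set W)
  (C : set 'rV[R]_n) (p : 'rV[R]_n) (S : cox_system E act ws Wa C p)
  (tau : 'rV[R]_n -> 'rV[R]_n) (ts : 'S_n) (sg : W -> W) :
  paff E tau ts -> tau p = p -> (forall w, Wa w -> Wa (sg w)) ->
  (forall w x, E x -> tau (act w x) = act (sg w) (tau x)) ->
  aut E act Wa tau ts sg.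
Proof.
move=> ht tp hW he; have Ep := base_E S.
have itE m x : E x -> E (iter m tau x) by move=> Ex; elim: m => //= m; apply: ht.1.
have tN x : E x -> iter n`! tau x = x.
  move=> Ex; rewrite (paff_translation ht Ep) //.
  have -> : iter n`! tau p = p by elim: (n`!) => //= m ->.
  by rewrite subrr addr0.
have itW m w : Wa w -> Wa (iter m sg w) by move=> Ww; elim: m => //= m; apply: hW.
have [N eN] : exists N, n`! = N.+1 by exists (n`!).-1; rewrite prednK ?fact_gt0.
split=> //.
- by move=> y Ey; exists (iter N tau y); [apply: itE|rewrite -iterS -eN tN].
- move=> w Ww; exists (iter N sg w); first exact: itW.
  rewrite -iterS -eN; apply: (faithful S) => // [|x Ex]; first exact: itW.
  have it m y : E y -> iter m tau (act w y) = act (iter m sg w) (iter m tau y).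
    move=> Ey; elim: m => //= m ->; rewrite he //; exact: itE.
  by rewrite -{1}(tN x Ex) -it // tN //; apply: (act_E S).
Qed.

(** * Straight classes *)

Section Main.
Variables (D : padic_datum) (B : group_datum D) (R : realType) (I : iw_datum B R).
Hypothesis hBT : bruhat_tits I.
Local Notation n := (gdim B).
Local Notation act := (bact I).
Local Notation sA := (bsA I).
Local Notation sW := (bsig I).
Local Notation j := (iwj I).
Local Notation NS := (ptsL (gNS B)).

Definition wperm (w : bW I) : 'S_n := projT1 (cid (act_paff w)).

Lemma wpermP w : paff (apt B R) (act w) (wperm w).
Proof. exact: projT2 (cid (act_paff w)). Qed.

Lemma iwC_point : exists p, [/\ iwC I p, iwCb I p & aptF I p].
Proof.
have [p [Ap hp eC]] := iwCP I.
have Cp : iwC I p.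
  rewrite eC; split=> // t _ H hH; rewrite /segment_pt -scalerDl subrK scale1r; exact: hp.
by exists p; split=> //; apply: iwC_Cb.
Qed.

Definition bpt : 'rV[R]_n := projT1 (cid iwC_point).

Lemma bptP : [/\ iwC I bpt, iwCb I bpt & aptF I bpt].
Proof. exact: projT2 (cid iwC_point). Qed.

Lemma cox_L : cox_system (apt B R) act wperm (bWa I) (iwCb I) bpt.
Proof.
have [_ h1 hM _ _] := bactP I; split=> //.
- exact: apt_affine.
- exact: wpermP.
- exact: bt_affineL hBT.
- exact: iwCbP.
- by have [] := bptP.
Qed.

Lemma jM w u : j (w * u)%g = (j w * j u)%g.
Proof. exact: (bt_morph hBT). Qed.

Lemma j1 : j 1%g = 1%g.
Proof. by apply: (@mulgI _ (j 1%g)); rewrite -jM !mulg1. Qed.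

Lemma jV w : j w^-1%g = (j w)^-1%g.
Proof. by apply: (@mulgI _ (j w)); rewrite -jM !mulgV j1. Qed.

Lemma j_fixed w : sW (j w) = j w.
Proof.
have : range j (j w) by exists w.
by rewrite (bt_W hBT).
Qed.

Lemma cox_F : cox_system (aptF I) (fun w => act (j w)) (fun w => wperm (j w))
  (@iwWa D B R I) (iwC I) bpt.
Proof.
have S := cox_L; have [a1 _ a3] := bsAP I.
have sAp := sA_paff (iwB I).
split.
- move=> x y z a [Ex /= fx] [Ey /= fy] [Ez /= fz]; split; first exact: (apt_affine a Ex Ey Ez).
  have dyz : dir (apt B R) (a *: (y - z)).
    exact: (dirZ a (@apt_affine _ B R) (dirB (@apt_affine _ B R) Ey Ez)).
  by rewrite /= (paff_add sAp dyz Ex) linearZ /= -sAp.2 // fx fy fz.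
- move=> w; have [h1 h2] := wpermP (j w); split=> [x [Ex /= fx]|x y [Ex _] [Ey _]]; last exact: h2.
  by split; [apply: h1|rewrite /= a3 // fx j_fixed].
- by move=> x [Ex _]; rewrite j1; apply: (cs_act1 S).
- by move=> w w' x [Ex _]; rewrite jM; apply: (cs_actM S).
- exact: bt_affineF hBT.
- exact: iwCP.
- by have [] := bptP.
Qed.

Lemma frob_aut : aut (apt B R) act (bWa I) sA (fperm B) sW.
Proof.
have [_ _ a3] := bsAP I.
apply: (frobenius_aut cox_L) => //; first exact: sA_paff.
  by have [_ _ [_ ]] := bptP.
exact: bWa_frob.
Qed.

Lemma fixed_iwWa g : bWa I g -> sW g = g -> exists2 w, @iwWa D B R I w & j w = g.
Proof.
move=> Wg fg; have : (bWa I `&` [set w | sW w = w]) g by [].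
by rewrite -(bt_Wa hBT).
Qed.

(** [j x] is Frobenius-fixed, so the twisted product is an ordinary power. *)
Lemma straight_sig (x : iwW I) : straight x -> sig_straight (j x).
Proof.
move=> hx m; have e i : iter i sW (j x) = j x by elim: i => //= i ->; apply: j_fixed.
rewrite (eq_bigr (fun=> j x)) => [|i _]; last exact: e.
rewrite prodg_const card_ord.
exact: (trace_straight cox_L frob_aut cox_F fixed_iwWa jM j1 hx m).
Qed.

Lemma straight_chain (x : iwW I) : straight x -> chain (apt B R) act (bWa I) bpt (j x).
Proof.
move=> hx; apply/(straight_chainP cox_L) => m.
exact: (trace_straight cox_L frob_aut cox_F fixed_iwWa jM j1 hx m).
Qed.

Lemma weyl_times_torus w : exists a t, [/\ bWa I a, ptsL (gT B) t & w = (a * bpi I t)%g].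
Proof.
have [g Ng <-] := pi_onto w; have [m [t [Nm Gm Tt ->]]] := bt_weyl hBT Ng.
exists (bpi I m), t; split=> //; first by exists m.
by rewrite pi_mul //; apply: T_NS.
Qed.

Lemma torus_commute s t : ptsL (gT B) s -> ptsL (gT B) t -> s *m t = t *m s.
Proof.
move=> Ts Tt; have := bt_torus hBT Ts Tt; rewrite -!map_mxM => /matrixP e.
by apply/matrixP => i k; have := e i k; rewrite !mxE => /fmorph_inj.
Qed.

(** Every element is the product of one in the normal subgroup [Wa] and one in the image of the
    commutative group [T]. *)
Lemma commutator_Wa a b : bWa I (a * b * a^-1 * b^-1)%g.
Proof.
have S := cox_L.
have [a1 [s [Wa1 Ts ->]]] := weyl_times_torus a; have [b1 [t [Wb1 Tt ->]]] := weyl_times_torus b.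
have Ns := T_NS Ts; have Nt := T_NS Tt.
have : (bpi I s * bpi I t = bpi I t * bpi I s)%g.
  by rewrite -!pi_mul // (torus_commute Ts Tt).
move: (bpi I s) (bpi I t) => x y xy.
have yx : (x^-1 * y = y * x^-1)%g by apply: (@mulgI _ x); rewrite !mulgA mulgV mul1g xy mulgK.
have -> : (a1 * x * (b1 * y) * (a1 * x)^-1 * (b1 * y)^-1 =
    a1 * (x * b1 * x^-1) * (y * a1^-1 * y^-1) * b1^-1)%g.
  by rewrite !invMg !mulgA -(mulgA _ y x^-1%g) -yx !mulgA.
apply: (WaM S); last exact: (WaV S).
apply: (WaM S); last by apply: (WaJ S); apply: (WaV S).
by apply: (WaM S) => //; apply: (WaJ S).
Qed.

Lemma bpt_fixed : sA bpt = bpt.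
Proof. by have [_ _ []] := bptP. Qed.

Definition orbit (x : bW I) : set (bW I) := [set (w * x * (sW w)^-1)%g | w in bWa I].

Lemma orbit_self x : orbit x x.
Proof. by exists 1%g; [apply: (Wa1 cox_L)|rewrite sW1 mul1g invg1 mulg1]. Qed.

Lemma orbit_eq x y : orbit x y -> orbit y = orbit x.
Proof.
have S := cox_L; move=> [w Ww <-]; apply/seteqP; split=> [_ [u Wu <-]|_ [u Wu <-]].
  by exists (u * w)%g; [apply: (WaM S)|rewrite sW_mul invMg !mulgA].
exists (u * w^-1)%g; first by apply: (WaM S) => //; apply: (WaV S).
have e : (sW (u * w^-1) * sW w = sW u)%g by rewrite -sW_mul mulgVK.
by rewrite -e invMg !mulgA mulgVK.
Qed.

Lemma class_in_orbit (x g : iwW I) : straight x -> orbit (j x) (j (g * x * g^-1)%g).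
Proof.
move=> hx; have [a [t [Ha Tt eg]]] := weyl_times_torus (j g).
have [_ _ [Ap _]] := bptP.
have ht y : apt B R y -> act (bpi I t) y = y + (act (bpi I t) bpt - bpt).
  by move=> Ay; rewrite (T_translation I Tt Ap Ay) addrCA subrr addr0.
have [w Ww e] := conj_orbit cox_L frob_aut (@sW_mul _ _ _ _) bpt_fixed
  commutator_Wa (j_fixed x) (straight_chain hx) (j_fixed g) Ha eg ht.
by exists w => //; rewrite e !jM jV.
Qed.

Lemma orbit_class (x x' : iwW I) : straight x -> straight x' -> orbit (j x) (j x') ->
  exists v, x' = (v * x * v^-1)%g.
Proof.
move=> hx hx' [w Ww e].
have [v [Wv fv ev]] := conj_descent cox_L frob_aut (@sW_mul _ _ _ _)
  bpt_fixed (j_fixed x) (straight_chain hx)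
  (j_fixed x') (straight_chain hx') Ww e.
have [u _ eu] := fixed_iwWa Wv fv; exists u.
by apply: (bt_inj hBT); rewrite !jM jV eu.
Qed.

End Main.

Theorem theorem1 (D : padic_datum) (B : group_datum D) (R : realType)
    (I : iw_datum B R) (hBT : bruhat_tits I) :
  exists i : set (iwW I) -> set (bW I),
    (forall nu, straight_class nu ->
       [/\ straight_orbit (i nu),
           [set iwj I w | w in nu] `<=` i nu &
           forall o, straight_orbit o -> [set iwj I w | w in nu] `<=` o ->
             o = i nu]) /\
    (forall nu nu', straight_class nu -> straight_class nu' ->
       i nu = i nu' -> nu = nu').
Proof.
(* An arbitrary straight element; the default [1%g] is not reached for a straight class. *)
pose rep (nu : set (iwW I)) := xget 1%g [set x | nu x /\ straight x].
have repP nu : straight_class nu -> nu (rep nu) /\ straight (rep nu).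
  move=> [_ [x nx sx]]; rewrite /rep; case: xgetP => [y _ []|/(_ x)] //.
  by case.
have classE (nu : set (iwW I)) x : conj_class nu -> nu x -> nu = [set (g * x * g^-1)%g | g in setT].
  move=> [y ->] [h _ <-]; apply/seteqP; split=> [_ [g _ <-]|_ [g _ <-]].
    by exists (g * h^-1)%g => //; rewrite invMg invgK !mulgA !mulgVK.
  by exists (g * h)%g => //; rewrite invMg !mulgA.
exists (fun nu => orbit (iwj I (rep nu))); split=> [nu hnu|nu nu' hnu hnu' e].
  have [nr sr] := repP nu hnu; split.
  - split; first by exists (iwj I (rep nu)).
    by exists (iwj I (rep nu)); [apply: orbit_self|apply: straight_sig].
  - move=> _ [w nw <-]; have := nw; rewrite {1}(classE _ _ hnu.1 nr) => -[g _ <-].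
    exact: (class_in_orbit hBT _ sr).
  (* An orbit containing the class contains the image of [rep nu], and orbits with a common point
     coincide. *)
  move=> o [[z ->] _] sub; symmetry; apply: (orbit_eq hBT); apply: sub.
  by exists (rep nu).
have [nr sr] := repP nu hnu; have [nr' sr'] := repP nu' hnu'.
have [|v ev] := orbit_class hBT sr sr'; first by rewrite e; apply: orbit_self.
rewrite (classE _ _ hnu'.1 nr'); apply: (classE _ _ hnu.1).
by rewrite (classE _ _ hnu.1 nr); exists v.
Qed.
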